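(* Assume the Markov semigroup $(P_t)$ on the Polish space $(E,\rho)$ is Feller, and that: (1) there exist a measurable $V:E\to[0,\infty)$ and constants $\gamma>0$, $K>0$ such that $P_tV(x)\le V(x)-\gamma\int_0^tP_sV(x)\,ds+Kt$ for all $t\ge0$, $x\in E$; (2) $\rho\wedge1\le\theta$ for a premetric $\theta$; (3) Assumption A holds (with this $\theta$) for some functions $r,L$; (4* ) Assumption B2 holds (with this $\theta$) for some function $R$, the set $B=\{V\le 4K/\gamma\}$ and some $\varepsilon>0$. Then $(P_t)$ has a unique invariant probability measure $\pi$, and for any $\delta\in(0,1)$ there exist constants $C_1,C_2>0$ such that for all $x\in E$, $t\ge0$, $$W_{\rho\wedge1}(P_t(x,\cdot),\pi)\le\frac{C_1(1+\phi(V(x))^\delta)}{\phi(H_\phi^{-1}(C_2t))^\delta},\qquad \phi(u)=\gamma u,\quad H_\phi(x)=\int_1^x\frac{du}{\phi(u)}.$$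
   Context: $(E,\rho)$ Polish, $(P_t)$ a Markov transition function with semigroup $P_t\phi(x)=\int\phi(y)P_t(x,dy)$, $\mathbb P_x$ the law of the Markov process started at $x$. Feller: $P_t$ maps bounded continuous functions to bounded continuous functions. A premetric is a lower semicontinuous $\theta:E\times E\to\mathbb R_+$ with $\theta(x,y)=0\iff x=y$. $W_d(\mu,\nu):=\inf\int d\,d\lambda$ over couplings $\lambda$ of $\mu,\nu$; $d_{TV}(\mu,\nu)=\sup_A|\mu(A)-\nu(A)|$. Assumption A: there exist a non-increasing $r:\mathbb R_+\to\mathbb R_+$ with $r(t)\to0$ and a locally bounded $L:\mathbb R_+\to\mathbb R_+$ such that for any $x,y\in E$ there exist random processes $X^{x,y},Y^{x,y}$ on a common probability space with (1) $\mathrm{Law}(X^{x,y})=\mathbb P_x$ and $d_{TV}(\mathrm{Law}(Y^{x,y}_t),P_t(y,\cdot))\le L(t)\theta(x,y)$, $t\ge0$; (2) $\mathbb E\theta(X^{x,y}_t,Y^{x,y}_t)\le r(t)\theta(x,y)$, $t\ge0$. Assumption B2 (for a set $B$, a non-increasing $R:\mathbb R_+\to\mathbb R_+$ with $R(t)\to0$, and $\varepsilon>0$): for any $x,y\in B$ there exist random processes $X^{x,y},Y^{x,y}$ on a common probability space with (1) $\mathrm{Law}(X^{x,y})=\mathbb P_x$ and $d_{TV}(\mathrm{Law}(Y^{x,y}_t),P_t(y,\cdot))\le1-\varepsilon$, $t\ge0$; (2) $\mathbb E\theta(X^{x,y}_t,Y^{x,y}_t)\le R(t)$, $t\ge0$.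 *)

(* Defs.v *)
From HB Require Import structures.
From mathcomp Require Import all_boot all_order all_algebra.
From mathcomp Require Import all_classical all_reals all_analysis measurable_realfun.
Set Implicit Arguments.
Unset Strict Implicit.
Unset Printing Implicit Defensive.
Import Order.TTheory GRing.Theory Num.Theory.
Import numFieldNormedType.Exports.
Local Open Scope classical_set_scope.
Local Open Scope ring_scope.

Section Defs.
Context {R : realType} {d : measure_display} {E : measurableType d}.
Variable rho : E -> E -> R.

Definition is_metric :=
  [/\ forall x y, 0 <= rho x y,
      forall x y, rho x y = 0 <-> x = y,
      forall x y, rho x y = rho y x &
      forall x y z, rho x z <= rho x y + rho y z].

Definition rho_cauchy (u : nat -> E) :=
  forall e : R, 0 < e -> exists N, forall m n, (N <= m)%N -> (N <= n)%N ->
    rho (u m) (u n) < e.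

Definition rho_converges (u : nat -> E) (x : E) :=
  forall e : R, 0 < e -> exists N, forall n, (N <= n)%N -> rho (u n) x < e.

Definition rho_complete :=
  forall u : nat -> E, rho_cauchy u -> exists x, rho_converges u x.

(* separable: a dense sequence (E is nonempty) *)
Definition rho_separable :=
  exists s : nat -> E, forall x (e : R), 0 < e -> exists n, rho x (s n) < e.

Definition rho_open (U : set E) :=
  forall x, U x -> exists2 e : R, 0 < e & forall y, rho x y < e -> U y.

Definition rho_borel := forall A : set E, measurable A <-> <<s rho_open >> A.

Definition polish :=
  [/\ is_metric, rho_complete, rho_separable & rho_borel].

Definition rho_continuous (f : E -> R) :=
  forall x (e : R), 0 < e -> exists2 del : R, 0 < del &
    forall y, rho x y < del -> `|f y - f x| < e.

Definition bounded_fun (f : E -> R) := exists M : R, forall x, `|f x| <= M.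

Definition premetric (theta : E -> E -> R) :=
  [/\ forall x y, 0 <= theta x y,
      forall x y, theta x y = 0 <-> x = y &
      forall x y (c : R), c < theta x y -> exists2 del : R, 0 < del &
        forall x' y', rho x x' < del -> rho y y' < del -> c < theta x' y'].
End Defs.

Section Markov.
Context {R : realType} {d : measure_display} {E : measurableType d}.
Local Open Scope ereal_scope.

Definition markov_tf (P : R -> E -> probability E R) :=
  [/\ forall t A, (0 <= t)%R -> measurable A ->
        measurable_fun [set: E] ((fun x => P t x A) : E -> \bar R),
      forall x A, measurable A -> P 0%R x A = \d_x A &
      forall s t x A, (0 <= s)%R -> (0 <= t)%R -> measurable A ->
        P (s + t)%R x A = \int[P s x]_y P t y A].

Definition Psg (P : R -> E -> probability E R) (t : R) (f : E -> R) (x : E)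
  : R := fine (\int[P t x]_y (f y)%:E).

Definition feller (rho : E -> E -> R) (P : R -> E -> probability E R) :=
  forall t (f : E -> R), (0 <= t)%R -> bounded_fun f -> rho_continuous rho f ->
    bounded_fun (Psg P t f) /\ rho_continuous rho (Psg P t f).

(* finite-dimensional distributions of the Markov process started at x:
   for a list [(dt_1,A_1);...;(dt_n,A_n)] of time increments and sets,
   fdd l x = P_x(X_{t_1} in A_1, ..., X_{t_n} in A_n), t_k = dt_1+...+dt_k *)
Fixpoint fdd (P : R -> E -> probability E R) (l : seq (R * set E)) (x : E)
  : \bar R :=
  match l with
  | [::] => 1
  | (dt, A) :: l' => \int[P dt x]_(y in A) fdd P l' y
  end.

Fixpoint fdd_event {T : Type} (X : R -> T -> E) (s : R) (l : seq (R * set E))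
  (w : T) : Prop :=
  match l with
  | [::] => True
  | (dt, A) :: l' => A (X (s + dt)%R w) /\ fdd_event X (s + dt)%R l' w
  end.

(* Law(X) = P_x : X is a process (indexed by t >= 0) whose law on the
   product sigma-algebra of E^[0,oo) is that of the Markov process with
   transition function P started at x, i.e. whose finite-dimensional
   distributions are those of P_x. *)
Definition law_is_Px {dO : measure_display} {O : measurableType dO}
  (Pr : probability O R) (X : R -> O -> E) (P : R -> E -> probability E R)
  (x : E) :=
  (forall t, (0 <= t)%R -> measurable_fun [set: O] (X t)) /\
  forall l : seq (R * set E),
    all (fun p => (0 <= p.1)%R) l -> (forall p, p \in l -> measurable p.2) ->
    Pr (fdd_event X 0%R l) = fdd P l x.

Definition dTV (mu nu : set E -> \bar R) : \bar R :=
  ereal_sup [set `|mu A - nu A| | A in [set A : set E | measurable A]].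

Definition coupling (mu nu : set E -> \bar R) (lam : probability (E * E)%type R) :=
  (forall A, measurable A -> lam (A `*` setT) = mu A) /\
  (forall A, measurable A -> lam (setT `*` A) = nu A).

Definition wasserstein (c : E -> E -> R) (mu nu : set E -> \bar R) : \bar R :=
  ereal_inf [set \int[lam]_z (c z.1 z.2)%:E |
             lam in [set lam | coupling mu nu lam]].

Definition is_invariant (P : R -> E -> probability E R) (pi : probability E R) :=
  forall t A, (0 <= t)%R -> measurable A -> \int[pi]_x P t x A = pi A.

Definition assumptionA (P : R -> E -> probability E R) (theta : E -> E -> R)
  (r L : R -> R) :=
  [/\ (forall t, (0 <= t)%R -> (0 <= r t)%R),
      (forall s t, (0 <= s)%R -> (s <= t)%R -> (r t <= r s)%R),
      r t @[t --> +oo%R] --> 0%R,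
      (forall t, (0 <= t)%R -> (0 <= L t)%R) /\
      (forall T, exists M : R, forall t, (0 <= t <= T)%R -> (L t <= M)%R) &
      forall x y, exists (dO : measure_display) (O : measurableType dO)
        (Pr : probability O R) (X Y : R -> O -> E),
        [/\ law_is_Px Pr X P x,
            (forall t, (0 <= t)%R -> measurable_fun [set: O] (Y t)),
            (forall t, (0 <= t)%R ->
               dTV (pushforward Pr (Y t)) (P t y) <= (L t * theta x y)%:E) &
            (forall t, (0 <= t)%R ->
               \int[Pr]_w (theta (X t w) (Y t w))%:E <= (r t * theta x y)%:E)]].

Definition assumptionB2 (P : R -> E -> probability E R) (theta : E -> E -> R)
  (B : set E) (Rf : R -> R) (eps : R) :=
  [/\ (forall t, (0 <= t)%R -> (0 <= Rf t)%R),
      (forall s t, (0 <= s)%R -> (s <= t)%R -> (Rf t <= Rf s)%R),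
      Rf t @[t --> +oo%R] --> 0%R,
      (0 < eps)%R &
      forall x y, B x -> B y -> exists (dO : measure_display) (O : measurableType dO)
        (Pr : probability O R) (X Y : R -> O -> E),
        [/\ law_is_Px Pr X P x,
            (forall t, (0 <= t)%R -> measurable_fun [set: O] (Y t)),
            (forall t, (0 <= t)%R ->
               dTV (pushforward Pr (Y t)) (P t y) <= (1 - eps)%:E) &
            (forall t, (0 <= t)%R ->
               \int[Pr]_w (theta (X t w) (Y t w))%:E <= (Rf t)%:E)]].
End Markov.

Definition H_phi {R : realType} (phi : R -> R) (z : R) : R :=
  fine (\int[@lebesgue_measure R]_(u in `[1%R, z]) (1 / phi u)%:E)%E.

Definition H_phi_inv {R : realType} (phi : R -> R) (y : R) : R :=
  xget 1%R [set z : R | (1 <= z)%R /\ H_phi phi z = y].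

(* Main.v *)
(* Fix delta and consider, for c = min (N theta) 1, the weighted cost
     W(x, y) = c(x, y)^(1 - delta) (1 + b (V x + V y))^delta.
   A generalised coupling becomes a genuine coupling once the total variation
   defect is paid for in the cost c <= 1, and a Hoelder-type inequality turns
   E c and E V into a bound on E W.  Assumption A then contracts W when c < 1,
   Assumption B2 contracts it when c = 1 and V is small at both points, and the
   Lyapunov condition contracts it when V is large, all for one time T and one
   weight b.  Hence P_T maps functions that are a-Lipschitz for W to functions
   that are (al a)-Lipschitz with al < 1.  Since min rho 1 <= c <= W, the laws
   P_n(x, .) form a summable Cauchy sequence in the dual bounded-Lipschitz
   distance, which converges because a Polish space is complete; the Feller
   property makes the limit invariant.  Kantorovich-Rubinstein duality, obtained
   from finite transport duality by discretisation, converts the dual bound into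
   the Wasserstein bound, and for phi u = gamma u the stated rate is exponential
   because the inverse of H_phi is y |-> exp (gamma y). *)

Require Import Defs.
From HB Require Import structures.
From mathcomp Require Import all_boot all_order all_algebra.
From mathcomp Require Import all_classical all_reals all_analysis measurable_realfun giry.
From mathcomp Require Import ring lra.
Set Implicit Arguments.
Unset Strict Implicit.
Unset Printing Implicit Defensive.
Import Order.TTheory GRing.Theory Num.Theory.
Import numFieldNormedType.Exports.
Local Open Scope classical_set_scope.
Local Open Scope ring_scope.

(** * Finite transport duality *)

Section sublinear.
Variables (R : realType) (U : lmodType R).
Implicit Types (p q : U -> R) (u v w : U).

Definition sublinear p :=
  (forall u v, p (u + v) <= p u + p v) /\
  (forall a u, 0 <= a -> p (a *: u) = a * p u).

Lemma sublinear0 p : sublinear p -> p 0 = 0.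
Proof. by case=> _ pZ; rewrite -(scale0r 0) pZ// mul0r. Qed.

Lemma sublinear_le_scale p : p 0 = 0 -> (forall u v, p (u + v) <= p u + p v) ->
  (forall a u, 0 < a -> p (a *: u) <= a * p u) -> sublinear p.
Proof.
move=> p0 pD pZ; split=> // a u; rewrite le_eqVlt => /predU1P[<-|a_gt0].
  by rewrite scale0r mul0r p0.
apply/eqP; rewrite eq_le pZ//=.
have := pZ a^-1 (a *: u); rewrite invr_gt0 => /(_ a_gt0).
by rewrite scalerA mulVf ?gt_eqF// scale1r ler_pdivlMl.
Qed.

Lemma sublinear_opp_ge p u : sublinear p -> - p (- u) <= p u.
Proof.
move=> sp; have := sp.1 u (- u); rewrite subrr (sublinear0 sp).
by rewrite -subr_le0 sub0r; lra.
Qed.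

Lemma sublinearZ_opp p v a : sublinear p -> p (- v) = - p v ->
  p (a *: v) = a * p v.
Proof.
move=> sp pv; have [a0|a0] := leP 0 a; first exact: sp.2.
by rewrite -[a]opprK scaleNr -scalerN sp.2 ?oppr_ge0 ?ltW// pv; ring.
Qed.

Lemma sublinear_sum p I (r : seq I) (F : I -> U) : sublinear p ->
  p (\sum_(i <- r) F i) <= \sum_(i <- r) p (F i).
Proof.
move=> sp; elim: r => [|i r IH]; first by rewrite !big_nil (sublinear0 sp).
by rewrite !big_cons (le_trans (sp.1 _ _))// lerD2l.
Qed.

(* The largest minorant of p that keeps its value at v and is additive along v:
   q u = inf_(t >= 0) (p (u + t v) - t p v). *)
Lemma sublinear_minorant_along p v : sublinear p -> exists q,
  [/\ sublinear q, forall u, q u <= p u, q v = p v & q (- v) = - p v].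
Proof.
move=> sp; have [pD pZ] := sp.
pose S u := [set p (u + t *: v) - t * p v | t in [set t : R | 0 <= t]].
have infS u : has_inf (S u).
  split; first by exists (p (u + 0 *: v) - 0 * p v); exists 0 => /=.
  exists (- p (- u)) => _ [t /= t0 <-]; rewrite -pZ//.
  have := pD (u + t *: v) (- u); rewrite addrAC subrr add0r; lra.
pose q u := inf (S u).
have q_le u t : 0 <= t -> q u <= p (u + t *: v) - t * p v.
  by move=> t0; apply: (ge_inf (infS u).2); exists t.
have le_q u (x : R) : (forall t, 0 <= t -> x <= p (u + t *: v) - t * p v) -> x <= q u.
  by move=> x_le; apply: lb_le_inf; [exact: (infS u).1|move=> _ [t t0 <-]; exact: x_le].
have q_le_p u : q u <= p u.
  by have := q_le u 0 (lexx _); rewrite scale0r addr0 mul0r subr0.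
have sq : sublinear q.
  apply: sublinear_le_scale => [|u w|a u a_gt0].
  - apply/eqP; rewrite eq_le -{1}(sublinear0 sp) q_le_p/=.
    by apply: (le_q) => t t0; rewrite add0r pZ// subrr.
  - rewrite -lerBlDr; apply: (le_q) => t t0.
    rewrite lerBlDr -lerBlDl; apply: (le_q) => s s0.
    rewrite lerBlDl; apply: (le_trans (q_le _ (t + s) (addr_ge0 t0 s0))).
    have := pD (u + t *: v) (w + s *: v); rewrite addrACA -scalerDl mulrDl; lra.
  - rewrite mulrC -ler_pdivrMr//; apply: (le_q) => t t0.
    rewrite ler_pdivrMr// mulrC.
    apply: (le_trans (q_le _ (a * t) (mulr_ge0 (ltW a_gt0) t0))).
    by rewrite -scalerA -scalerDr (pZ _ _ (ltW a_gt0)) mulrBr -mulrA.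
have qNv : q (- v) <= - p v.
  by have := q_le (- v) 1 ler01; rewrite scale1r addNr (sublinear0 sp) mul1r sub0r.
have := sublinear_opp_ge v sq; exists q; split=> //.
- by apply/eqP; rewrite eq_le q_le_p/=; lra.
- by apply/eqP; rewrite eq_le qNv/=; have := q_le_p v; lra.
Qed.

Lemma sublinear_minorant_opp p q v : sublinear q -> (forall u, q u <= p u) ->
  p (- v) = - p v -> q v = p v /\ q (- v) = - p v.
Proof.
move=> sq qp pv; have := sublinear_opp_ge v sq; have := qp v; have := qp (- v).
rewrite pv => qNv_le qv_le qv_ge.
by split; apply/eqP; rewrite eq_le ?qNv_le ?qv_le/=; lra.
Qed.

Lemma sublinear_minorant_seq p (s : seq U) : sublinear p -> exists q,
  [/\ sublinear q, forall u, q u <= p u & {in s, forall v, q (- v) = - q v}].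
Proof.
move=> sp; elim: s => [|v s [q [sq qp qs]]]; first by exists p; split=> //.
have [q' [sq' q'q q'v q'Nv]] := sublinear_minorant_along v sq.
exists q'; split=> // [u|w]; first exact: le_trans (q'q u) (qp u).
rewrite in_cons => /predU1P[->|ws]; first by rewrite q'Nv q'v.
by have [-> ->] := sublinear_minorant_opp sq' q'q (qs _ ws).
Qed.

End sublinear.

Section finite_hahn_banach.
Variables (R : realType) (I : finType).
Implicit Types (p : (I -> R) -> R) (f : I -> R).

Let delta (i : I) : I -> R := fun j => (i == j)%:R.

Let sum_delta f : f = \sum_i f i *: delta i.
Proof.
apply/funext => j; rewrite fct_sumE.
have scale_delta i : (f i *: delta i) j = f i * (i == j)%:R by [].
rewrite (bigD1 j)//= big1 => [|i /negPf ij]; last by rewrite scale_delta ij mulr0.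
by rewrite scale_delta eqxx mulr1 addr0.
Qed.

Lemma finite_hahn_banach p f : sublinear p -> exists l : I -> R,
  (forall g, \sum_i g i * l i <= p g) /\ \sum_i f i * l i = p f.
Proof.
move=> sp; have [p' [sp' p'p p'f p'Nf]] := sublinear_minorant_along f sp.
have [q [sq qp' qN]] := sublinear_minorant_seq (codom delta) sp'.
have [qf _] := sublinear_minorant_opp sq qp' (etrans p'Nf (congr1 _ (esym p'f))).
have qZ g i : q (g i *: delta i) = g i * q (delta i).
  by rewrite sublinearZ_opp// qN// codom_f.
have q_le g : q g <= \sum_i g i * q (delta i).
  rewrite {1}(sum_delta g); apply: le_trans (sublinear_sum _ _ sq) _.
  by apply: ler_sum => i _; rewrite qZ.
have qE g : \sum_i g i * q (delta i) = q g.
  apply/eqP; rewrite eq_le q_le andbT; apply: le_trans (sublinear_opp_ge g sq).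
  rewrite lerNr; apply: le_trans (q_le _) _; rewrite -sumrN.
  by apply: ler_sum => i _; rewrite mulNr.
exists (fun i => q (delta i)); split=> [g|]; rewrite qE ?qf ?p'f//.
exact: le_trans (qp' g) (p'p g).
Qed.

End finite_hahn_banach.

Section transport_duality.
Variables (R : realType) (I J : finType) (a : I -> R) (b : J -> R).
Hypotheses (a_ge0 : forall i, 0 <= a i) (b_ge0 : forall j, 0 <= b j).
Hypotheses (sum_a : \sum_i a i = 1) (sum_b : \sum_j b j = 1).
Implicit Types (f : I -> R) (g : J -> R) (h : I * J -> R).

Let potential_value f g := \sum_i a i * f i + \sum_j b j * g j.

Let potential_above h (fg : (I -> R) * (J -> R)) :=
  forall i j, h (i, j) <= fg.1 i + fg.2 j.

Let price h :=
  inf [set potential_value fg.1 fg.2 | fg in potential_above h].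

Let potential_valueN f g :
  potential_value (fun i => - f i) (fun j => - g j) = - potential_value f g.
Proof.
rewrite /potential_value opprD -!sumrN.
by congr (_ + _); apply: eq_bigr => i _; rewrite mulrN.
Qed.

Let potential_value0 : potential_value (fun=> 0) (fun=> 0) = 0.
Proof. by rewrite /potential_value !big1 ?addr0// => i _; rewrite mulr0. Qed.

Let potential_value_ge h f g : potential_above h (f, g) ->
  \sum_i \sum_j a i * b j * h (i, j) <= potential_value f g.
Proof.
move=> h_le; have -> : potential_value f g = \sum_i \sum_j a i * b j * (f i + g j).
  transitivity (\sum_i \sum_j (a i * f i * b j + a i * (b j * g j))).
    under [RHS]eq_bigr do rewrite big_split/= -!mulr_sumr sum_b mulr1.
    by rewrite big_split/= -mulr_suml sum_a mul1r.
  by apply: eq_bigr => i _; apply: eq_bigr => j _; ring.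
apply: ler_sum => i _; apply: ler_sum => j _.
by rewrite ler_wpM2l// ?mulr_ge0//; exact: h_le.
Qed.

Let has_inf_price h :
  has_inf [set potential_value fg.1 fg.2 | fg in potential_above h].
Proof.
split; last by eexists => _ [[f g] + <-]; exact: potential_value_ge.
pose f (_ : I) := \sum_ij `|h ij|.
exists (potential_value f (fun=> 0)), (f, fun=> 0) => //= i j /=.
rewrite addr0 /f (bigD1 (i, j))//=; apply: le_trans (ler_norm _) _.
by rewrite lerDl sumr_ge0.
Qed.

Let price_le h f g : potential_above h (f, g) -> price h <= potential_value f g.
Proof. by move=> ?; apply: (ge_inf (has_inf_price h).2); exists (f, g). Qed.

Let le_price h (x : R) :
  (forall f g, potential_above h (f, g) -> x <= potential_value f g) -> x <= price h.
Proof.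
move=> x_le; apply: lb_le_inf; first exact: (has_inf_price h).1.
by move=> _ [[f g] ? <-]; exact: x_le.
Qed.

Let sublinear_price : sublinear price.
Proof.
apply: sublinear_le_scale => [|h1 h2|k h k_gt0].
- apply/eqP; rewrite eq_le -{1}potential_value0 price_le => [/=|i j /=]; last first.
    by rewrite addr0.
  apply: le_price => f g /potential_value_ge; apply: le_trans.
  by rewrite big1// => i _; rewrite big1// => j _; rewrite mulr0.
- rewrite -lerBlDr; apply: le_price => f1 g1 le1.
  rewrite lerBlDr -lerBlDl; apply: le_price => f2 g2 le2; rewrite lerBlDl.
  have -> : potential_value f1 g1 + potential_value f2 g2 =
      potential_value (f1 \+ f2) (g1 \+ g2).
    rewrite /potential_value addrACA -!big_split/=.
    by congr (_ + _); apply: eq_bigr => i _; rewrite mulrDr.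
  by apply: price_le => i j /=; rewrite addrACA; exact: lerD (le1 i j) (le2 i j).
- rewrite mulrC -ler_pdivrMr//; apply: le_price => f g le_h.
  rewrite ler_pdivrMr// mulrC.
  have -> : k * potential_value f g = potential_value (k \*o f) (k \*o g).
    rewrite /potential_value mulrDr !mulr_sumr.
    by congr (_ + _); apply: eq_bigr => i _; rewrite mulrCA.
  apply: price_le => i j /=; rewrite -mulrDr.
  exact: ler_wpM2l (ltW k_gt0) _ _ (le_h i j).
Qed.

Let sum_pairing h (l : I * J -> R) :
  \sum_ij h ij * l ij = \sum_i \sum_j h (i, j) * l (i, j).
Proof.
by rewrite (pair_bigA _ (fun i j => h (i, j) * l (i, j))); apply: eq_bigr => -[].
Qed.

Let sum_indicator (K : finType) (k : K) (F : K -> R) :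
  \sum_m (m == k)%:R * F m = F k.
Proof.
rewrite (bigD1 k)//= eqxx mul1r big1 ?addr0// => m /negPf ->.
by rewrite mul0r.
Qed.

Let price_minorant_potential (l : I * J -> R) f g :
  (forall h, \sum_ij h ij * l ij <= price h) ->
  \sum_i \sum_j (f i + g j) * l (i, j) = potential_value f g.
Proof.
move=> l_le.
have l_le_value f' g' : \sum_i \sum_j (f' i + g' j) * l (i, j) <= potential_value f' g'.
  rewrite -(sum_pairing (fun ij => f' ij.1 + g' ij.2)).
  by apply: le_trans (l_le _) _; exact: price_le.
apply/eqP; rewrite eq_le l_le_value/= -lerN2 -potential_valueN.
rewrite (le_trans _ (l_le_value _ _))// -sumrN ler_sum// => i _.
by rewrite -sumrN ler_sum// => j _; rewrite -opprD mulNr.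
Qed.

Let price_minorant_marginals (l : I * J -> R) :
  (forall h, \sum_ij h ij * l ij <= price h) ->
  (forall i, \sum_j l (i, j) = a i) /\ (forall j, \sum_i l (i, j) = b j).
Proof.
move=> l_le; split=> [i|j].
- have <- : potential_value (fun k => (k == i)%:R) (fun=> 0) = a i.
    rewrite /potential_value [X in _ + X]big1 ?addr0 => [|j _]; last by rewrite mulr0.
    by under eq_bigr do rewrite mulrC; rewrite sum_indicator.
  rewrite -(price_minorant_potential _ _ l_le).
  rewrite -[LHS](sum_indicator i (fun k => \sum_j l (k, j))).
  by apply: eq_bigr => k _; rewrite mulr_sumr; apply: eq_bigr => j _; rewrite addr0.
- have <- : potential_value (fun=> 0) (fun k => (k == j)%:R) = b j.
    rewrite /potential_value big1 ?add0r => [|i _]; last by rewrite mulr0.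
    by under eq_bigr do rewrite mulrC; rewrite sum_indicator.
  rewrite -(price_minorant_potential _ _ l_le) exchange_big.
  rewrite -[LHS](sum_indicator j (fun k => \sum_i l (i, k))).
  by apply: eq_bigr => k _; rewrite mulr_sumr; apply: eq_bigr => i _; rewrite add0r.
Qed.

Lemma transport_duality (c : I -> J -> R) (M : R) :
  (forall f g, (forall i j, f i + g j <= c i j) ->
     \sum_i a i * f i + \sum_j b j * g j <= M) ->
  exists l : I -> J -> R,
    [/\ forall i j, 0 <= l i j,
        forall i, \sum_j l i j = a i,
        forall j, \sum_i l i j = b j &
        \sum_i \sum_j c i j * l i j <= M].
Proof.
move=> dual_le.
have [l [l_le l_c]] := finite_hahn_banach (fun ij => - c ij.1 ij.2) sublinear_price.
have [l_row l_col] := price_minorant_marginals l_le.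
exists (fun i j => l (i, j)); split=> // [i j|].
- have := l_le (fun ij => - (ij == (i, j))%:R).
  under eq_bigr do rewrite mulNr.
  rewrite sumrN sum_indicator -oppr_le0 => /le_trans; apply.
  rewrite -potential_value0; apply: price_le => i' j' /=.
  by rewrite addr0 oppr_le0 ler0n.
- rewrite -[leLHS]opprK -sumrN lerNl.
  under [leRHS]eq_bigr do rewrite -sumrN.
  under [leRHS]eq_bigr do under eq_bigr do rewrite -mulNr.
  rewrite -(sum_pairing (fun ij => - c ij.1 ij.2)) l_c; apply: le_price => f g le_fg.
  rewrite lerNl -potential_valueN; apply: dual_le => i j.
  by rewrite -opprD lerNl; exact: le_fg.
Qed.

End transport_duality.

(** * Weak convergence on a Polish space *)

Lemma ge0_integral_le_cst (R : realType) (d : measure_display) (T : measurableType d)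
    (m : {measure set T -> \bar R}) (f : T -> \bar R) (M : R) :
  measurable_fun setT f -> (forall x, 0 <= f x <= M%:E)%E ->
  (\int[m]_x f x <= M%:E * m setT)%E.
Proof.
move=> mf f0M; rewrite -integral_cst//; apply: ge0_le_integral => //.
  by move=> x _; case/andP: (f0M x).
by move=> x _; case/andP: (f0M x).
Qed.

Definition unit_mfun (R : realType) (d : measure_display) (T : measurableType d)
    (f : T -> R) :=
  measurable_fun setT f /\ (forall x, 0 <= f x <= 1).

Section probability_integral.
Context {R : realType} {d : measure_display} {T : measurableType d}.
Variable mu : probability T R.
Implicit Types f g h : T -> R.

Lemma unit_mfun_EFin f : unit_mfun f ->
  measurable_fun setT (EFin \o f) /\ (forall x, 0 <= (f x)%:E)%E.
Proof.
move=> [mf f01]; split=> [|x]; first exact/measurable_EFinP.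
by rewrite lee_fin; case/andP: (f01 x).
Qed.

Lemma unit_mfunC f : unit_mfun f -> unit_mfun (fun x => 1 - f x).
Proof.
move=> [mf f01]; split=> [|x]; first exact: measurable_funB.
by have := f01 x; lra.
Qed.

Lemma unit_mfun_comp d' (T' : measurableType d') (X : T' -> T) f :
  measurable_fun setT X -> unit_mfun f -> unit_mfun (f \o X).
Proof. by move=> mX [mf f01]; split=> [|w /=]; first exact: measurableT_comp. Qed.

Lemma unit_mfun_integrable f : unit_mfun f -> mu.-integrable setT (EFin \o f).
Proof.
move=> [mf f01]; apply: measurable_bounded_integrable => //.
  by rewrite ltey_eq fin_num_measure.
exists 1; split=> // y y1 x _; have /andP[f0 f1] := f01 x.
by rewrite /= ger0_norm// (le_trans f1)// ltW.
Qed.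

Lemma integrable_EFin_Rintegral f : mu.-integrable setT (EFin \o f) ->
  (\int[mu]_x f x)%:E = (\int[mu]_x (f x)%:E)%E.
Proof. by move=> fi; rewrite /Rintegral fineK// integrable_fin_num. Qed.

Lemma unit_mfun_EFin_Rintegral f : unit_mfun f ->
  (\int[mu]_x f x)%:E = (\int[mu]_x (f x)%:E)%E.
Proof. by move=> /unit_mfun_integrable/integrable_EFin_Rintegral. Qed.

Lemma integral_prob_cst (r : R) : (\int[mu]_x r%:E)%E = r%:E.
Proof.
by rewrite integral_cst// [X in (_ * X)%E]probability_setT mule1.
Qed.

Lemma integral_affine f (a b : R) : measurable_fun setT f -> (forall x, 0 <= f x) ->
  0 <= a -> 0 <= b ->
  (\int[mu]_x (a * f x + b)%:E = a%:E * \int[mu]_x (f x)%:E + b%:E)%E.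
Proof.
move=> mf f0 a0 b0; under eq_integral do rewrite EFinD.
rewrite ge0_integralD//; last 2 first.
- by move=> x _; rewrite lee_fin mulr_ge0.
- by apply/measurable_EFinP; exact: measurable_funM.
under eq_integral do rewrite EFinM.
rewrite ge0_integralZl_EFin//; last 2 first.
- by move=> x _; rewrite lee_fin.
- exact/measurable_EFinP.
by rewrite integral_prob_cst.
Qed.

Lemma Rintegral_prob_cst (r : R) : \int[mu]_x r = r.
Proof. by rewrite /Rintegral integral_prob_cst. Qed.

Lemma RintegralC f : unit_mfun f -> \int[mu]_x (1 - f x) = 1 - \int[mu]_x f x.
Proof.
move=> uf; rewrite RintegralB ?Rintegral_prob_cst//.
- by apply: unit_mfun_integrable; split=> // x; rewrite ler01 lexx.
- exact: unit_mfun_integrable.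
Qed.

Lemma le_unit_Rintegral f g : unit_mfun f -> unit_mfun g ->
  (forall x, f x <= g x) -> \int[mu]_x f x <= \int[mu]_x g x.
Proof.
by move=> uf ug fg; apply: le_Rintegral => //; exact: unit_mfun_integrable.
Qed.

Lemma integral_prob_le (f : T -> \bar R) (M : R) : measurable_fun setT f ->
  (forall x, 0 <= f x <= M%:E)%E -> (\int[mu]_x f x <= M%:E)%E.
Proof.
move=> mf f0M; apply: le_trans (ge0_integral_le_cst _ mf f0M) _.
by rewrite [X in (_ * X)%E]probability_setT mule1.
Qed.

Lemma unit_Rintegral f : unit_mfun f -> 0 <= \int[mu]_x f x <= 1.
Proof.
move=> uf; have [mfE f0] := unit_mfun_EFin uf.
rewrite -!lee_fin unit_mfun_EFin_Rintegral// integral_ge0//=.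
by apply: integral_prob_le => // x; rewrite f0/= lee_fin; case/andP: (uf.2 x).
Qed.

Lemma le_Rintegral_dist f g h (M : R) : unit_mfun f -> unit_mfun g ->
  measurable_fun setT h -> (forall x, `|f x - g x| <= h x) ->
  (\int[mu]_x (h x)%:E <= M%:E)%E ->
  `|\int[mu]_x f x - \int[mu]_x g x| <= M.
Proof.
move=> uf ug mh fg_le_h h_le_M.
have fi := unit_mfun_integrable uf; have gi := unit_mfun_integrable ug.
have fgi : mu.-integrable setT (EFin \o (f \- g)).
  by have := integrableB measurableT fi gi.
rewrite -RintegralB//; apply: (le_trans (le_normr_Rintegral _ fgi)) => //.
rewrite -lee_fin integrable_EFin_Rintegral; last exact: integrable_norm.
apply: (le_trans _ h_le_M); apply: ge0_le_integral => //.
- apply/measurable_EFinP; apply: measurableT_comp => //.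
  by apply: measurable_funB; [exact: uf.1|exact: ug.1].
- exact/measurable_EFinP.
- by move=> x _; rewrite lee_fin; exact: fg_le_h.
Qed.

Lemma unit_Rintegral_cvg (f_ : nat -> T -> R) f : (forall n, unit_mfun (f_ n)) ->
  unit_mfun f -> {ae mu, forall x, f_ n x @[n --> \oo] --> f x} ->
  \int[mu]_x f_ n x @[n --> \oo] --> \int[mu]_x f x.
Proof.
move=> uf_ uf f_cvg; apply: fine_cvg; rewrite unit_mfun_EFin_Rintegral//.
have [mfE _] := unit_mfun_EFin uf.
have mf_E n := (unit_mfun_EFin (uf_ n)).1.
have f_le1 : {ae mu, forall x n, setT x -> (`|(f_ n x)%:E| <= cst 1 x)%E}.
  apply: aeW => x n _ /=; have /andP[f0 f1] := (uf_ n).2 x.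
  by rewrite lee_fin ger0_norm.
have f_cvgE : {ae mu, forall x, setT x -> (f_ n x)%:E @[n --> \oo] --> (f x)%:E}.
  by apply: filterS f_cvg => x f_x _; apply: cvg_EFin => //; exact: nearW.
have [//] := dominated_convergence measurableT mf_E mfE f_cvgE
  (finite_measure_integrable_cst mu 1 measurableT) f_le1.
Qed.

End probability_integral.

Section polish_space.
Context {R : realType} {d : measure_display} {E : measurableType d}.
Variable rho : E -> E -> R.
Hypothesis polish_rho : polish rho.
Implicit Types (x y z : E) (f g : E -> R) (U : set E).

Definition tdist x y : R := Num.min (rho x y) 1.

Definition Lip1 f := (forall x, 0 <= f x <= 1) /\
  (forall x y, `|f x - f y| <= rho x y).

Definition rho_lsc g := forall x c, c < g x ->
  exists2 del : R, 0 < del & forall y, rho x y < del -> c < g y.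

Definition rho_lsc2 (h : E -> E -> R) := forall x y c, c < h x y ->
  exists2 del : R, 0 < del &
    forall x' y', rho x x' < del -> rho y y' < del -> c < h x' y'.

Definition inf_conv (k : R) g x := inf [set g y + k * rho x y | y in [set: E]].

Let metric_rho : is_metric rho. Proof. by case: polish_rho. Qed.

Lemma rho_ge0 x y : 0 <= rho x y. Proof. by case: metric_rho. Qed.

Lemma rhoxx x : rho x x = 0.
Proof. by case: metric_rho => _ rho_eq0 _ _; apply/rho_eq0. Qed.

Lemma rhoC x y : rho x y = rho y x. Proof. by case: metric_rho. Qed.

Lemma rho_triangle y x z : rho x z <= rho x y + rho y z.
Proof. by case: metric_rho. Qed.

Lemma tdist_ge0 x y : 0 <= tdist x y.
Proof. by rewrite /tdist le_min rho_ge0 ler01. Qed.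

Lemma tdist_le1 x y : tdist x y <= 1.
Proof. by rewrite /tdist ge_min lexx orbT. Qed.

Lemma tdist_le_rho x y : tdist x y <= rho x y.
Proof. by rewrite /tdist ge_min lexx. Qed.

Lemma tdistC x y : tdist x y = tdist y x.
Proof. by rewrite /tdist rhoC. Qed.

Lemma tdistxx x : tdist x x = 0.
Proof. by rewrite /tdist rhoxx; apply/min_idPl; exact: ler01. Qed.

Lemma tdist_triangle y x z : tdist x z <= tdist x y + tdist y z.
Proof.
have := rho_triangle y x z; have := rho_ge0 x y; have := rho_ge0 y z.
rewrite /tdist; case: (leP (rho x z) 1); case: (leP (rho x y) 1);
  case: (leP (rho y z) 1); lra.
Qed.

Lemma measurable_rho_open U : rho_open rho U -> measurable U.
Proof. by case: polish_rho => _ _ _ b oU; apply/b; exact: sub_sigma_algebra. Qed.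

Lemma measurable_rho_ball x e : measurable [set y | rho x y < e].
Proof.
apply: measurable_rho_open => y /= xy.
exists (e - rho x y) => [|z yz]; first by rewrite subr_gt0.
by apply: le_lt_trans (rho_triangle y x z) _; rewrite -ltrBrDl.
Qed.

(* Separability makes an open subset of the product a countable union of
   products of balls, hence measurable for the product sigma-algebra. *)
Lemma measurable_prod_open (W : set (E * E)) :
  (forall x y, W (x, y) -> exists2 e : R, 0 < e &
     forall x' y', rho x x' < e -> rho y y' < e -> W (x', y')) ->
  measurable W.
Proof.
move=> openW; have [_ _ [s s_dense] _] := polish_rho.
pose B (i : nat) (k : nat) := [set y | rho (s i) y < k.+1%:R^-1].
pose BB (ijk : nat * nat * nat) := B ijk.1.1 ijk.2 `*` B ijk.1.2 ijk.2.
have -> : W = \bigcup_ijk (if `[< BB ijk `<=` W >] then BB ijk else set0).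
  apply/seteqP; split=> [[x y] Wxy|xy [[[i j] k] _]]; last first.
    by case: asboolP => // sub_W; exact: sub_W.
  have [e e0 ball_W] := openW _ _ Wxy.
  have [k ke] : exists k : nat, k.+1%:R^-1 < e / 2.
    have e20 : 0 < e / 2 by rewrite divr_gt0.
    have [k _ k_lt] := near_infty_natSinv_lt (PosNum e20).
    by exists k; exact: k_lt k (leqnn k).
  have k0 : 0 < k.+1%:R^-1 :> R by rewrite invr_gt0.
  have [i xi] := s_dense x _ k0; have [j yj] := s_dense y _ k0.
  exists (i, j, k) => //; case: asboolP.
    by rewrite /BB /B/= => _; split=> /=; rewrite rhoC.
  case=> -[x' y'] [/=]; rewrite /B/=.
  move: ke xi yj; move: (k.+1%:R^-1) => q qe xi yj ix' jy'; apply: ball_W.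
    by have := rho_triangle (s i) x x'; lra.
  by have := rho_triangle (s j) y y'; lra.
apply: countable_bigcupT_measurable => [|ijk]; first exact: countableP.
by case: asboolP => // _; apply: measurableX; exact: measurable_rho_ball.
Qed.

Lemma measurable_rho_lsc2 (h : E -> E -> R) : rho_lsc2 h ->
  measurable_fun setT (fun z : E * E => h z.1 z.2).
Proof.
move=> lsc_h; apply: (measurability _ (RGenOInfty.measurableE R)) => //.
move=> _ [_ [c ->] <-]; rewrite setTI; apply: measurable_prod_open => x y /=.
rewrite in_itv/= andbT => /lsc_h[e e0 h_gt]; exists e => // x' y' ? ?.
by rewrite in_itv/= andbT; exact: h_gt.
Qed.

Lemma measurable_rho_lsc g : rho_lsc g -> measurable_fun setT g.
Proof.
move=> lsc_g; apply: (measurability _ (RGenOInfty.measurableE R)) => //.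
move=> _ [_ [c ->] <-]; rewrite setTI; apply: measurable_rho_open => x /=.
rewrite in_itv/= andbT => /lsc_g[e e0 g_gt]; exists e => // y ?.
by rewrite in_itv/= andbT; exact: g_gt.
Qed.

Lemma rho_continuous_lsc g : rho_continuous rho g -> rho_lsc g.
Proof.
move=> cont_g x c cx; have [|e e0 near_x] := cont_g x (g x - c).
  by rewrite subr_gt0.
by exists e => // y /near_x; rewrite ltr_norml => /andP[+ _]; lra.
Qed.

Lemma measurable_tdist : measurable_fun setT (fun z : E * E => tdist z.1 z.2).
Proof.
apply: measurable_minr => //; apply: measurable_rho_lsc2 => x y c cxy.
exists ((rho x y - c) / 2) => [|x' y' xx' yy']; first by lra.
have := rho_triangle x' x y; have := rho_triangle y' x' y.
by rewrite (rhoC y' y); lra.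
Qed.

Lemma measurable_fun_tdist d' (O : measurableType d') (u v : O -> E) :
  measurable_fun setT u -> measurable_fun setT v ->
  measurable_fun setT (fun w => tdist (u w) (v w)).
Proof.
by move=> mu mv; exact: (measurableT_comp measurable_tdist (measurable_fun_pair mu mv)).
Qed.

Lemma Lip1_tdist f x y : Lip1 f -> `|f x - f y| <= tdist x y.
Proof.
move=> [f01 f_lip]; rewrite /tdist le_min f_lip/= ler_norml.
by have := f01 x; have := f01 y; lra.
Qed.

Lemma Lip1_continuous f : Lip1 f -> rho_continuous rho f.
Proof.
move=> [_ f_lip] x e e0; exists e => // y xy.
by apply: le_lt_trans xy; rewrite rhoC.
Qed.

Lemma Lip1_unit_mfun f : Lip1 f -> unit_mfun f.
Proof.
move=> f_lip; split; last exact: f_lip.1.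
exact/measurable_rho_lsc/rho_continuous_lsc/Lip1_continuous.
Qed.

Lemma Lip1_scale (k : R) g : 1 <= k -> (forall x, 0 <= g x <= 1) ->
  (forall x y, g x - g y <= k * rho x y) -> Lip1 (fun x => k^-1 * g x).
Proof.
move=> k1 g01 g_lip; have k0 : 0 < k by lra.
split=> [x|x y].
  have /andP[g0 g1] := g01 x; rewrite mulr_ge0 ?invr_ge0 ?(ltW k0)//=.
  by rewrite ler_pdivrMl// mulr1 (le_trans g1).
rewrite -mulrBr normrM gtr0_norm ?invr_gt0// ler_pdivrMl// ler_norml g_lip andbT.
by have := g_lip y x; rewrite rhoC; lra.
Qed.

Section inf_convolution.
Variables (k : R) (g : E -> R).
Hypotheses (k_ge0 : 0 <= k) (g_ge0 : forall x, 0 <= g x).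

Let has_inf_inf_conv x : has_inf [set g y + k * rho x y | y in [set: E]].
Proof.
split; first by exists (g x + k * rho x x), x.
by exists 0 => _ [y _ <-]; rewrite addr_ge0// mulr_ge0// rho_ge0.
Qed.

Lemma inf_conv_le x y : inf_conv k g x <= g y + k * rho x y.
Proof. by apply: (ge_inf (has_inf_inf_conv x).2); exists y. Qed.

Lemma le_inf_conv x a : (forall y, a <= g y + k * rho x y) -> a <= inf_conv k g x.
Proof.
move=> a_le; apply: lb_le_inf; first exact: (has_inf_inf_conv x).1.
by move=> _ [y _ <-]; exact: a_le.
Qed.

Lemma inf_conv_ge0 x : 0 <= inf_conv k g x.
Proof. by apply: le_inf_conv => y; rewrite addr_ge0// mulr_ge0// rho_ge0. Qed.

Lemma inf_conv_minorant x : inf_conv k g x <= g x.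
Proof. by have := inf_conv_le x x; rewrite rhoxx mulr0 addr0. Qed.

Lemma inf_conv_lipschitz x y : inf_conv k g x - inf_conv k g y <= k * rho x y.
Proof.
rewrite lerBlDr addrC -lerBlDr; apply: le_inf_conv => z.
rewrite lerBlDr; apply: le_trans (inf_conv_le x z) _.
by rewrite -addrA lerD2l -mulrDr ler_wpM2l// addrC rho_triangle.
Qed.

End inf_convolution.

Lemma inf_conv_cvg g x : (forall x, 0 <= g x) -> rho_lsc g ->
  inf_conv k.+1%:R g x @[k --> \oo] --> g x.
Proof.
move=> g0 lsc_g; apply/cvgrPdist_le => e e0.
have [|del del0 near_x] := lsc_g x (g x - e); first lra.
near=> k; rewrite ler_norml; apply/andP; split.
  by have := @inf_conv_minorant k.+1%:R g (ler0n _ _) g0 x; lra.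
rewrite lerBlDr addrC -lerBlDr; apply: le_inf_conv => // y.
have := g0 y; have : 0 <= k.+1%:R * rho x y by rewrite mulr_ge0// rho_ge0.
have [/near_x|far] := ltP (rho x y) del; first by lra.
suff : g x <= k.+1%:R * rho x y by lra.
apply: (@le_trans _ _ (k.+1%:R * del)); last by rewrite ler_wpM2l.
rewrite -ler_pdivrMr// ltW// (@lt_trans _ _ k%:R) ?ltr_nat//.
by near: k; exact: nbhs_infty_gtr.
Unshelve. all: by end_near. Qed.

Lemma Lip1_inf_conv (k : nat) g : (forall x, 0 <= g x <= 1) ->
  Lip1 (fun x => k.+1%:R^-1 * inf_conv k.+1%:R g x).
Proof.
move=> g01; have g0 x : 0 <= g x by case/andP: (g01 x).
apply: Lip1_scale => [|x|x y]; first by rewrite ler1n.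
  rewrite inf_conv_ge0//= (le_trans (inf_conv_minorant _ _ _))//.
  by case/andP: (g01 x).
exact: inf_conv_lipschitz.
Qed.

Lemma unit_mfun_inf_conv (k : nat) g : (forall x, 0 <= g x <= 1) ->
  unit_mfun (inf_conv k.+1%:R g).
Proof.
move=> g01; have g0 x : 0 <= g x by case/andP: (g01 x).
split=> [|x]; last first.
  rewrite inf_conv_ge0//= (le_trans (inf_conv_minorant _ _ _))//.
  by case/andP: (g01 x).
rewrite (_ : inf_conv _ _ = fun x => k.+1%:R * (k.+1%:R^-1 * inf_conv k.+1%:R g x)).
  by apply: measurable_funM => //; exact: (Lip1_unit_mfun (Lip1_inf_conv k g01)).1.
by apply/funext => x; rewrite mulrA divff ?mul1r// pnatr_eq0.
Qed.

Lemma rho_open_Lip1_gt0 U : rho_open rho U ->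
  exists2 f, Lip1 f & U = [set x | 0 < f x].
Proof.
move=> oU; pose g x : R := \1_U x.
have g01 x : 0 <= g x <= 1.
  by rewrite /g indicE; case: (x \in U); rewrite !lexx ler01.
have g0 x : 0 <= g x by case/andP: (g01 x).
have := Lip1_inf_conv 0 g01; rewrite invr1; under eq_fun do rewrite mul1r.
move=> f_lip; exists (inf_conv 1 g) => //; apply/seteqP; split=> x /=.
  move=> /oU[e e0 ball_U]; apply: (@lt_le_trans _ _ (Num.min e 1)).
    by rewrite lt_min e0 ltr01.
  apply: le_inf_conv => // y; rewrite mul1r ge_min /g indicE.
  have [xy|xy] := ltP (rho x y) e.
    by rewrite mem_set ?lerDl ?rho_ge0 ?orbT//; exact: ball_U.
  by rewrite ler_wpDl.
move=> f_gt0; apply: contrapT => nUx.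
by have := inf_conv_minorant ler01 g0 x; rewrite {2}/g indicE memNset// leNgt f_gt0.
Qed.

Lemma rho_borel_generated : measurable = <<s rho_open rho >>.
Proof. by apply/seteqP; split=> A; case: polish_rho => _ _ _ b /b. Qed.

Lemma measurable_fun_Lip1 d' (O : measurableType d') (v : O -> E) :
  (forall f, Lip1 f -> measurable_fun setT (f \o v)) -> measurable_fun setT v.
Proof.
move=> mfv; apply: (measurability (rho_open rho)); first exact: rho_borel_generated.
move=> _ [_ /rho_open_Lip1_gt0[f f_lip ->] <-].
rewrite setTI (_ : _ @^-1` _ = [set: O] `&` (f \o v) @^-1` `]0, +oo[%classic).
  by apply: mfv => //; exact: measurable_itv.
by rewrite setTI; apply/seteqP; split=> w /=; rewrite in_itv/= andbT.
Qed.

End polish_space.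

Section weak_convergence.
Context {R : realType} {d : measure_display} {E : measurableType d}.
Variable rho : E -> E -> R.
Hypothesis polish_rho : polish rho.
Implicit Types (mu : nat -> probability E R) (pi nu : probability E R) (g : E -> R).

Definition weakly_cvg mu pi := forall f, Lip1 rho f ->
  \int[mu n]_x f x @[n --> \oo] --> \int[pi]_x f x.

Lemma weakly_cvg_lsc_le mu pi g (l : R) : weakly_cvg mu pi ->
  (forall x, 0 <= g x <= 1) -> rho_lsc rho g ->
  \int[mu n]_x g x @[n --> \oo] --> l -> \int[pi]_x g x <= l.
Proof.
move=> mu_pi g01 lsc_g mu_g.
have g0 x : 0 <= g x by case/andP: (g01 x).
have ug : unit_mfun g by split=> //; exact: measurable_rho_lsc lsc_g.
pose G k := inf_conv rho k.+1%:R g.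
have uG k : unit_mfun (G k) by exact: unit_mfun_inf_conv.
have intG k nu : \int[nu]_x G k x = k.+1%:R * \int[nu]_x (k.+1%:R^-1 * G k x).
  rewrite -RintegralZl//.
    by apply: eq_Rintegral => x _; rewrite mulrA divff ?mul1r// pnatr_eq0.
  exact/unit_mfun_integrable/(Lip1_unit_mfun polish_rho)/Lip1_inf_conv.
have intG_le k : \int[pi]_x G k x <= l.
  have mu_G : \int[mu n]_x G k x @[n --> \oo] --> \int[pi]_x G k x.
    rewrite intG; under eq_fun do rewrite intG.
    by apply: cvgM; [exact: cvg_cst|exact/mu_pi/Lip1_inf_conv].
  apply: (ler_cvg_to mu_G mu_g); apply: nearW => n.
  apply: le_unit_Rintegral => // x; exact: inf_conv_minorant.
have intG_cvg : \int[pi]_x G k x @[k --> \oo] --> \int[pi]_x g x.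
  apply: unit_Rintegral_cvg => //; apply: aeW => x; exact: inf_conv_cvg.
by apply: (ler_cvg_to intG_cvg (cvg_cst l)); exact: nearW.
Qed.

Lemma weakly_cvg_continuous_eq mu pi g (l : R) : weakly_cvg mu pi ->
  (forall x, 0 <= g x <= 1) -> rho_continuous rho g ->
  \int[mu n]_x g x @[n --> \oo] --> l -> \int[pi]_x g x = l.
Proof.
move=> mu_pi g01 cont_g mu_g; have lsc_g := rho_continuous_lsc cont_g.
have ug : unit_mfun g by split=> //; exact: measurable_rho_lsc lsc_g.
apply/eqP; rewrite eq_le (weakly_cvg_lsc_le mu_pi g01 lsc_g mu_g)/=.
rewrite -lerN2 -(lerD2l 1) -RintegralC//.
apply: (weakly_cvg_lsc_le mu_pi (unit_mfunC ug).2).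
  apply: rho_continuous_lsc => x e /(cont_g x)[del del0 near_x].
  by exists del => // y /near_x; rewrite -normrN; congr (`| _ | < _); ring.
under eq_fun do rewrite RintegralC//.
by apply: cvgB => //; exact: cvg_cst.
Qed.

Lemma prob_eq_Lip1 pi nu :
  (forall f, Lip1 rho f -> \int[pi]_x f x = \int[nu]_x f x) ->
  forall A, measurable A -> pi A = nu A.
Proof.
move=> eq_pi_nu.
have le_open (p q : probability E R) U : (forall f, Lip1 rho f ->
    \int[p]_x f x = \int[q]_x f x) -> rho_open rho U -> (p U <= q U)%E.
  move=> eq_pq oU; have mU := measurable_rho_open polish_rho oU.
  have indic_lsc : rho_lsc rho (\1_U : E -> R).
    move=> x c; rewrite indicE; case: (boolP (x \in U)) => [|_ c0].
      rewrite inE => /oU[e e0 ball_U] c1; exists e => // y /ball_U Uy.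
      by rewrite indicE mem_set.
    by exists 1 => // y _; rewrite (lt_le_trans c0)// indicE.
  have indic01 x : 0 <= (\1_U x : R) <= 1.
    by rewrite indicE; case: (x \in U); rewrite !lexx ler01.
  have q_p : weakly_cvg (fun=> q) p by move=> f f_lip; rewrite eq_pq//; exact: cvg_cst.
  have := weakly_cvg_lsc_le q_p indic01 indic_lsc (@cvg_cst _ _ _ _ eventually_filter).
  rewrite -lee_fin !integrable_EFin_Rintegral; last 2 first.
  - exact: integrable_indic.
  - exact: integrable_indic.
  by rewrite !integral_indic// !setIT => ->.
apply: (measure_unique (rho_open rho) (fun=> setT)).
- exact: rho_borel_generated.
- move=> A B oA oB x [/oA[e e0 eA] /oB[e' e'0 eB]].
  by exists (Num.min e e') => [|y]; rewrite lt_min ?e0// => /andP[? ?]; split; auto.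
- by move=> _ x _; exists 1.
- by rewrite bigcup_const//; exists 0%N.
- by move=> U oU; apply/eqP; rewrite eq_le !le_open// => f /eq_pi_nu.
- by move=> _; apply: (@le_lt_trans _ _ 1%E); [exact: probability_le1|exact: ltry].
Qed.

End weak_convergence.

(** * Couplings *)

Section measure_constructions.
Context {R : realType} {d : measure_display} {T : measurableType d}.
Local Open Scope ereal_scope.

Definition density (m : {measure set T -> \bar R}) (f : T -> \bar R)
    (mf : measurable_fun setT f) (f_ge0 : forall x, 0 <= f x) (A : set T) :=
  \int[m]_(x in A) f x.

Section density.
Variables (m : {measure set T -> \bar R}) (f : T -> \bar R).
Hypotheses (mf : measurable_fun setT f) (f_ge0 : forall x, 0 <= f x).

Local Notation density := (density m mf f_ge0).

Let density0 : density set0 = 0. Proof. exact: integral_set0. Qed.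

Let density_ge0 A : 0 <= density A. Proof. exact: integral_ge0. Qed.

Let density_sigma_additive : semi_sigma_additive density.
Proof. exact: semi_sigma_additive_nng_induced. Qed.

HB.instance Definition _ := isMeasure.Build _ _ _ density
  density0 density_ge0 density_sigma_additive.

End density.

Lemma densityC (m : {measure set T -> \bar R}) (h : T -> R)
    (mh : measurable_fun setT (EFin \o h)) (h_ge0 : forall x, 0 <= (EFin \o h) x)
    (mhc : measurable_fun setT (EFin \o (fun x => 1 - h x)%R))
    (hc_ge0 : forall x, 0 <= (EFin \o (fun x => 1 - h x)%R) x) A : measurable A ->
  density m mhc hc_ge0 A + density m mh h_ge0 A = m A.
Proof.
move=> mA; rewrite /density -ge0_integralD//; last 2 first.
- exact: measurable_funTS.
- exact: measurable_funTS.
rewrite (eq_integral (cst 1)) ?integral_cst ?mul1e// => z _.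
by rewrite /= -EFinD subrK.
Qed.

Lemma measure_scale_probability (M : {measure set T -> \bar R}) (k : R) :
  M setT = k%:E ->
  exists Q : probability T R, forall A, measurable A -> M A = k%:E * Q A.
Proof.
move=> Mk.
exists (mnormalize M (dirac point : probability T R)) => A mA /=.
rewrite /mnormalize Mk/= eqe orbF; case: eqVneq => [k0|k_neq0].
  rewrite k0 mul0e; apply/eqP; rewrite eq_le measure_ge0 andbT.
  apply: (@le_trans _ _ (M setT)); last by rewrite Mk k0.
  by apply: le_measure; rewrite ?inE.
by rewrite muleCA -EFinM divff ?mule1.
Qed.

Lemma measure_setT1_probability (M : {measure set T -> \bar R}) : M setT = 1 ->
  exists Q : probability T R, forall A, measurable A -> Q A = M A.
Proof.
move=> M1; have [Q QE] := measure_scale_probability M1.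
by exists Q => A mA; rewrite QE// mul1e.
Qed.

Lemma exists_law d' (O : measurableType d') (Pr : probability O R) (X : O -> T) :
  measurable_fun setT X ->
  exists Q : probability T R, (forall A, Q A = Pr (X @^-1` A)) /\
    (forall h : T -> \bar R, measurable_fun setT h -> (forall x, 0 <= h x) ->
       \int[Q]_x h x = \int[Pr]_w h (X w)).
Proof.
move=> mX; pose X' : {mfun O >-> T} := HB.pack X (isMeasurableFun.Build _ _ _ _ _ mX).
exists (distribution Pr X'); split=> // h mh h0.
exact: (ge0_integral_pushforward mX).
Qed.

End measure_constructions.

Section dominated_density.
Context {R : realType} {d : measure_display} {T : measurableType d}.
Variables (nu : probability T R) (sigma : {finite_measure set T -> \bar R}).
Hypothesis sigma_le : forall A, measurable A -> (sigma A <= nu A)%E.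
Local Open Scope ereal_scope.

Lemma dominated_density : exists h : T -> R, unit_mfun h /\
  forall A, measurable A -> \int[nu]_(x in A) (h x)%:E = sigma A.
Proof.
have sigma_dom : sigma `<< nu.
  apply/null_content_dominatesP => A mA nuA.
  by apply/eqP; rewrite eq_le measure_ge0 andbT -nuA sigma_le.
have [g [g0 gi gE]] := radon_nikodym_finite sigma_dom.
have mg : measurable_fun setT g by exact: measurable_int gi.
pose h x := fine (mine (g x) 1).
have hE x : (h x)%:E = mine (g x) 1.
  rewrite fineK// ge0_fin_numE ?le_min ?g0 ?lee01//.
  by rewrite (@le_lt_trans _ _ 1) ?ltry// ge_min lexx orbT.
have uh : unit_mfun h.
  split=> [|x]; first by apply: measurableT_comp => //; exact: measurable_mine.
  by rewrite -!lee_fin hE le_min ge_min g0 lexx orbT lee01.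
have [mhE h0] := unit_mfun_EFin uh.
exists h; split=> // A mA.
pose G := [set x | g x <= 1].
have mG : measurable G by rewrite -[G]setTI; exact: measurable_lee.
have mAG : measurable (A `&` G) by exact: measurableI.
have mAGc : measurable (A `\` G) by exact: measurableD.
transitivity (density nu mhE h0 A) => //; rewrite (measureDI _ mA mG).
rewrite (measureDI sigma mA mG); congr (_ + _); rewrite /= /density; last first.
  rewrite gE//; apply: eq_integral => x; rewrite inE /= => -[_ Gx].
  by rewrite hE; exact/min_idPl.
have -> : \int[nu]_(x in A `\` G) (h x)%:E = nu (A `\` G).
  rewrite -[RHS]mul1e -integral_cst//; apply: eq_integral => x.
  rewrite inE => -[_ /negP]; rewrite -ltNge => /ltW g1.
  by rewrite hE; exact/min_idPr.
apply/eqP; rewrite eq_le sigma_le// andbT gE// -[leLHS]mul1e -integral_cst//.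
apply: ge0_le_integral => //; first exact: measurable_funTS.
by move=> x [_ /negP]; rewrite -ltNge => /ltW.
Qed.

End dominated_density.

Section coupling_integrals.
Context {R : realType} {d : measure_display} {E : measurableType d}.
Variables (mu nu : probability E R) (m : probability (E * E)%type R).
Hypothesis coupling_m : coupling mu nu m.

Lemma coupling_integral1 (f : E -> \bar R) : measurable_fun setT f ->
  (forall x, (0 <= f x)%E) -> (\int[m]_z f z.1 = \int[mu]_x f x)%E.
Proof.
move=> mf f0.
have mfst : measurable_fun setT (fst : E * E -> E) by exact: measurable_fst.
have := @ge0_integral_pushforward _ _ _ _ R _ mfst m setT f measurableT mf.
rewrite preimage_setT => <- //; apply: eq_measure_integral => A mA _.
by transitivity (m (A `*` setT)); [rewrite setXT|exact: coupling_m.1].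
Qed.

Lemma coupling_integral2_setX (A : set E) (f : E -> \bar R) : measurable A ->
  measurable_fun setT f -> (forall x, (0 <= f x)%E) ->
  (\int[m]_(z in setT `*` A) f z.2 = \int[nu]_(x in A) f x)%E.
Proof.
move=> mA mf f0.
have msnd : measurable_fun setT (snd : E * E -> E) by exact: measurable_snd.
have := @ge0_integral_pushforward _ _ _ _ R _ msnd m A f mA (measurable_funTS mf).
rewrite setTX => <- //; apply: eq_measure_integral => B mB _.
by transitivity (m (setT `*` B)); [rewrite setTX|exact: coupling_m.2].
Qed.

Lemma coupling_integral2 (f : E -> \bar R) : measurable_fun setT f ->
  (forall x, (0 <= f x)%E) -> (\int[m]_z f z.2 = \int[nu]_x f x)%E.
Proof. by move=> mf f0; rewrite -coupling_integral2_setX// setXTT. Qed.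

Lemma coupling_Rintegral_dist (f : E -> R) (h : E * E -> R) (M : R) :
  unit_mfun f -> measurable_fun setT h -> (forall z, `|f z.1 - f z.2| <= h z) ->
  (\int[m]_z (h z)%:E <= M%:E)%E ->
  `|\int[mu]_x f x - \int[nu]_x f x| <= M.
Proof.
move=> uf mh f_le_h h_le_M; have [mfE f0] := unit_mfun_EFin uf.
rewrite /Rintegral -(coupling_integral1 mfE f0) -(coupling_integral2 mfE f0).
by apply: (le_Rintegral_dist (unit_mfun_comp measurable_fst uf)
  (unit_mfun_comp measurable_snd uf) mh).
Qed.

End coupling_integrals.

Definition transport_le (R : realType) (d : measure_display) (E : measurableType d)
    (c : E -> E -> R) (mu nu : set E -> \bar R) (A : R) :=
  exists2 m : probability (E * E)%type R, coupling mu nu m &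
    (\int[m]_z (c z.1 z.2)%:E <= A%:E)%E.

Section transport_le.
Context {R : realType} {d : measure_display} {E : measurableType d}.
Implicit Types (c : E -> E -> R) (mu nu : probability E R).

Lemma coupling_product mu nu :
  coupling mu nu ((mu \x nu)%E : probability (E * E)%type R).
Proof.
split=> A mA.
- transitivity (mu A * nu setT)%E; first exact: product_measure1E.
  by rewrite -[RHS]mule1; congr (_ * _)%E; exact: probability_setT.
- transitivity (mu setT * nu A)%E; first exact: product_measure1E.
  by rewrite -[RHS]mul1e; congr (_ * _)%E; exact: probability_setT.
Qed.

Lemma transport_le1 c mu nu : unit_mfun (fun z : E * E => c z.1 z.2) ->
  transport_le c mu nu 1.
Proof.
move=> uc; exists ((mu \x nu)%E : probability (E * E)%type R).
  exact: coupling_product.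
have [mcE c0] := unit_mfun_EFin uc.
apply: integral_prob_le => // z; rewrite c0/= lee_fin.
by case/andP: (uc.2 z).
Qed.

Lemma wasserstein_le_transport c mu nu (A : R) : transport_le c mu nu A ->
  (wasserstein c mu nu <= A%:E)%E.
Proof.
by move=> [m cm mA]; apply: le_trans mA; apply: ereal_inf_lbound; exists m.
Qed.

Lemma transport_le_widen c mu nu (A B : R) : A <= B ->
  transport_le c mu nu A -> transport_le c mu nu B.
Proof. by move=> AB [m cm mA]; exists m => //; rewrite (le_trans mA)// lee_fin. Qed.

End transport_le.

Section gluing.
Context {R : realType} {d : measure_display} {E : measurableType d}.
Implicit Types (mu nu : probability E R) (m : probability (E * E)%type R) (tau : R).
Local Open Scope ereal_scope.

Lemma dTV_excess nu nu' tau : dTV nu nu' <= tau%:E ->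
  exists excess deficit : {finite_measure set E -> \bar R},
    [/\ forall A, measurable A -> nu A + deficit A = nu' A + excess A,
        forall A, measurable A -> excess A <= nu A & excess setT <= tau%:E].
Proof.
move=> tv; have fin (p : {finite_measure set E -> \bar R}) A :
  measurable A -> p A \is a fin_num by exact: fin_num_measure.
pose s := cadd (charge_of_finite_measure nu)
  (cscale (-1) (charge_of_finite_measure nu')).
have [P [N hahn_s]] := Hahn_decomposition s.
have [[mP _] _ _ _] := hahn_s.
have sE A : s A = nu A - nu' A by rewrite /s /cadd/= cscaleN1.
have posE A : measurable A -> jordan_pos hahn_s A = nu (A `&` P) - nu' (A `&` P).
  by move=> mA; rewrite jordan_posE cjordan_posE /crestr0 mem_set// /crestr; exact: sE.
pose excess : {finite_measure set E -> \bar R} := jordan_pos hahn_s.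
pose deficit : {finite_measure set E -> \bar R} := jordan_neg hahn_s.
have jordanE A : measurable A -> nu A - nu' A = excess A - deficit A.
  move=> mA; transitivity (s A); first exact/esym/sE.
  rewrite [LHS](jordan_decomp hahn_s mA) [LHS]/cadd/=; congr (_ + _).
  by rewrite /cscale EFinN mulN1e.
exists excess, deficit; split.
- move=> A mA; have := jordanE A mA; have := fin nu A mA; have := fin nu' A mA.
  have := fin excess A mA; have := fin deficit A mA.
  move: (nu A) (nu' A) (excess A) (deficit A).
  move=> [a| |]// [b| |]// [p| |]// [n| |]// _ _ _ _; rewrite -!EFinB => -[?].
  by rewrite -!EFinD; congr EFin; lra.
- move=> A mA; rewrite [leLHS]posE//; apply: (@le_trans _ _ (nu (A `&` P))).
    by rewrite leeBlDr ?fin//; [rewrite leeDl|exact: measurableI].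
  by apply: le_measure; rewrite ?inE//; exact: measurableI.
- rewrite [leLHS]posE// setTI; apply: le_trans (lee_abs _) _.
  by apply: le_trans tv; apply: ereal_sup_ubound; exists P.
Qed.

(* Weighting m by a function of the second coordinate avoids any
   disintegration. *)
Lemma coupling_split mu nu m (sigma : {finite_measure set E -> \bar R}) :
  coupling mu nu m -> (forall A, measurable A -> sigma A <= nu A) ->
  exists kept removed : {measure set (E * E)%type -> \bar R},
    (forall A, measurable A -> kept A + removed A = m A) /\
    (forall A, measurable A -> removed (setT `*` A) = sigma A).
Proof.
move=> coupling_m sigma_le; have [h [uh hE]] := dominated_density sigma_le.
have msnd : measurable_fun setT (snd : E * E -> E) by exact: measurable_snd.
have uh2 := unit_mfun_comp msnd uh.
have [mh2 h2_ge0] := unit_mfun_EFin uh2.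
have [mh2c h2c_ge0] := unit_mfun_EFin (unit_mfunC uh2).
exists (density m mh2c h2c_ge0), (density m mh2 h2_ge0).
split=> A mA; first exact: densityC.
have [mhE h_ge0] := unit_mfun_EFin uh.
by rewrite -hE// -(coupling_integral2_setX coupling_m mA mhE h_ge0).
Qed.

(* Only the part of m whose second coordinate carries the excess of nu over nu'
   is resampled, independently of the first coordinate. *)
Lemma coupling_resample mu nu nu' m tau : coupling mu nu m ->
  dTV nu nu' <= tau%:E ->
  exists kept resampled : {measure set (E * E)%type -> \bar R},
    [/\ forall A, measurable A ->
          kept (A `*` setT) + resampled (A `*` setT) = mu A,
        forall A, measurable A ->
          kept (setT `*` A) + resampled (setT `*` A) = nu' A,
        forall f : E * E -> R, unit_mfun f ->
          \int[kept]_z (f z)%:E <= \int[m]_z (f z)%:E &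
        resampled setT <= tau%:E].
Proof.
move=> coupling_m tv; have [m1 m2] := coupling_m.
have [excess [deficit [excess_deficit excess_le excess_tau]]] := dTV_excess tv.
have [kept [removed [kept_removed removed2]]] := coupling_split coupling_m excess_le.
have fin (p : {finite_measure set E -> \bar R}) A :
  measurable A -> p A \is a fin_num by exact: fin_num_measure.
pose k := fine (excess setT).
have kE : excess setT = k%:E by rewrite fineK// fin.
have removedT : removed setT = k%:E by rewrite -setXTT removed2.
have [Q QE] := measure_scale_probability removedT.
have mfst : measurable_fun setT (fst : E * E -> E) by exact: measurable_fst.
have [al [alE _]] := exists_law Q mfst.
have deficitT : deficit setT = k%:E.
  have := excess_deficit setT measurableT; rewrite kE !probability_setT.
  have := fin deficit setT measurableT.
  by case: (deficit setT) => // ? _ [?]; congr EFin; lra.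
pose resampled : {measure set (E * E)%type -> \bar R} := al \x deficit.
have resampledE A B : measurable A -> measurable B ->
    resampled (A `*` B) = al A * deficit B.
  by move=> mA mB; exact: product_measure1E.
exists kept, resampled; split=> [A mA|A mA|f uf|].
- rewrite resampledE// deficitT muleC alE -QE.
    rewrite -m1// -kept_removed; last exact: measurableX.
    by rewrite setXT.
  by rewrite -[_ @^-1` _]setTI; exact: measurable_fst.
- rewrite resampledE// probability_setT mul1e.
  have := excess_deficit A mA; rewrite -m2// -kept_removed; last exact: measurableX.
  rewrite removed2// addeAC.
  have := fin excess A mA; have := fin nu' A mA.
  move: (kept _ + _) (nu' A) (excess A).
  by move=> [a| |]// [b| |]// [e| |]// _ _ [?]; congr EFin; lra.
- have [mfE f0] := unit_mfun_EFin uf.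
  rewrite (@eq_measure_integral _ _ _ _ (measure_add kept removed) m); last first.
    by move=> A mA _; rewrite [RHS]measure_addE [RHS]kept_removed.
  by rewrite ge0_integral_measure_add// leeDl// integral_ge0.
- by rewrite -setXTT resampledE// probability_setT mul1e deficitT -kE.
Qed.

Lemma transport_le_dTV (c : E -> E -> R) mu nu nu' (A tau : R) :
  unit_mfun (fun z : E * E => c z.1 z.2) -> transport_le c mu nu A ->
  dTV nu nu' <= tau%:E -> transport_le c mu nu' (A + tau).
Proof.
move=> uc [m coupling_m cA] tv; have [mcE c0] := unit_mfun_EFin uc.
have [kept [resampled [marg1 marg2 kept_le resampled_tau]]] :=
  coupling_resample coupling_m tv.
pose M := measure_add kept resampled.
have ME B : M B = kept B + resampled B by exact: measure_addE.
have MT : M setT = 1 by rewrite ME -setXTT marg1// probability_setT.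
have [m' m'E] := measure_setT1_probability MT.
exists m'; first split=> B mB.
- by rewrite m'E; [rewrite [LHS]ME marg1|exact: measurableX].
- by rewrite m'E; [rewrite [LHS]ME marg2|exact: measurableX].
rewrite (@eq_measure_integral _ _ _ _ M); last by move=> B mB _; exact: m'E.
rewrite ge0_integral_measure_add// EFinD; apply: leeD.
  exact: le_trans (kept_le _ uc) cA.
apply: le_trans (ge0_integral_le_cst (M := 1) _ _ _) _ => //.
  by move=> z; rewrite c0/= lee_fin; case/andP: (uc.2 z).
by rewrite mul1e.
Qed.

End gluing.

(** * Lyapunov bounds *)

Section integral_minorant.
Context {R : realType} {d : measure_display} {T : measurableType d}.
Variable mu : {measure set T -> \bar R}.
Local Open Scope ereal_scope.
Import HBNNSimple.

(* f need not be measurable: the integral of a nonnegative function is the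
   supremum over the simple functions below it. *)
Lemma cst_le_integral (D : set T) (f : T -> \bar R) (c : R) : measurable D ->
  (0 <= c)%R -> (forall x, D x -> c%:E <= f x) ->
  c%:E * mu D <= \int[mu]_(x in D) f x.
Proof.
move=> mD c0 cf; rewrite -integral_cst// [leRHS]integral_mkcond [leLHS]integral_mkcond.
have f0 x : D x -> 0 <= f x by move=> /cf; apply: le_trans; rewrite lee_fin.
rewrite [leRHS]ge0_integralTE; last by move=> x; exact: erestrict_ge0.
pose h := scale_nnsfun (indic_nnsfun R mD) c0.
have hE x : (h x)%:E = (cst c%:E \_ D) x.
  have -> : h x = (c * \1_D x)%R by [].
  rewrite patchE; case: ifPn => xD; first by rewrite indicE xD mulr1.
  by rewrite indicE (negbTE xD) mulr0.
apply: ereal_sup_ubound; exists h.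
  move=> x; rewrite hE !patchE; case: ifPn => //.
  by rewrite inE; exact: cf.
by rewrite -integralT_nnsfun; apply: eq_integral => x _; rewrite hE.
Qed.

End integral_minorant.

Section markov_semigroup.
Context {R : realType} {d : measure_display} {E : measurableType d}.
Variable P : R -> E -> probability E R.
Hypothesis markov_P : markov_tf P.
Implicit Types (t s : R) (f : E -> R).

Lemma measurable_markov_integral t (f : E -> \bar R) : 0 <= t ->
  measurable_fun setT f -> (forall x, (0 <= f x)%E) ->
  measurable_fun setT (fun x => \int[P t x]_y f y)%E.
Proof.
move=> t0 mf f0; apply: measurable_fun_integral_kernel => // U mU.
by case: markov_P => measurable_P _ _; exact: measurable_P.
Qed.

Lemma measurable_markov_giry t : 0 <= t ->
  measurable_fun setT (fun x => P t x : giry E R).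
Proof.
move=> t0; apply: measurable_giry_codensity => // B mB.
by case: markov_P => measurable_P _ _; exact: measurable_P.
Qed.

Lemma giry_bind_markovE t (mu : probability E R) (A : set E)
    (mP : measurable_fun setT (fun x => P t x : giry E R)) :
  measurable A -> giry_bind mu mP A = (\int[mu]_x P t x A)%E.
Proof.
by move=> mA; rewrite /giry_bind/= [LHS]giry_int_map//; exact: measurable_giry_ev.
Qed.

Lemma exists_markov_image t (mu : probability E R) : 0 <= t ->
  exists nu : probability E R, forall A, measurable A ->
    (\int[mu]_x P t x A = nu A)%E.
Proof.
move=> t0; have mP := measurable_markov_giry t0.
have bindT : giry_bind mu mP setT = 1%E.
  rewrite giry_bind_markovE// -[RHS](integral_prob_cst mu).
  by apply: eq_integral => x _; exact: probability_setT.
have [nu nuE] := measure_setT1_probability bindT.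
by exists nu => A mA; rewrite nuE//; exact/esym/giry_bind_markovE.
Qed.

Lemma markov_image_integral t (mu nu : probability E R) (f : E -> \bar R) :
  0 <= t -> (forall A, measurable A -> (\int[mu]_x P t x A = nu A)%E) ->
  measurable_fun setT f -> (forall x, (0 <= f x)%E) ->
  (\int[mu]_x \int[P t x]_y f y = \int[nu]_x f x)%E.
Proof.
move=> t0 munu mf f0; have mP := measurable_markov_giry t0.
have := giry_int_bind mu mP mf f0; rewrite /giry_int => <-.
apply: eq_measure_integral => A mA _.
by transitivity (\int[mu]_x P t x A)%E; [exact: giry_bind_markovE|exact: munu].
Qed.

Lemma chapman_kolmogorov s t x (f : E -> \bar R) : 0 <= s -> 0 <= t ->
  measurable_fun setT f -> (forall x, (0 <= f x)%E) ->
  (\int[P (s + t) x]_y f y = \int[P s x]_y \int[P t y]_z f z)%E.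
Proof.
move=> s0 t0 mf f0; apply/esym/markov_image_integral => // A mA.
by case: markov_P => _ _ PD; rewrite PD.
Qed.

Lemma markov0_integral x (f : E -> \bar R) : measurable_fun setT f ->
  (forall x, (0 <= f x)%E) -> (\int[P 0 x]_y f y = f x)%E.
Proof.
move=> mf f0; rewrite (@eq_measure_integral _ _ _ _ (dirac x)).
  by rewrite integral_dirac// diracT mul1e.
by move=> A mA _; case: markov_P => _ P0 _; exact: P0.
Qed.

Lemma Psg_unit_mfun t f : 0 <= t -> unit_mfun f -> unit_mfun (Psg P t f).
Proof.
move=> t0 uf; have [mfE f0] := unit_mfun_EFin uf.
split; last by move=> x; exact: unit_Rintegral.
by apply: measurableT_comp => //; exact: measurable_markov_integral.
Qed.

Lemma PsgD s t f : 0 <= s -> 0 <= t -> unit_mfun f ->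
  Psg P (s + t) f = Psg P s (Psg P t f).
Proof.
move=> s0 t0 uf; have [mfE f0] := unit_mfun_EFin uf.
apply/funext => x; rewrite /Psg chapman_kolmogorov//.
by congr fine; apply: eq_integral => y _; rewrite -unit_mfun_EFin_Rintegral.
Qed.

Lemma Psg0 f : unit_mfun f -> Psg P 0 f = f.
Proof.
move=> uf; have [mfE f0] := unit_mfun_EFin uf.
by apply/funext => x; rewrite /Psg markov0_integral.
Qed.

Lemma Psg_natmulS n t f : 0 <= t -> unit_mfun f ->
  Psg P (n.+1%:R * t) f = Psg P t (Psg P (n%:R * t) f).
Proof. by move=> t0 uf; rewrite -PsgD ?mulr_ge0// mulrSr mulrDl mul1r addrC. Qed.

Lemma Rintegral_Psg t (mu nu : probability E R) f : 0 <= t -> unit_mfun f ->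
  (forall A, measurable A -> (\int[mu]_x P t x A = nu A)%E) ->
  \int[mu]_x Psg P t f x = \int[nu]_x f x.
Proof.
move=> t0 uf munu; have [mfE f0] := unit_mfun_EFin uf.
rewrite /Rintegral -(markov_image_integral t0 munu mfE f0); congr fine.
by apply: eq_integral => x _; exact: unit_mfun_EFin_Rintegral.
Qed.

End markov_semigroup.

Definition lyapunov_drift (R : realType) (d : measure_display) (E : measurableType d)
    (P : R -> E -> probability E R) (V : E -> R) (gamma K : R) :=
  forall t x, 0 <= t ->
    (\int[P t x]_y (V y)%:E
     + gamma%:E * \int[lebesgue_measure]_(s in `[0%R, t]%classic) \int[P s x]_y (V y)%:E
     <= (V x + K * t)%:E)%E.

Lemma bernoulli_inequality (R : realDomainType) (x : R) n : 0 <= x ->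
  1 + n%:R * x <= (1 + x) ^+ n.
Proof.
move=> x0; elim: n => [|n IH]; first by rewrite mul0r addr0.
rewrite exprS; apply: le_trans (ler_wpM2l _ IH); last by rewrite addr_ge0.
have := mulr_ge0 (ler0n R n) (mulr_ge0 x0 x0); rewrite -natr1.
lra.
Qed.

Section lyapunov.
Context {R : realType} {d : measure_display} {E : measurableType d}.
Variables (P : R -> E -> probability E R) (V : E -> R) (gamma K : R).
Hypothesis markov_P : markov_tf P.
Hypotheses (measurable_V : measurable_fun setT V) (V_ge0 : forall x, 0 <= V x).
Hypotheses (gamma_gt0 : 0 < gamma) (K_gt0 : 0 < K).
Hypothesis drift_V : lyapunov_drift P V gamma K.
Implicit Types t s h : R.

Let PV t x : \bar R := (\int[P t x]_y (V y)%:E)%E.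

Let PV_ge0 t x : (0 <= PV t x)%E.
Proof. by apply: integral_ge0 => y _; rewrite lee_fin. Qed.

Let measurable_VE : measurable_fun setT (fun x => (V x)%:E).
Proof. exact/measurable_EFinP. Qed.

Lemma markov_affine_le s t x (a b : R) : 0 <= s -> 0 <= t -> 0 <= a -> 0 <= b ->
  (forall y, (PV t y <= (a * V y + b)%:E)%E) ->
  (PV (s + t) x <= a%:E * PV s x + b%:E)%E.
Proof.
move=> s0 t0 a0 b0 PV_le; rewrite /PV chapman_kolmogorov//.
rewrite -integral_affine//; apply: ge0_le_integral => //.
- by move=> y _; exact: PV_ge0.
- by apply: measurable_markov_integral => // y; rewrite lee_fin.
- by apply/measurable_EFinP; apply: measurable_funD => //; exact: measurable_funM.
- by move=> y _; exact: PV_le.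
Qed.

Lemma lyapunov_linear_growth t x : 0 <= t -> (PV t x <= (V x + K * t)%:E)%E.
Proof.
move=> t0; apply: le_trans (drift_V x t0); rewrite leeDl// mule_ge0//.
  by rewrite lee_fin ltW.
by apply: integral_ge0 => s _; exact: PV_ge0.
Qed.

(* t |-> P_t V decreases at most at rate K backwards in time, so P_s V is at
   least P_t V - K t on [0, t]. *)
Lemma lyapunov_step t x : 0 <= t ->
  (PV t x <= ((1 + gamma * t)^-1 * V x + K * t)%:E)%E.
Proof.
move=> t0; have gt0 : 0 < 1 + gamma * t by have := mulr_ge0 (ltW gamma_gt0) t0; lra.
have PV_fin : PV t x \is a fin_num.
  by rewrite ge0_fin_numE// (le_lt_trans (lyapunov_linear_growth x t0))// ltry.
pose w := fine (PV t x); have wE : PV t x = w%:E by rewrite fineK.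
pose c := Num.max 0 (w - K * t).
have c0 : 0 <= c by rewrite le_max lexx.
have c_le s : s \in `[0, t] -> (c%:E <= PV s x)%E.
  rewrite in_itv/= => /andP[s0 st]; rewrite /c EFin_max ge_max PV_ge0/= EFinB leeBlDr//.
  rewrite -wE; have ts0 : 0 <= t - s by rewrite subr_ge0.
  have growth_ts y : (PV (t - s) y <= (1 * V y + K * (t - s))%:E)%E.
    by rewrite mul1r; exact: lyapunov_linear_growth.
  have := markov_affine_le x s0 ts0 ler01 (mulr_ge0 (ltW K_gt0) ts0) growth_ts.
  rewrite subrKC mul1e => /le_trans; apply.
  by rewrite leeD2l// lee_fin ler_pM2l// gerBl.
have ct_le : ((c * t)%:E <= \int[lebesgue_measure]_(s in `[0%R, t]%classic) PV s x)%E.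
  have t_measure : lebesgue_measure (`[0%R, t]%classic : set R) = t%:E.
    rewrite lebesgue_measure_itv/= lte_fin; case: ltP => [_|t_le0].
      by rewrite -EFinB subr0.
    by congr EFin; apply/eqP; rewrite eq_le t0 t_le0.
  by rewrite EFinM -t_measure; apply: cst_le_integral.
have : w + gamma * (c * t) <= V x + K * t.
  rewrite -lee_fin EFinD EFinM -wE; apply: le_trans (drift_V x t0).
  by rewrite leeD2l// lee_pmul2l// lte_fin.
have wc : w - K * t <= c by rewrite le_max lexx orbT.
have := ler_wpM2l (ltW gamma_gt0) (ler_wpM2r t0 wc) => le_gct le_w.
rewrite wE lee_fin -lerBlDr [leRHS]mulrC ler_pdivlMr//; lra.
Qed.

Lemma lyapunov_iter h n x : 0 <= h ->
  (PV (n%:R * h) x <=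
   ((1 + gamma * h)^-1 ^+ n * V x + K / gamma * (1 + gamma * h))%:E)%E.
Proof.
move=> h0; have gh0 := mulr_ge0 (ltW gamma_gt0) h0.
set q := (1 + gamma * h)^-1.
have q0 : 0 <= q by rewrite invr_ge0 addr_ge0.
have C0 : 0 <= K / gamma * (1 + gamma * h).
  by rewrite mulr_ge0 ?divr_ge0 ?(ltW K_gt0) ?(ltW gamma_gt0) ?addr_ge0.
elim: n => [|n IH].
  rewrite mul0r /PV markov0_integral//.
  by rewrite expr0 mul1r lee_fin lerDl.
rewrite -natr1 mulrDl mul1r.
apply: le_trans (markov_affine_le x (mulr_ge0 (ler0n _ _) h0) h0 q0
  (mulr_ge0 (ltW K_gt0) h0) (fun y => lyapunov_step y h0)) _.
apply: (@le_trans _ _ (q%:E *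
  (q ^+ n * V x + K / gamma * (1 + gamma * h))%:E + (K * h)%:E)%E).
  by rewrite leeD2r// lee_wpmul2l// lee_fin.
rewrite -EFinM -EFinD lee_fin mulrDr mulrA -exprS -addrA lerD2l.
rewrite le_eqVlt; apply: predU1l; rewrite /q; field.
by rewrite gt_eqF//= gt_eqF// ltr_pwDl.
Qed.

(* Split [0, t] into n steps of the previous lemma, use Bernoulli's inequality
   for the geometric factor and let n tend to infinity. *)
Lemma lyapunov_decay t x : 0 <= t ->
  (\int[P t x]_y (V y)%:E <= ((1 + gamma * t)^-1 * V x + K / gamma)%:E)%E.
Proof.
move=> t0; apply/lee_addgt0Pr => e e0.
pose n := (Num.truncn (K * t / e)).+1; pose h := t / n%:R.
have h0 : 0 <= h by rewrite divr_ge0// ltW.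
have tE : t = n%:R * h by rewrite mulrC divfK// gt_eqF.
have gh0 : 0 <= gamma * h by rewrite mulr_ge0// ltW.
rewrite {1}tE; apply: le_trans (lyapunov_iter n x h0) _.
rewrite -EFinD lee_fin -addrA; apply: lerD.
  rewrite ler_wpM2r// exprVn lef_pV2 ?posrE ?exprn_gt0 ?ltr_pwDl//;
    last by rewrite mulr_ge0// ltW.
  by rewrite tE mulrCA bernoulli_inequality.
rewrite mulrDr mulr1 lerD2l mulrA divfK ?gt_eqF// mulrA ler_pdivrMr//.
by rewrite -ler_pdivrMl// mulrC ltW// truncnS_gt.
Qed.

Lemma lyapunov_bound t x : 0 <= t ->
  (\int[P t x]_y (V y)%:E <= (V x + K / gamma)%:E)%E.
Proof.
move=> t0; apply: le_trans (lyapunov_decay x t0) _; rewrite lee_fin lerD2r.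
have gt0 : 0 <= gamma * t by rewrite mulr_ge0// ltW.
by rewrite ler_piMl// invf_le1 ?lerDl// ltr_pwDl.
Qed.

End lyapunov.

(** * Contraction for a weighted cost *)

Section powR_lemmas.
Variable R : realType.
Implicit Types a b A B r delta : R.

Lemma ge0_le_powR a b r : 0 <= r -> 0 <= a -> a <= b -> a `^ r <= b `^ r.
Proof.
by move=> r0 a0 ab; apply: ge0_ler_powR => //; rewrite nnegrE// (le_trans a0).
Qed.

Lemma powR_ge1 a r : 0 <= r -> 1 <= a -> 1 <= a `^ r.
Proof.
by move=> r0 a1; have := ge0_le_powR r0 ler01 a1; rewrite powR1.
Qed.

Lemma powR_lt1 a r : 0 < r -> 0 <= a -> a < 1 -> a `^ r < 1.
Proof.
move=> r0 a0 a1; have -> : 1 = 1 `^ r :> R by rewrite powR1.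
by apply: gt0_ltr_powR; rewrite ?nnegrE.
Qed.

Lemma powR_young a b delta : 0 < delta < 1 -> 0 <= a -> 0 <= b ->
  a `^ (1 - delta) * b `^ delta <= (1 - delta) * a + delta * b.
Proof.
move=> /andP[d0 d1] a0 b0; have onem_delta_gt0 : 0 < 1 - delta by rewrite subr_gt0.
have p0 : 0 < (1 - delta)^-1 by rewrite invr_gt0.
have q0 : 0 < delta^-1 by rewrite invr_gt0.
have /(_ _)/le_trans := conjugate_powR (powR_ge0 a (1 - delta)) (powR_ge0 b delta) p0 q0.
rewrite !invrK subrK => /(_ _ erefl); apply.
rewrite -!powRrM !divff ?gt_eqF// !powRr1//.
by rewrite [_ * (1 - delta)]mulrC [_ * delta]mulrC.
Qed.

(* Young's inequality at the normalised values a / A and b / B; integrating it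
   plays the role of Hoelder's inequality. *)
Lemma powR_young_scaled a b A B delta : 0 < delta < 1 -> 0 <= a -> 0 <= b ->
  0 < A -> 0 < B ->
  a `^ (1 - delta) * b `^ delta <=
  A `^ (1 - delta) * B `^ delta * ((1 - delta) / A * a + delta / B * b).
Proof.
move=> d01 a0 b0 A0 B0.
have aA : 0 <= a / A by rewrite divr_ge0// ltW.
have bB : 0 <= b / B by rewrite divr_ge0// ltW.
have -> : a `^ (1 - delta) * b `^ delta =
    A `^ (1 - delta) * B `^ delta * ((a / A) `^ (1 - delta) * (b / B) `^ delta).
  rewrite -{1}(divfK (lt0r_neq0 A0) a) -{1}(divfK (lt0r_neq0 B0) b).
  by rewrite (powRM _ aA (ltW A0)) (powRM _ bB (ltW B0)); ring.
rewrite ler_wpM2l ?mulr_ge0 ?powR_ge0//.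
by rewrite (le_trans (powR_young d01 aA bB))// !mulrA ![_ / _ * _]mulrAC.
Qed.

End powR_lemmas.

Definition wcost (R : realType) (E : Type) (V : E -> R) (c : E -> E -> R)
  (b delta : R) (x y : E) : R :=
  c x y `^ (1 - delta) * (1 + b * (V x + V y)) `^ delta.

Section weighted_cost.
Context {R : realType} {d : measure_display} {E : measurableType d}.
Variables (V : E -> R) (c : E -> E -> R) (b delta : R).
Hypotheses (measurable_V : measurable_fun setT V) (V_ge0 : forall x, 0 <= V x).
Hypothesis unit_c : unit_mfun (fun z : E * E => c z.1 z.2).
Hypotheses (b_ge0 : 0 <= b) (delta01 : 0 < delta < 1).

Local Notation W := (wcost V c b delta).

Definition wlip (a : R) (f : E -> R) :=
  unit_mfun f /\ forall x y, `|f x - f y| <= a * W x y.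

Lemma measurable_wcost : measurable_fun setT (fun z : E * E => W z.1 z.2).
Proof.
apply: measurable_funM.
  exact: (measurableT_comp (measurable_powR _) unit_c.1).
apply: (measurableT_comp (measurable_powR _)).
apply: measurable_funD => //; apply: measurable_funM => //.
by apply: measurable_funD; apply: measurableT_comp.
Qed.

Lemma wcost_ge0 x y : 0 <= W x y.
Proof. by rewrite mulr_ge0 ?powR_ge0. Qed.

Variables (mu nu : probability E R) (vx vy : R).
Hypotheses (mu_V : (\int[mu]_x (V x)%:E <= vx%:E)%E).
Hypotheses (nu_V : (\int[nu]_x (V x)%:E <= vy%:E)%E).

Lemma coupling_affine_le (m : probability (E * E)%type R) (A a0 a1 a2 : R) :
  coupling mu nu m -> (\int[m]_z (c z.1 z.2)%:E <= A%:E)%E ->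
  0 <= a0 -> 0 <= a1 -> 0 <= a2 ->
  (\int[m]_z (a0 * c z.1 z.2 + (a1 * (V z.1 + V z.2) + a2))%:E
   <= (a0 * A + (a1 * (vx + vy) + a2))%:E)%E.
Proof.
move=> cm cA a0_ge0 a1_ge0 a2_ge0.
have [mcE c0] := unit_mfun_EFin unit_c.
have mVE : measurable_fun setT (EFin \o V) by exact/measurable_EFinP.
have mV1 : measurable_fun setT (fun z : E * E => V z.1) by exact: measurableT_comp.
have mV2 : measurable_fun setT (fun z : E * E => V z.2) by exact: measurableT_comp.
have mV12 : measurable_fun setT (fun z : E * E => V z.1 + V z.2).
  exact: measurable_funD.
have V12_ge0 (z : E * E) : 0 <= V z.1 + V z.2 by rewrite addr_ge0.
under eq_integral do rewrite EFinD EFinM.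
rewrite ge0_integralD//; last 4 first.
- by move=> z _; rewrite mule_ge0 ?lee_fin//; exact: c0.
- by apply: measurable_funeM.
- by move=> z _; rewrite lee_fin addr_ge0 ?mulr_ge0.
- by apply/measurable_EFinP; apply: measurable_funD => //; exact: measurable_funM.
rewrite ge0_integralZl_EFin// integral_affine//.
rewrite EFinD EFinM; apply: leeD; first by rewrite lee_wpmul2l ?lee_fin.
rewrite EFinD EFinM leeD2r// lee_wpmul2l ?lee_fin//.
under eq_integral do rewrite EFinD.
rewrite ge0_integralD//; last 4 first.
- by move=> z _; rewrite lee_fin.
- exact/measurable_EFinP.
- by move=> z _; rewrite lee_fin.
- exact/measurable_EFinP.
by rewrite (coupling_integral1 cm mVE) ?(coupling_integral2 cm mVE) ?EFinD ?leeD.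
Qed.

Lemma integral_wcost (m : probability (E * E)%type R) (A : R) : coupling mu nu m ->
  0 < A -> (\int[m]_z (c z.1 z.2)%:E <= A%:E)%E ->
  (\int[m]_z (W z.1 z.2)%:E <=
   (A `^ (1 - delta) * (1 + b * (vx + vy)) `^ delta)%:E)%E.
Proof.
move=> cm A0 cA; have /andP[d0 d1] := delta01.
have V_int_ge0 (p : probability E R) : (0 <= \int[p]_x (V x)%:E)%E.
  by apply: integral_ge0 => x _; rewrite lee_fin.
have vx_ge0 : 0 <= vx by rewrite -lee_fin (le_trans (V_int_ge0 mu)).
have vy_ge0 : 0 <= vy by rewrite -lee_fin (le_trans (V_int_ge0 nu)).
set B := 1 + b * (vx + vy).
have B0 : 0 < B by rewrite ltr_pwDl// mulr_ge0// addr_ge0.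
set S := A `^ (1 - delta) * B `^ delta.
have S0 : 0 <= S by rewrite mulr_ge0 ?powR_ge0.
pose k1 := S * ((1 - delta) / A); pose k2 := S * (delta / B).
have k1_ge0 : 0 <= k1 by rewrite mulr_ge0// divr_ge0 ?(ltW A0)// subr_ge0 ltW.
have k2_ge0 : 0 <= k2 by rewrite mulr_ge0// divr_ge0 ?ltW.
have young_W (z : E * E) :
    W z.1 z.2 <= k1 * c z.1 z.2 + (k2 * b * (V z.1 + V z.2) + k2).
  have c0 : 0 <= c z.1 z.2 by case/andP: (unit_c.2 z).
  have w0 : 0 <= 1 + b * (V z.1 + V z.2) by rewrite addr_ge0// mulr_ge0// addr_ge0.
  apply: le_trans (powR_young_scaled delta01 c0 w0 A0 B0) _.
  by rewrite -/S le_eqVlt; apply: predU1l; rewrite /k1 /k2; ring.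
have -> : S = k1 * A + (k2 * b * (vx + vy) + k2).
  transitivity (k1 * A + k2 * B); last by rewrite /B; ring.
  by rewrite /k1 /k2; field; rewrite !gt_eqF.
apply: le_trans (coupling_affine_le cm cA k1_ge0 (mulr_ge0 k2_ge0 b_ge0) k2_ge0).
apply: ge0_le_integral => //.
- by move=> z _; rewrite lee_fin wcost_ge0.
- by apply/measurable_EFinP; exact: measurable_wcost.
- apply/measurable_EFinP; apply: measurable_funD.
    by apply: measurable_funM => //; exact: unit_c.1.
  apply: measurable_funD => //; apply: measurable_funM => //.
  by apply: measurable_funD; exact: measurableT_comp.
- by move=> z _; rewrite lee_fin.
Qed.

Lemma wlip_transport (A a : R) f : transport_le c mu nu A -> 0 < A ->
  0 <= a -> wlip a f ->
  `|\int[mu]_x f x - \int[nu]_x f x| <=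
  a * (A `^ (1 - delta) * (1 + b * (vx + vy)) `^ delta).
Proof.
move=> [m cm cA] A0 a0 [uf f_lip].
apply: (coupling_Rintegral_dist cm (h := fun z => a * W z.1 z.2)) => //.
  by apply: measurable_funM => //; exact: measurable_wcost.
under eq_integral do rewrite EFinM.
rewrite ge0_integralZl_EFin//; last 2 first.
- by move=> z _; rewrite lee_fin wcost_ge0.
- by apply/measurable_EFinP; exact: measurable_wcost.
by rewrite (EFinM a) lee_wpmul2l ?lee_fin//; exact: integral_wcost.
Qed.

Lemma wlip_product (a : R) f : 0 <= a -> wlip a f ->
  `|\int[mu]_x f x - \int[nu]_x f x| <= a * (1 + b * (vx + vy)) `^ delta.
Proof.
move=> a0 f_lip.
by have := wlip_transport (transport_le1 mu nu unit_c) ltr01 a0 f_lip;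
  rewrite powR1 mul1r.
Qed.

End weighted_cost.

Section weak_harris.
Context {R : realType} {d : measure_display} {E : measurableType d}.
Variables (P : R -> E -> probability E R) (V : E -> R) (c : E -> E -> R).
Variables (C delta : R).
Hypotheses (markov_P : markov_tf P) (measurable_V : measurable_fun setT V).
Hypotheses (V_ge0 : forall x, 0 <= V x) (C_gt0 : 0 < C) (delta01 : 0 < delta < 1).
Hypothesis unit_c : unit_mfun (fun z : E * E => c z.1 z.2).
Hypothesis c_eq0 : forall x y, c x y = 0 -> x = y.
Hypothesis PV_le : forall t x, 0 <= t ->
  (\int[P t x]_y (V y)%:E <= (V x + C)%:E)%E.
Implicit Types (x y : E) (f : E -> R) (a b eta t : R).

Let delta_ge0 : 0 <= delta. Proof. by case/andP: delta01 => /ltW. Qed.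

Let delta_le1 : delta <= 1. Proof. by case/andP: delta01 => _ /ltW. Qed.

Definition weight_growth b := (1 + 2 * b * C) `^ delta.

Lemma weight_growth_ge0 b : 0 <= weight_growth b.
Proof. exact: powR_ge0. Qed.

Lemma weight_growth_ge1 b : 0 < b -> 1 <= weight_growth b.
Proof. by move=> b0; apply: powR_ge1 => //; rewrite lerDl !mulr_ge0// ltW. Qed.

Lemma weight_growthP b x y : 0 < b ->
  (1 + b * ((V x + C) + (V y + C))) `^ delta <=
  weight_growth b * (1 + b * (V x + V y)) `^ delta.
Proof.
move=> b0; have bV_ge0 : 0 <= b * (V x + V y) by rewrite mulr_ge0 ?addr_ge0// ltW.
have bC_ge0 : 0 <= 2 * b * C by rewrite mulr_ge0 ?(ltW C_gt0)// mulr_ge0// ltW.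
rewrite /weight_growth -powRM ?addr_ge0//; apply: ge0_le_powR => //.
  by rewrite addr_ge0// mulr_ge0 ?(ltW b0)// !addr_ge0// ltW.
rewrite -subr_ge0 [leRHS](_ : _ = 2 * b * C * (b * (V x + V y))); last by ring.
exact: mulr_ge0.
Qed.

Lemma exists_small_weight (k : nat) eta : (0 < k)%N -> 0 < eta < 1 ->
  exists2 b, 0 < b & weight_growth b ^+ k * eta `^ (1 - delta) < 1.
Proof.
move=> k_gt0 /andP[eta0 eta1]; have /andP[_ d1] := delta01.
set e := eta `^ (1 - delta).
have e0 : 0 < e by exact: powR_gt0.
have e1 : e < 1 by apply: powR_lt1; rewrite ?subr_gt0// ltW.
have k0 : 0 < k%:R :> R by rewrite ltr0n.
have ln_e : ln e < 0 by rewrite ln_lt0// e0 e1.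
pose b := - ln e / (4 * k%:R * C).
have b0 : 0 < b by rewrite divr_gt0 ?oppr_gt0 ?mulr_gt0.
exists b => //; have bC0 : 0 <= 2 * b * C.
  by rewrite mulr_ge0 ?(ltW C_gt0)// mulr_ge0// ltW.
apply: (@le_lt_trans _ _ (expR (k%:R * (2 * b * C)) * expR (ln e))).
  rewrite lnK ?posrE// ler_pM2r// expRM_natl lerXn2r ?nnegrE ?expR_ge0 ?powR_ge0//.
  by rewrite (le_trans (ler1_powR _ delta_le1))// ?expR_ge1Dx// lerDl.
rewrite -expRD expR_lt1 (_ : k%:R * _ = - ln e / 2); first lra.
by rewrite /b; field; rewrite !gt_eqF.
Qed.

Lemma Psg_transport_le t x y eta a b f : 0 <= t -> 0 < b -> 0 < eta -> 0 <= a ->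
  transport_le c (P t x) (P t y) (eta * c x y) -> wlip V c b delta a f ->
  `|Psg P t f x - Psg P t f y| <=
  weight_growth b * eta `^ (1 - delta) * a * wcost V c b delta x y.
Proof.
move=> t0 b0 eta0 a0 transport_xy f_lip.
have [c0|c_neq0] := eqVneq (c x y) 0.
  by rewrite (c_eq0 c0) subrr normr0 mulr_ge0 ?wcost_ge0// !mulr_ge0 ?powR_ge0.
have c_ge0 : 0 <= c x y by case/andP: (unit_c.2 (x, y)).
have c_gt0 : 0 < c x y by rewrite lt_def c_neq0.
apply: le_trans (wlip_transport measurable_V V_ge0 unit_c (ltW b0) delta01
  (PV_le x t0) (PV_le y t0) transport_xy (mulr_gt0 eta0 c_gt0) a0 f_lip) _.
rewrite (powRM _ (ltW eta0) c_ge0).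
rewrite [leRHS](_ : _ = a * (eta `^ (1 - delta) * c x y `^ (1 - delta) *
  (weight_growth b * (1 + b * (V x + V y)) `^ delta))); last by rewrite /wcost; ring.
by rewrite ler_wpM2l// ler_wpM2l ?mulr_ge0 ?powR_ge0// weight_growthP.
Qed.

Lemma wlip_Psg_nonexpansive t a b f : 0 <= t -> 0 < b -> 0 <= a ->
  (forall x y, c x y < 1 -> transport_le c (P t x) (P t y) (c x y)) ->
  wlip V c b delta a f -> wlip V c b delta (weight_growth b * a) (Psg P t f).
Proof.
move=> t0 b0 a0 transport_lt1 f_lip; split=> [|x y].
  by apply: Psg_unit_mfun => //; case: f_lip.
have transport_xy : transport_le c (P t x) (P t y) (1 * c x y).
  rewrite mul1r; have [/transport_lt1//|c_ge1] := ltP (c x y) 1.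
  exact: transport_le_widen c_ge1 (transport_le1 _ _ unit_c).
have := Psg_transport_le t0 b0 ltr01 a0 transport_xy f_lip.
by rewrite powR1 mulr1.
Qed.

Lemma wlip_Psg_iter t a b f n : 0 <= t -> 0 < b -> 0 <= a ->
  (forall x y, c x y < 1 -> transport_le c (P t x) (P t y) (c x y)) ->
  wlip V c b delta a f ->
  wlip V c b delta (weight_growth b ^+ n * a) (Psg P (n%:R * t) f).
Proof.
move=> t0 b0 a0 transport_lt1 f_lip; elim: n => [|n IH].
  by rewrite mul0r mul1r Psg0//; case: f_lip.
rewrite Psg_natmulS//; last by case: f_lip.
rewrite exprS -mulrA; apply: wlip_Psg_nonexpansive => //.
by rewrite mulr_ge0// exprn_ge0// weight_growth_ge0.
Qed.

Lemma Psg_close_le tau eta a b f n x y : 0 <= tau -> 0 < b -> 0 < eta < 1 ->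
  0 <= a ->
  (forall x y, c x y < 1 -> transport_le c (P tau x) (P tau y) (eta * c x y)) ->
  c x y < 1 -> wlip V c b delta a f ->
  `|Psg P (n.+1%:R * tau) f x - Psg P (n.+1%:R * tau) f y| <=
  weight_growth b ^+ n.+1 * eta `^ (1 - delta) * a * wcost V c b delta x y.
Proof.
move=> tau0 b0 /andP[eta0 eta1] a0 close_le c_lt1 f_lip; have [uf _] := f_lip.
have step_le z z' : c z z' < 1 -> transport_le c (P tau z) (P tau z') (c z z').
  move=> /close_le; apply: transport_le_widen.
  by rewrite ler_piMl ?(ltW eta1)//; case/andP: (unit_c.2 (z, z')).
have f_iter := wlip_Psg_iter n tau0 b0 a0 step_le f_lip.
have iter_ge0 : 0 <= weight_growth b ^+ n * a.
  by rewrite mulr_ge0// exprn_ge0// weight_growth_ge0.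
rewrite Psg_natmulS//; apply: le_trans (Psg_transport_le tau0 b0 eta0 iter_ge0
  (close_le _ _ c_lt1) f_iter) _.
by rewrite exprS le_eqVlt; apply: predU1l; ring.
Qed.

Section drift.
Variables (q S : R).
Hypotheses (q_ge0 : 0 <= q) (S_gt0 : 0 < S) (drift_lt : 2 * C + q * S < S).

Definition drift_ratio b := (1 + b * (2 * C + q * S)) / (1 + b * S).

Lemma drift_ratio_gt0 b : 0 < b -> 0 < drift_ratio b.
Proof.
move=> b0; rewrite divr_gt0// ltr_pwDl ?mulr_ge0 ?(ltW b0) ?(ltW S_gt0)//.
by rewrite addr_ge0 ?mulr_ge0// ltW.
Qed.

Lemma drift_ratio_lt1 b : 0 < b -> drift_ratio b < 1.
Proof.
move=> b0; rewrite ltr_pdivrMr ?mul1r ?ltrD2l ?ltr_pM2l//.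
by rewrite addr_gt0// mulr_gt0.
Qed.

(* The quotient (1 + b (q u + 2 C)) / (1 + b u) is nonincreasing in u, and
   drift_ratio b is its value at u = S. *)
Lemma drift_ratioP b (u : R) : 0 < b -> S <= u ->
  1 + b * (q * u + 2 * C) <= drift_ratio b * (1 + b * u).
Proof.
move=> b0 Su; rewrite /drift_ratio mulrAC ler_pdivlMr; last first.
  by rewrite addr_gt0// mulr_gt0.
have q_le1 : q <= 1.
  by have := drift_lt; have := C_gt0; rewrite -(ler_pM2r S_gt0) mul1r; lra.
rewrite -subr_ge0 [leRHS](_ : _ = b * (u - S) * (1 - q + 2 * b * C)); last by ring.
apply: mulr_ge0; first by rewrite mulr_ge0 ?subr_ge0// ltW.
by rewrite addr_ge0 ?subr_ge0// mulr_ge0 ?(ltW C_gt0)// mulr_ge0// ltW.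
Qed.

Lemma Psg_drift_le t a b f x y : 0 < b -> 0 <= a ->
  (forall x, \int[P t x]_y (V y)%:E <= (q * V x + C)%:E)%E ->
  c x y = 1 -> S <= V x + V y -> wlip V c b delta a f ->
  `|Psg P t f x - Psg P t f y| <=
  drift_ratio b `^ delta * a * wcost V c b delta x y.
Proof.
move=> b0 a0 PV_drift c1 V_large f_lip.
apply: le_trans (wlip_product measurable_V V_ge0 unit_c (ltW b0) delta01
  (PV_drift x) (PV_drift y) a0 f_lip) _.
rewrite /wcost c1 powR1 mul1r -mulrA mulrCA ler_wpM2l//.
rewrite -powRM ?(ltW (drift_ratio_gt0 b0))//; last first.
  by rewrite addr_ge0// mulr_ge0 ?(ltW b0)// addr_ge0.
have qV_ge0 z : 0 <= q * V z + C by rewrite addr_ge0 ?mulr_ge0// ltW.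
apply: ge0_le_powR => //; first by rewrite addr_ge0// mulr_ge0 ?(ltW b0)// addr_ge0.
by apply: le_trans (drift_ratioP b0 V_large); rewrite lerD2l ler_pM2l//; lra.
Qed.

(* A pair with c x y < 1 is contracted during a first lapse of time tau, the
   remaining k.-1 lapses costing at most the factor weight_growth b each. *)
Lemma weak_harris (tau eta : R) (k : nat) : 0 < tau -> (0 < k)%N -> 0 < eta < 1 ->
  (forall x y, c x y < 1 -> transport_le c (P tau x) (P tau y) (eta * c x y)) ->
  (forall x y, V x <= S -> V y <= S ->
     transport_le c (P (k%:R * tau) x) (P (k%:R * tau) y) eta) ->
  (forall x, \int[P (k%:R * tau) x]_y (V y)%:E <= (q * V x + C)%:E)%E ->
  exists b al, [/\ 0 < b, 0 < al < 1 & forall a f, 0 <= a ->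
    wlip V c b delta a f -> wlip V c b delta (al * a) (Psg P (k%:R * tau) f)].
Proof.
move=> tau0 k_gt0 eta01 close_le small_le PV_drift.
have tau_ge0 := ltW tau0; have /andP[eta0 eta1] := eta01.
have [b b0 growth_lt1] := exists_small_weight k_gt0 eta01.
have ratio_lt1 : drift_ratio b `^ delta < 1.
  apply: powR_lt1 (drift_ratio_lt1 b0); first by case/andP: delta01.
  exact: ltW (drift_ratio_gt0 b0).
pose al := Num.max (weight_growth b ^+ k * eta `^ (1 - delta)) (drift_ratio b `^ delta).
have al0 : 0 < al by rewrite lt_max (powR_gt0 _ (drift_ratio_gt0 b0)) orbT.
exists b, al; split=> //; first by rewrite al0 gt_max growth_lt1.
move=> a f a0 f_lip; have [uf _] := f_lip.
have le_al u x y : u <= al ->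
    u * a * wcost V c b delta x y <= al * a * wcost V c b delta x y.
  by move=> u_al; rewrite !ler_wpM2r ?wcost_ge0.
have growth_al : weight_growth b ^+ k * eta `^ (1 - delta) <= al by rewrite le_max lexx.
split=> [|x y]; first by apply: Psg_unit_mfun; rewrite // mulr_ge0.
have [c_lt1|c_ge1] := ltP (c x y) 1.
  apply: le_trans (le_al _ x y growth_al); rewrite -(prednK k_gt0).
  exact: Psg_close_le.
have c1 : c x y = 1.
  by apply/eqP; rewrite eq_le c_ge1 andbT; case/andP: (unit_c.2 (x, y)).
have [[Vx Vy]|not_small] := pselect (V x <= S /\ V y <= S).
  have transport_xy :
      transport_le c (P (k%:R * tau) x) (P (k%:R * tau) y) (eta * c x y).
    by rewrite c1 mulr1; exact: small_le.
  have T0 : 0 <= k%:R * tau by rewrite mulr_ge0.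
  apply: le_trans (Psg_transport_le T0 b0 eta0 a0 transport_xy f_lip) _.
  apply: le_trans (le_al _ x y growth_al).
  rewrite !ler_wpM2r ?wcost_ge0 ?powR_ge0// -(prednK k_gt0) exprS.
  by rewrite ler_peMr ?weight_growth_ge0// exprn_ege1// weight_growth_ge1.
have V_large : S <= V x + V y.
  have [Vx|/ltW Vx] := leP (V x) S; last by rewrite (le_trans Vx)// lerDl.
  have [Vy|/ltW Vy] := leP (V y) S; last by rewrite (le_trans Vy)// lerDr.
  by case: not_small.
apply: le_trans (Psg_drift_le b0 a0 PV_drift c1 V_large f_lip) (le_al _ x y _).
by rewrite le_max lexx orbT.
Qed.

End drift.

End weak_harris.

Section law_marginal.
Context {R : realType} {d : measure_display} {E : measurableType d}.
Variable P : R -> E -> probability E R.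

Lemma law_is_Px_marginal (dO : measure_display) (O : measurableType dO)
    (Pr : probability O R) (X : R -> O -> E) x t A :
  law_is_Px Pr X P x -> 0 <= t -> measurable A -> Pr (X t @^-1` A) = P t x A.
Proof.
move=> [_ fdd_X] t0 mA; have := fdd_X [:: (t, A)].
rewrite /= t0 => /(_ isT) /(_ _); rewrite add0r.
have -> : (\int[P t x]_(y in A) 1 = P t x A)%E.
  by rewrite (_ : (fun=> 1%E) = cst 1%E)// integral_cst// [LHS]mul1e.
move=> <-; last by move=> p; rewrite inE => /eqP ->.
by congr (Pr _); apply/seteqP; split=> w /=; [split|case].
Qed.

End law_marginal.

Definition tcost (R : realType) (E : Type) (theta : E -> E -> R) (N : R) (x y : E) : R :=
  Num.min (N * theta x y) 1.

Section truncated_cost.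
Context {R : realType} {d : measure_display} {E : measurableType d}.
Variables (rho : E -> E -> R) (theta : E -> E -> R).
Hypotheses (polish_rho : polish rho) (premetric_theta : premetric rho theta).

Let theta_ge0 x y : 0 <= theta x y. Proof. by case: premetric_theta. Qed.

Lemma measurable_premetric : measurable_fun setT (fun z : E * E => theta z.1 z.2).
Proof. by apply: (measurable_rho_lsc2 polish_rho); case: premetric_theta. Qed.

Lemma tcost_unit_mfun (N : R) : 0 <= N ->
  unit_mfun (fun z : E * E => tcost theta N z.1 z.2).
Proof.
move=> N0; split=> [|z]; last by rewrite /tcost le_min ler01 mulr_ge0//= ge_min lexx orbT.
apply: measurable_minr => //; apply: measurable_funM => //.
exact: measurable_premetric.
Qed.

Lemma tcost_eq0 (N : R) x y : 0 < N -> tcost theta N x y = 0 -> x = y.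
Proof.
move=> N0; rewrite /tcost; case: leP => [_ /eqP|_ /eqP]; last by rewrite oner_eq0.
rewrite mulf_eq0 gt_eqF//= => /eqP.
by case: premetric_theta => _ theta_eq0 _ /theta_eq0.
Qed.

Lemma transport_le_generalized_coupling (P : R -> E -> probability E R) x y t
    (N s tau : R) (dO : measure_display) (O : measurableType dO)
    (Pr : probability O R) (X Y : R -> O -> E) :
  0 <= t -> 0 <= N -> law_is_Px Pr X P x -> measurable_fun setT (Y t) ->
  (dTV (pushforward Pr (Y t)) (P t y) <= tau%:E)%E ->
  (\int[Pr]_w (theta (X t w) (Y t w))%:E <= s%:E)%E ->
  transport_le (tcost theta N) (P t x) (P t y) (N * s + tau).
Proof.
move=> t0 N0 law_X mY tv theta_s.
have mX : measurable_fun setT (X t) by exact: law_X.1.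
have mXY : measurable_fun setT (fun w => (X t w, Y t w)) by exact: measurable_fun_pair.
have [nu [nuE _]] := exists_law Pr mY.
have [Q [QE Q_int]] := exists_law Pr mXY.
have uc := tcost_unit_mfun N0; have [mcE c0] := unit_mfun_EFin uc.
apply: (transport_le_dTV (nu := nu)) => //; last first.
  apply: le_trans tv; apply: le_ereal_sup => _ [A mA <-].
  by exists A => //; rewrite /pushforward -nuE.
exists Q.
  split=> A mA; rewrite QE.
    rewrite -(law_is_Px_marginal law_X)//; congr (Pr _).
    by apply/seteqP; split=> w /=; [case|].
  by rewrite nuE; congr (Pr _); apply/seteqP; split=> w /=; [case|].
rewrite Q_int//= EFinM; apply: le_trans (lee_wpmul2l _ theta_s); last by rewrite lee_fin.
have m_theta : measurable_fun setT (fun w => theta (X t w) (Y t w)).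
  exact: (measurableT_comp measurable_premetric mXY).
rewrite -ge0_integralZl_EFin//; last 2 first.
- by move=> w _; rewrite lee_fin.
- exact/measurable_EFinP.
apply: ge0_le_integral => //.
- by move=> w _; exact: (c0 (X t w, Y t w)).
- exact: (measurableT_comp mcE mXY).
- by apply: measurable_funeM; exact/measurable_EFinP.
- by move=> w _; rewrite -EFinM lee_fin ge_min lexx.
Qed.

End truncated_cost.

Lemma cvg0_pinfty_le (R : realType) (h : R -> R) (e : R) :
  h t @[t --> +oo] --> 0 -> 0 < e -> exists2 M, 0 <= M & forall t, M < t -> h t <= e.
Proof.
move=> /cvgrPdist_le h_cvg e0; have [M [_ h_le]] := h_cvg e e0.
exists (Num.max M 0) => [|t]; first by rewrite le_max lexx orbT.
rewrite gt_max => /andP[Mt _]; have := h_le t Mt; rewrite sub0r normrN.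
by apply: le_trans; exact: ler_norm.
Qed.

Section assumptions_transport.
Context {R : realType} {d : measure_display} {E : measurableType d}.
Variables (rho : E -> E -> R) (P : R -> E -> probability E R) (theta : E -> E -> R).
Hypotheses (polish_rho : polish rho) (premetric_theta : premetric rho theta).

Lemma assumptionA_transport (r L : R -> R) : assumptionA P theta r L ->
  exists tau N : R, [/\ 0 < tau, 1 <= N & forall x y, tcost theta N x y < 1 ->
    transport_le (tcost theta N) (P tau x) (P tau y) (1 / 2 * tcost theta N x y)].
Proof.
move=> [_ _ r_cvg [L_ge0 _] couplings].
have quarter_gt0 : 0 < 1 / 4 :> R by lra.
have [M M_ge0 r_le] := cvg0_pinfty_le r_cvg quarter_gt0.
pose tau := M + 1; have tau0 : 0 < tau by rewrite ltr_wpDl.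
have r_tau : r tau <= 1 / 4 by apply: r_le; rewrite ltrDl.
pose N := 1 + 4 * L tau; have L0 := L_ge0 _ (ltW tau0).
have N1 : 1 <= N by rewrite lerDl mulr_ge0.
have N0 : 0 < N by exact: lt_le_trans N1.
exists tau, N; split=> // x y.
have tcostE : tcost theta N x y = Num.min (N * theta x y) 1 by [].
rewrite tcostE gt_min ltxx orbF => Ntheta_lt1; rewrite (min_l (ltW Ntheta_lt1)).
have [dO [Om [Pr [X [Y [law_X mY tv theta_r]]]]]] := couplings x y.
have theta0 : 0 <= theta x y by case: premetric_theta.
apply: transport_le_widen (transport_le_generalized_coupling polish_rho
  premetric_theta (ltW tau0) (ltW N0) law_X (mY _ (ltW tau0)) (tv _ (ltW tau0))
  (theta_r _ (ltW tau0))).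
rewrite !mulrA -mulrDl ler_wpM2r//.
have N_E : N = 1 + 4 * L tau by [].
have := ler_wpM2l (ltW N0) r_tau; lra.
Qed.

Lemma assumptionB2_transport (B : set E) (Rf : R -> R) (eps N : R) :
  assumptionB2 P theta B Rf eps -> 0 < N ->
  exists eta t0 : R, [/\ 0 < eta < 1, 0 <= t0 & forall t x y, t0 < t -> B x -> B y ->
    transport_le (tcost theta N) (P t x) (P t y) eta].
Proof.
move=> [Rf_ge0 _ Rf_cvg eps0 couplings] N0.
pose e := Num.min eps 1.
have e0 : 0 < e by rewrite lt_min eps0 ltr01.
have e_eps : e <= eps by rewrite ge_min lexx.
have e_le1 : e <= 1 by rewrite ge_min lexx orbT.
have eN0 : 0 < e / (2 * N) by rewrite divr_gt0// mulr_gt0.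
have [t0 t0_ge0 Rf_le] := cvg0_pinfty_le Rf_cvg eN0.
exists (1 - e / 2), t0; split=> [|//|t x y t0t Bx By]; first lra.
have t_ge0 : 0 <= t by rewrite ltW// (le_lt_trans t0_ge0).
have [dO [Om [Pr [X [Y [law_X mY tv theta_R]]]]]] := couplings x y Bx By.
apply: transport_le_widen (transport_le_generalized_coupling polish_rho
  premetric_theta t_ge0 (ltW N0) law_X (mY _ t_ge0) (tv _ t_ge0) (theta_R _ t_ge0)).
have := ler_wpM2l (ltW N0) (Rf_le t t0t).
rewrite (_ : N * (e / (2 * N)) = e / 2); last by field; rewrite gt_eqF.
lra.
Qed.

End assumptions_transport.

Section semigroup_contraction.
Context {R : realType} {d : measure_display} {E : measurableType d}.
Variables (rho : E -> E -> R) (P : R -> E -> probability E R).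
Variables (V : E -> R) (gamma K : R) (theta : E -> E -> R) (r L Rf : R -> R).
Variables (eps delta : R).
Hypotheses (polish_rho : polish rho) (markov_P : markov_tf P).
Hypotheses (measurable_V : measurable_fun setT V) (V_ge0 : forall x, 0 <= V x).
Hypotheses (gamma_gt0 : 0 < gamma) (K_gt0 : 0 < K).
Hypothesis drift_V : lyapunov_drift P V gamma K.
Hypothesis premetric_theta : premetric rho theta.
Hypothesis assumptionA_P : assumptionA P theta r L.
Hypothesis assumptionB2_P :
  assumptionB2 P theta [set x | V x <= 4 * K / gamma] Rf eps.
Hypothesis delta01 : 0 < delta < 1.

Lemma Psg_contraction : exists T N b al : R, [/\ 0 < T, 1 <= N, 0 < b, 0 < al < 1 &
  forall (a : R) f, 0 <= a -> wlip V (tcost theta N) b delta a f ->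
    wlip V (tcost theta N) b delta (al * a) (Psg P T f)].
Proof.
have [tau [N [tau0 N1 close_le]]] :=
  assumptionA_transport polish_rho premetric_theta assumptionA_P.
have N0 : 0 < N by exact: lt_le_trans N1.
have [eta [t0 [/andP[eta0 eta1] t0_ge0 small_le]]] :=
  assumptionB2_transport polish_rho premetric_theta assumptionB2_P N0.
have unit_c := tcost_unit_mfun polish_rho premetric_theta (ltW N0).
have C0 : 0 < K / gamma by exact: divr_gt0.
have S0 : 0 < 4 * K / gamma by rewrite divr_gt0// mulr_gt0.
pose k := (Num.truncn ((t0 + 3 / gamma) / tau)).+1; pose T := k%:R * tau.
have T_large : t0 + 3 / gamma < T by rewrite -ltr_pdivrMr// truncnS_gt.
have g3 : 0 < 3 / gamma by exact: divr_gt0.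
have T0 : 0 < T by lra.
have decay_T : (1 + gamma * T)^-1 <= 1 / 4.
  rewrite -[leRHS]invrK lef_pV2 ?posrE ?invr_gt0 ?addr_gt0 ?mulr_gt0//.
  have : 3 < gamma * T by rewrite mulrC -ltr_pdivrMr//; lra.
  lra.
have PV_drift x : (\int[P T x]_y (V y)%:E <= (1 / 4 * V x + K / gamma)%:E)%E.
  apply: le_trans (lyapunov_decay markov_P measurable_V V_ge0 gamma_gt0 K_gt0
    drift_V x (ltW T0)) _.
  by rewrite lee_fin lerD2r ler_wpM2r.
pose eta' := Num.max (1 / 2) eta.
have eta'01 : 0 < eta' < 1 by rewrite lt_max gt_max eta0 eta1 orbT; lra.
have quarter_ge0 : 0 <= 1 / 4 :> R by lra.
have drift_lt : 2 * (K / gamma) + 1 / 4 * (4 * K / gamma) < 4 * K / gamma by lra.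
have [||b [al [b0 al01 contr]]] := weak_harris markov_P measurable_V V_ge0 C0 delta01
  unit_c (fun x y => tcost_eq0 premetric_theta N0)
  (lyapunov_bound markov_P measurable_V V_ge0 gamma_gt0 K_gt0 drift_V)
  quarter_ge0 S0 drift_lt tau0 (ltn0Sn _ : 0 < k)%N eta'01 _ _ PV_drift.
- move=> x y /close_le; apply: transport_le_widen.
  by rewrite ler_wpM2r ?le_max ?lexx//; case/andP: (unit_c.2 (x, y)).
- move=> x y Vx Vy; apply: transport_le_widen (small_le T x y _ Vx Vy).
    by rewrite le_max lexx orbT.
  lra.
by exists T, N, b, al.
Qed.

End semigroup_contraction.

(** * Kantorovich-Rubinstein duality *)

Section finite_index.
Context {R : realType} {d : measure_display} {T : measurableType d} {I : finType}.
Variables (mu : probability T R) (J : T -> I).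
Hypothesis measurable_J : forall i, measurable (J @^-1` [set i]).

Definition index_mass (i : I) : R := fine (mu (J @^-1` [set i])).

Lemma index_mass_ge0 i : 0 <= index_mass i. Proof. exact: fine_ge0. Qed.

Lemma index_massE i : mu (J @^-1` [set i]) = (index_mass i)%:E.
Proof. by rewrite fineK// fin_num_measure. Qed.

Lemma measurable_fun_finite_index d' (T' : measurableType d') (h : I -> T') :
  measurable_fun setT (h \o J).
Proof.
move=> _ Y mY; rewrite setTI.
have -> : (h \o J) @^-1` Y =
    \bigcup_i (if `[< Y (h i) >] then J @^-1` [set i] else set0).
  apply/seteqP; split=> [x Yx|x [i _]] /=.
    by exists (J x) => //; case: asboolP.
  by case: asboolP => // Yi /= ->.
apply: countable_bigcupT_measurable => [|i]; first exact: countableP.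
by case: asboolP.
Qed.

Lemma integral_finite_index (A : set T) (h : I -> R) : measurable A ->
  (forall i, 0 <= h i) ->
  (\int[mu]_(x in A) (h (J x))%:E =
   \sum_i (h i)%:E * mu (A `&` J @^-1` [set i]))%E.
Proof.
move=> mA h0.
transitivity (\int[mu]_(x in A) (\sum_i (h i)%:E * (\1_(J @^-1` [set i]) x)%:E))%E.
  apply: eq_integral => x _; rewrite (bigD1 (J x))//= indicE mem_set// mule1.
  rewrite big1 ?adde0// => i /eqP iJ; rewrite indicE memNset ?mule0//.
  by move=> /= /esym.
rewrite ge0_integral_sum//; last 2 first.
- by move=> i; apply/measurable_EFinP; apply: measurable_funM.
- by move=> i x _; rewrite -EFinM lee_fin mulr_ge0.
apply: eq_bigr => i _; rewrite ge0_integralZl_EFin ?integral_indic 1?setIC//.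
by apply/measurable_EFinP; exact: measurable_funTS.
Qed.

Lemma measure_finite_index (A : set T) : measurable A ->
  (\sum_i mu (A `&` J @^-1` [set i]) = mu A)%E.
Proof.
move=> mA; rewrite -[RHS]mul1e -integral_cst//.
rewrite (integral_finite_index mA (h := fun=> 1))//.
by apply: eq_bigr => i _; rewrite mul1e.
Qed.

Lemma sum_index_mass : \sum_i index_mass i = 1.
Proof.
apply: EFin_inj; rewrite -sumEFin -(@probability_setT _ _ _ mu).
rewrite -(measure_finite_index measurableT).
by apply: eq_bigr => i _; rewrite setTI index_massE.
Qed.

Lemma Rintegral_finite_index (h : I -> R) : (forall i, 0 <= h i) ->
  \int[mu]_x h (J x) = \sum_i h i * index_mass i.
Proof.
move=> h0; rewrite /Rintegral integral_finite_index//.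
by under eq_bigr do rewrite setTI index_massE -EFinM; rewrite sumEFin.
Qed.

End finite_index.

Section joint_index.
Context {R : realType} {d : measure_display} {T : measurableType d} {I J : finType}.
Variables (mu : probability T R) (X : T -> I) (Y : T -> J).
Hypotheses (measurable_X : forall i, measurable (X @^-1` [set i])).
Hypotheses (measurable_Y : forall j, measurable (Y @^-1` [set j])).

Definition joint_index (w : T) : I * J := (X w, Y w).

Lemma joint_index_fiber i j :
  joint_index @^-1` [set (i, j)] = X @^-1` [set i] `&` Y @^-1` [set j].
Proof. by rewrite /joint_index; apply/seteqP; split=> w /= [-> ->]. Qed.

Lemma measurable_joint_index ij : measurable (joint_index @^-1` [set ij]).
Proof. by case: ij => i j; rewrite joint_index_fiber; exact: measurableI. Qed.

Lemma integral_joint_index (h l : I -> J -> R) : (forall i j, 0 <= h i j) ->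
  (forall i j, mu (X @^-1` [set i] `&` Y @^-1` [set j]) = (l i j)%:E) ->
  (\int[mu]_w (h (X w) (Y w))%:E = (\sum_i \sum_j h i j * l i j)%:E)%E.
Proof.
move=> h0 muE; rewrite (integral_finite_index mu measurable_joint_index measurableT
  (h := fun ij => h ij.1 ij.2))//.
rewrite pair_bigA -sumEFin; apply: eq_bigr => -[i j] _.
by rewrite setTI joint_index_fiber muE EFinM.
Qed.

End joint_index.

Section coupling_of_plan.
Context {R : realType} {d : measure_display} {E : measurableType d} {I J : finType}.
Variables (mu nu : probability E R) (X : E -> I) (Y : E -> J) (l : I -> J -> R).
Hypotheses (measurable_X : forall i, measurable (X @^-1` [set i])).
Hypotheses (measurable_Y : forall j, measurable (Y @^-1` [set j])).
Hypothesis l_ge0 : forall i j, 0 <= l i j.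
Hypothesis l_row : forall i, \sum_j l i j = index_mass mu X i.
Hypothesis l_col : forall j, \sum_i l i j = index_mass nu Y j.

Local Notation p := (index_mass mu X).
Local Notation q := (index_mass nu Y).

Local Notation XY := (joint_index (X \o @fst E E) (Y \o @snd E E)).

Let XY_fiber i j : XY @^-1` [set (i, j)] = X @^-1` [set i] `*` Y @^-1` [set j].
Proof. exact: joint_index_fiber. Qed.

Let measurable_XY ij : measurable (XY @^-1` [set ij]).
Proof. by case: ij => i j; rewrite XY_fiber; exact: measurableX. Qed.

(* The denominator vanishes only where l does, and then the quotient is 0. *)
Let weight (ij : I * J) : R := l ij.1 ij.2 / (p ij.1 * q ij.2).

Let weight_ge0 ij : 0 <= weight ij.
Proof. by rewrite divr_ge0// mulr_ge0// index_mass_ge0. Qed.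

Let weight_mass i j : weight (i, j) * (p i * q j) = l i j.
Proof.
have l_le_p : l i j <= p i by rewrite -l_row (bigD1 j)//= lerDl sumr_ge0.
have l_le_q : l i j <= q j by rewrite -l_col (bigD1 i)//= lerDl sumr_ge0.
have [pq0|pq_neq0] := eqVneq (p i * q j) 0; last by rewrite divfK.
rewrite pq0 mulr0; apply/esym/eqP; rewrite eq_le l_ge0 andbT.
by move/eqP: pq0; rewrite mulf_eq0 => /orP[] /eqP <-.
Qed.

Let marginal_weight1 i (a : R) : 0 <= a <= p i -> \sum_j weight (i, j) * (a * q j) = a.
Proof.
move=> /andP[a0 ap]; have [p0|p_neq0] := eqVneq (p i) 0.
  have -> : a = 0 by apply/eqP; rewrite eq_le a0 -p0 ap.
  by rewrite big1// => j _; rewrite mul0r mulr0.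
transitivity (\sum_j a / p i * l i j); last by rewrite -mulr_sumr l_row divfK.
by apply: eq_bigr => j _; rewrite -(weight_mass i j); field.
Qed.

Let marginal_weight2 j (a : R) : 0 <= a <= q j -> \sum_i weight (i, j) * (p i * a) = a.
Proof.
move=> /andP[a0 aq]; have [q0|q_neq0] := eqVneq (q j) 0.
  have -> : a = 0 by apply/eqP; rewrite eq_le a0 -q0 aq.
  by rewrite big1// => i _; rewrite !mulr0.
transitivity (\sum_i a / q j * l i j); last by rewrite -mulr_sumr l_col divfK.
by apply: eq_bigr => i _; rewrite -(weight_mass i j); field.
Qed.

Let measurable_weight : measurable_fun setT (EFin \o (weight \o XY)).
Proof. by apply/measurable_EFinP; exact: measurable_fun_finite_index. Qed.

Let m : {measure set (E * E)%type -> \bar R} :=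
  density (mu \x nu)%E measurable_weight (fun z => weight_ge0 (XY z)).

Let m_setX (A B : set E) : measurable A -> measurable B ->
  m (A `*` B) = (\sum_i \sum_j weight (i, j) *
    (fine (mu (A `&` X @^-1` [set i])) * fine (nu (B `&` Y @^-1` [set j]))))%:E.
Proof.
move=> mA mB; have mAB : measurable (A `*` B) by exact: measurableX.
rewrite [LHS](integral_finite_index _ measurable_XY mAB weight_ge0).
rewrite pair_bigA -sumEFin; apply: eq_bigr => -[i j] _ /=; rewrite XY_fiber.
have -> : (A `*` B) `&` (X @^-1` [set i] `*` Y @^-1` [set j]) =
    (A `&` X @^-1` [set i]) `*` (B `&` Y @^-1` [set j]).
  by apply/seteqP; split=> -[x y] /= [[? ?] [? ?]].
have mAi := measurableI _ _ mA (measurable_X i).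
have mBj := measurableI _ _ mB (measurable_Y j).
rewrite (EFinM (weight _)) (EFinM (fine _)) !fineK ?fin_num_measure//.
by congr (_ * _)%E; exact: product_measure1E.
Qed.

Lemma coupling_of_plan : exists2 Q : probability (E * E)%type R, coupling mu nu Q &
  forall i j, Q (X @^-1` [set i] `*` Y @^-1` [set j]) = (l i j)%:E.
Proof.
have fine_le (p : probability E R) (A B : set E) : measurable A -> measurable B ->
    0 <= fine (p (A `&` B)) <= fine (p B).
  move=> mA mB; have mAB : measurable (A `&` B) by exact: measurableI.
  rewrite fine_ge0//= fine_le ?fin_num_measure//.
  by apply: le_measure; rewrite ?inE//; exact: subIsetr.
have marg1 A : measurable A -> m (A `*` setT) = mu A.
  move=> mA; rewrite m_setX// -(measure_finite_index mu measurable_X mA) -sumEFin.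
  apply: eq_bigr => i _; under eq_bigr do rewrite setTI.
  by rewrite marginal_weight1 ?fine_le// fineK// fin_num_measure//; exact: measurableI.
have marg2 A : measurable A -> m (setT `*` A) = nu A.
  move=> mA; rewrite m_setX// exchange_big -(measure_finite_index nu measurable_Y mA).
  rewrite -sumEFin; apply: eq_bigr => j _; under eq_bigr do rewrite setTI.
  by rewrite marginal_weight2 ?fine_le// fineK// fin_num_measure//; exact: measurableI.
have mT : m setT = 1%E by rewrite -setXTT marg1// probability_setT.
have [Q QE] := measure_setT1_probability mT.
exists Q; first by split=> A mA; rewrite QE ?marg1 ?marg2//; exact: measurableX.
move=> i j; have mij : measurable (X @^-1` [set i] `*` Y @^-1` [set j]).
  exact: measurableX.
rewrite QE//; transitivity (\int[mu \x nu]_(z in X @^-1` [set i] `*` Y @^-1` [set j])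
    (cst (weight (i, j))%:E z))%E.
  by apply: eq_integral => -[x y]; rewrite inE /= /joint_index/= => -[-> ->].
rewrite integral_cst// -(weight_mass i j) (EFinM (weight (i, j))); congr (_ * _)%E.
by rewrite EFinM -!index_massE//; exact: product_measure1E.
Qed.

End coupling_of_plan.

Lemma finite_min (R : realDomainType) (I : finType) (i0 : I) (h : I -> R) :
  exists i, forall j, h i <= h j.
Proof.
exists [arg min_(i < i0) h i]%O.
by case: Order.TotalTheory.arg_minP => // i _ i_min j; exact: i_min.
Qed.

Lemma sum1_inhabited (R : nzRingType) (I : finType) (p : I -> R) :
  \sum_i p i = 1 -> exists i : I, true.
Proof.
case: (pickP (@predT I)) => [i _|I0]; first by exists i.
by rewrite big1 => [/esym/eqP|i]; [rewrite oner_eq0|have := I0 i].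
Qed.

Record quantizer (d : measure_display) (E : measurableType d) := Quantizer {
  cells : finType;
  cell : E -> cells;
  center : cells -> E;
  measurable_cell : forall i, measurable (cell @^-1` [set i]) }.

Definition quantize d (E : measurableType d) (q : quantizer E) (x : E) : E :=
  center (cell q x).

Lemma measurable_quantize d (E : measurableType d) (q : quantizer E) :
  measurable_fun setT (quantize q).
Proof. exact: measurable_fun_finite_index (@measurable_cell _ _ q) _ _ _. Qed.

Section kantorovich.
Context {R : realType} {d : measure_display} {E : measurableType d}.
Variable rho : E -> E -> R.
Hypothesis polish_rho : polish rho.
Implicit Types (mu nu : probability E R) (f : E -> R).

Local Notation c := (tdist rho).
Local Notation mass mu q := (index_mass mu (cell q)).

(* The dual potentials f, g are replaced by the c-transform
   F(z) = min_j (c(z, y_j) - g_j), which is 1-Lipschitz because c is a metric. *)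
Lemma finite_kantorovich (I J : finType) (p : I -> R) (q : J -> R)
    (x : I -> E) (y : J -> E) (M : R) :
  (forall i, 0 <= p i) -> (forall j, 0 <= q j) ->
  \sum_i p i = 1 -> \sum_j q j = 1 ->
  (forall f, Lip1 rho f -> \sum_i f (x i) * p i - \sum_j f (y j) * q j <= M) ->
  exists l : I -> J -> R,
    [/\ forall i j, 0 <= l i j,
        forall i, \sum_j l i j = p i,
        forall j, \sum_i l i j = q j &
        \sum_i \sum_j c (x i) (y j) * l i j <= M].
Proof.
move=> p0 q0 p1 q1 f_le_M; apply: transport_duality => // f g fg_le_c.
have [j1 _] := sum1_inhabited q1.
pose H z j := c z (y j) - g j.
have /choice[jm jmP] : forall z, exists j, forall j', H z j <= H z j'.
  by move=> z; exact: finite_min.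
have [j0 j0P] := finite_min j1 (fun j => - g j).
pose F z := H z (jm z) + g j0.
have F_dist u v : F u - F v <= c u v.
  have := jmP u (jm v); have := tdist_triangle polish_rho v u (y (jm v)).
  by rewrite /F /H; lra.
have F_lip : Lip1 rho F.
  split=> [z|z z'].
    apply/andP; split.
      have := j0P (jm z); have := tdist_ge0 polish_rho z (y (jm z)).
      by rewrite /F /H; lra.
    have := jmP z j0; have := tdist_le1 rho z (y j0); rewrite /F /H; lra.
  rewrite ler_norml (le_trans (F_dist z z') (tdist_le_rho _ _ _)) andbT.
  have := le_trans (F_dist z' z) (tdist_le_rho _ _ _).
  by rewrite (rhoC polish_rho z'); lra.
have f_le_F : \sum_i p i * f i <= \sum_i F (x i) * p i - g j0.
  rewrite -[g j0]mulr1 -p1 mulr_sumr -sumrB; apply: ler_sum => i _.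
  rewrite -mulrBl [leLHS]mulrC ler_wpM2r// /F addrK.
  by have := fg_le_c i (jm (x i)); rewrite /H; lra.
have g_le_F : \sum_j q j * g j <= g j0 - \sum_j F (y j) * q j.
  rewrite -{1}[g j0]mulr1 -q1 mulr_sumr -sumrB; apply: ler_sum => j _.
  rewrite -mulrBl [leLHS]mulrC ler_wpM2r//.
  by have := jmP (y j) j; rewrite /F /H (tdistxx polish_rho); lra.
by have := f_le_M F F_lip; lra.
Qed.

Lemma exists_first_near (e : R) : 0 < e -> exists (s : nat -> E) (N : E -> nat),
  (forall x, rho x (s (N x)) < e) /\ forall Y, measurable (N @^-1` Y).
Proof.
move=> e0; have [_ _ [s s_dense] _] := polish_rho.
pose N x := ex_minn (s_dense x e e0).
have N_near x : rho x (s (N x)) < e by rewrite /N; case: ex_minnP.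
have N_min x j : rho x (s j) < e -> (N x <= j)%N.
  by rewrite /N; case: ex_minnP => m _ m_min /m_min.
have measurable_near j : measurable [set x | rho x (s j) < e].
  under eq_set do rewrite rhoC//.
  exact: measurable_rho_ball.
have fiberE i : N @^-1` [set i] = [set x | rho x (s i) < e] `\`
    \bigcup_(j in [set j | (j < i)%N]) [set x | rho x (s j) < e].
  apply/seteqP; split=> [x /= <-|x [/= xi far]].
    by split=> // -[j /= jN] /N_min; rewrite leqNgt jN.
  apply/eqP; rewrite eqn_leq N_min//= leqNgt; apply/negP => Ni.
  by apply: far; exists (N x); [exact: Ni|exact: N_near].
exists s, N; split=> // Y.
rewrite (_ : N @^-1` Y = \bigcup_(i in Y) (N @^-1` [set i])); last first.
  by apply/seteqP; split=> [x /= Yx|x [i Yi /= ->]]//; exists (N x).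
apply: bigcup_measurable => i _; rewrite fiberE.
by apply: measurableD => //; exact: bigcup_measurable.
Qed.

Lemma measure_tail_le mu (N : E -> nat) (e : R) : 0 < e ->
  (forall Y, measurable (N @^-1` Y)) ->
  exists k, (mu [set x | (k <= N x)%N] <= e%:E)%E.
Proof.
move=> e0 mN; pose F k := [set x | (k <= N x)%N].
have mF k : measurable (F k) by exact: (mN [set m | (k <= m)%N]).
have F_cvg : mu (F k) @[k --> \oo] --> 0%E.
  have <- : mu (\bigcap_k F k) = 0%E.
    rewrite (_ : \bigcap_k F k = set0) ?measure0//.
    by rewrite -subset0 => x /(_ (N x).+1 I); rewrite /F/= ltnn.
  apply: nonincreasing_cvg_mu => //.
  - by rewrite ltey_eq fin_num_measure.
  - exact: bigcapT_measurable.
  - by move=> k l kl; apply/subsetPset => x; exact: leq_trans.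
move/fine_cvgP: F_cvg => [_ /cvgrPdist_le/(_ e e0)[k _ /(_ k (leqnn k))]] /=.
rewrite sub0r normrN ger0_norm ?fine_ge0// => mu_le; exists k.
by rewrite -(@fineK _ (mu (F k))) ?fin_num_measure// lee_fin.
Qed.

Lemma measurable_quantize_dist (q : quantizer E) :
  measurable_fun setT (fun x => c x (quantize q x)).
Proof.
by apply: measurable_fun_tdist => //; exact: measurable_quantize.
Qed.

Lemma exists_quantizer mu (e : R) : 0 < e ->
  exists q : quantizer E, (\int[mu]_x (c x (quantize q x))%:E <= e%:E)%E.
Proof.
move=> e0; have e20 : 0 < e / 2 by rewrite divr_gt0.
have [s [N [N_near mN]]] := exists_first_near e20.
have [k tail_le] := measure_tail_le mu e20 mN.
pose J x : 'I_k.+1 := inord (minn (N x) k).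
have mJ i : measurable (J @^-1` [set i]).
  exact: (mN [set m | inord (minn m k) = i]).
pose q := @Quantizer _ _ _ J (fun i => s i) mJ.
pose F := [set x | (k <= N x)%N].
have mF : measurable F by exact: (mN [set m | (k <= m)%N]).
exists q.
apply: (@le_trans _ _ (\int[mu]_x ((e / 2)%:E + (\1_F x)%:E))%E).
  apply: ge0_le_integral => //.
  - by move=> x _; rewrite lee_fin tdist_ge0.
  - by apply/measurable_EFinP; exact: measurable_quantize_dist.
  - by apply: emeasurable_funD => //; exact/measurable_EFinP.
  - move=> x _; rewrite -EFinD lee_fin indicE /quantize/=.
    case: (leqP k (N x)) => kN.
      by rewrite mem_set//= (le_trans (tdist_le1 rho _ _))// lerDr ltW.
    rewrite memNset ?addr0; last by rewrite /F/= leqNgt kN.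
    rewrite (le_trans (tdist_le_rho rho _ _))// ltW// /J.
    rewrite inordK ?(minn_idPl _) ?(ltnW kN)//.
    by rewrite ltnS ltnW.
rewrite ge0_integralD//; last 2 first.
- by move=> x _; rewrite lee_fin ltW.
- exact/measurable_EFinP.
rewrite integral_prob_cst integral_indic// setIT.
by apply: le_trans (leeD2l _ tail_le) _; rewrite -EFinD -splitr.
Qed.

Lemma quantize_Rintegral_dist mu (q : quantizer E) (e : R) f :
  (\int[mu]_x (c x (quantize q x))%:E <= e%:E)%E -> Lip1 rho f ->
  `|\int[mu]_x f x - \sum_i f (center i) * mass mu q i| <= e.
Proof.
move=> q_e f_lip; have uf := Lip1_unit_mfun polish_rho f_lip.
rewrite -(Rintegral_finite_index mu (@measurable_cell _ _ q) (h := f \o @center _ _ q)).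
  apply: (le_Rintegral_dist (h := fun x => c x (quantize q x))) => //.
  - exact: unit_mfun_comp (measurable_quantize q) uf.
  - exact: measurable_quantize_dist.
  - by move=> x; exact: Lip1_tdist.
by move=> i; case/andP: (f_lip.1 (center i)).
Qed.

Lemma exists_quantized_plan mu nu (q q' : quantizer E) (e e' M : R) :
  (\int[mu]_x (c x (quantize q x))%:E <= e%:E)%E ->
  (\int[nu]_x (c x (quantize q' x))%:E <= e'%:E)%E ->
  (forall f, Lip1 rho f -> `|\int[mu]_x f x - \int[nu]_x f x| <= M) ->
  exists l : cells q -> cells q' -> R,
    [/\ forall i j, 0 <= l i j,
        forall i, \sum_j l i j = mass mu q i,
        forall j, \sum_i l i j = mass nu q' j &
        \sum_i \sum_j c (center i) (center j) * l i j <= M + e + e'].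
Proof.
move=> q_e q'_e' mu_nu_M; apply: finite_kantorovich.
- exact: index_mass_ge0.
- exact: index_mass_ge0.
- exact: sum_index_mass (@measurable_cell _ _ q).
- exact: sum_index_mass (@measurable_cell _ _ q').
move=> f f_lip; have := quantize_Rintegral_dist q_e f_lip.
have := quantize_Rintegral_dist q'_e' f_lip; have := mu_nu_M f f_lip.
by rewrite !ler_norml; lra.
Qed.

Lemma integral_quantized_pair_le (Q : probability (E * E)%type R) mu nu
    (q q' : quantizer E) (e e' M : R) : coupling mu nu Q ->
  (\int[mu]_x (c x (quantize q x))%:E <= e%:E)%E ->
  (\int[nu]_x (c x (quantize q' x))%:E <= e'%:E)%E ->
  (\int[Q]_z (c (quantize q z.1) (quantize q' z.2))%:E <= M%:E)%E ->
  (\int[Q]_z (c z.1 z.2)%:E <= (e + (M + e'))%:E)%E.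
Proof.
move=> coupling_Q q_e q'_e' Q_M.
have mc := measurable_tdist polish_rho.
have mq1 : measurable_fun setT (fun z : E * E => quantize q z.1).
  exact: measurableT_comp (measurable_quantize q) measurable_fst.
have mq2 : measurable_fun setT (fun z : E * E => quantize q' z.2).
  exact: measurableT_comp (measurable_quantize q') measurable_snd.
have mc_quantize (q0 : quantizer E) :
    measurable_fun setT (fun x => (c x (quantize q0 x))%:E).
  by apply/measurable_EFinP; exact: measurable_quantize_dist.
pose g1 (z : E * E) := (c z.1 (quantize q z.1))%:E.
pose g2 (z : E * E) := (c (quantize q z.1) (quantize q' z.2))%:E.
pose g3 (z : E * E) := (c z.2 (quantize q' z.2))%:E.
have mg1 : measurable_fun setT g1 by exact: measurableT_comp (mc_quantize q) _.
have mg2 : measurable_fun setT g2.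
  by apply/measurable_EFinP; exact: measurable_fun_tdist.
have mg3 : measurable_fun setT g3 by exact: measurableT_comp (mc_quantize q') _.
have c_ge0 x y : (0 <= (c x y)%:E)%E by rewrite lee_fin tdist_ge0.
apply: (@le_trans _ _ (\int[Q]_z (g1 z + (g2 z + g3 z)))%E).
  apply: ge0_le_integral => //.
  - exact/measurable_EFinP.
  - by apply: emeasurable_funD => //; exact: emeasurable_funD.
  - move=> z _; rewrite -!EFinD lee_fin.
    have := tdist_triangle polish_rho (quantize q z.1) z.1 z.2.
    have := tdist_triangle polish_rho (quantize q' z.2) (quantize q z.1) z.2.
    by rewrite (tdistC polish_rho (quantize q' z.2) z.2); lra.
rewrite ge0_integralD//; last 3 first.
- by move=> z _; exact: c_ge0.
- by move=> z _; rewrite adde_ge0 ?c_ge0.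
- exact: emeasurable_funD.
rewrite ge0_integralD//; last 2 first.
- by move=> z _; exact: c_ge0.
- by move=> z _; exact: c_ge0.
rewrite !EFinD /g1 /g3 (coupling_integral1 coupling_Q (mc_quantize q))//.
by rewrite (coupling_integral2 coupling_Q (mc_quantize q'))// !leeD.
Qed.

Lemma kantorovich_rubinstein mu nu (M : R) :
  (forall f, Lip1 rho f -> `|\int[mu]_x f x - \int[nu]_x f x| <= M) ->
  (wasserstein c mu nu <= M%:E)%E.
Proof.
move=> mu_nu_M; apply/lee_addgt0Pr => e e0.
have e40 : 0 < e / 4 by rewrite divr_gt0.
have [q q_e] := exists_quantizer mu e40; have [q' q'_e] := exists_quantizer nu e40.
have [l [l_ge0 l_row l_col l_cost]] := exists_quantized_plan q_e q'_e mu_nu_M.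
have [Q coupling_Q QE] := coupling_of_plan (@measurable_cell _ _ q)
  (@measurable_cell _ _ q') l_ge0 l_row l_col.
rewrite -EFinD (_ : M + e = e / 4 + (M + e / 4 + e / 4 + e / 4)); last by field.
apply: wasserstein_le_transport; exists Q => //.
apply: integral_quantized_pair_le q_e q'_e _ => //.
have mcell1 i : measurable ((cell q \o @fst E E) @^-1` [set i]).
  by rewrite comp_preimage -[X in measurable X]setTI; apply: measurable_fst => //;
    exact: measurable_cell.
have mcell2 j : measurable ((cell q' \o @snd E E) @^-1` [set j]).
  by rewrite comp_preimage -[X in measurable X]setTI; apply: measurable_snd => //;
    exact: measurable_cell.
rewrite (integral_joint_index mcell1 mcell2 (h := fun i j => c (center i) (center j))
  _ QE)//.
by move=> i j; exact: tdist_ge0.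
Qed.

End kantorovich.

(** * Completeness of the space of laws *)

Lemma dependent_choice_seq (X : nat -> Type) (Q : forall n, X n -> Prop)
    (r : forall n, X n -> X n.+1 -> Prop) :
  (exists x, Q 0%N x) ->
  (forall n x, Q n x -> exists y, Q n.+1 y /\ r n x y) ->
  exists u : forall n, X n, forall n, Q n (u n) /\ r n (u n) (u n.+1).
Proof.
move=> /cid[x0 Qx0] step.
pose next n (x : {x | Q n x}) := cid (step n (sval x) (svalP x)).
pose fix u n : {x | Q n x} := if n is n'.+1
  then exist _ (sval (next n' (u n'))) (svalP (next n' (u n'))).1 else exist _ x0 Qx0.
exists (fun n => sval (u n)) => n; split; first exact: svalP (u n).
exact: (svalP (next n (u n))).2.
Qed.

Section splittable.
Context {R : realType} {d : measure_display} {Om : measurableType d}.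
Variable Q : probability Om R.

Definition splittable := forall (A : set Om) (s : R), measurable A -> 0 <= s ->
  (s%:E <= Q A)%E -> exists B, [/\ measurable B, B `<=` A & Q B = s%:E].

Hypothesis splittable_Q : splittable.

Let splittable_partition_seq (I : eqType) (i0 : I) (s : seq I) (A : set Om)
    (lam : I -> R) : uniq (i0 :: s) -> measurable A -> (forall i, 0 <= lam i) ->
  Q A = (\sum_(i <- i0 :: s) lam i)%:E ->
  exists2 g : Om -> I, (forall w, g w \in i0 :: s) &
    {in i0 :: s, forall i, measurable (A `&` g @^-1` [set i]) /\
      Q (A `&` g @^-1` [set i]) = (lam i)%:E}.
Proof.
move=> + + lam0; elim: s A => [|i1 s IH] A uniq_s mA QA.
  exists (fun=> i0) => [w|i]; first exact: mem_head.
  rewrite inE => /eqP ->; rewrite (_ : _ @^-1` _ = setT) ?setIT ?QA ?big_seq1//.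
  by apply/seteqP; split.
have [i1_notin uniq_i0s] : i1 \notin i0 :: s /\ uniq (i0 :: s).
  by move: uniq_s; rewrite /= !inE !negb_or eq_sym => /and3P[/andP[-> ->] -> ->].
have sumE : \sum_(i <- [:: i0, i1 & s]) lam i = lam i1 + \sum_(i <- i0 :: s) lam i.
  by rewrite !big_cons addrCA.
have lam1_le : ((lam i1)%:E <= Q A)%E by rewrite QA sumE lee_fin lerDl sumr_ge0.
have [B [mB BA QB]] := splittable_Q mA (lam0 i1) lam1_le.
have QAB : Q (A `\` B) = (\sum_(i <- i0 :: s) lam i)%:E.
  rewrite measureD//; last first.
    by rewrite ltey_eq fin_num_measure.
  have /setIidPr -> := BA.
  transitivity ((lam i1 + \sum_(i <- i0 :: s) lam i)%:E - (lam i1)%:E)%E.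
    by rewrite -sumE; congr (_ - _)%E; [exact: QA|exact: QB].
  by rewrite -EFinB addrAC subrr add0r.
have [g g_in gP] := IH _ uniq_i0s (measurableD mA mB) QAB.
exists (fun w => if w \in B then i1 else g w) => [w|i].
  by case: ifP => _; rewrite !inE ?eqxx ?orbT//; have := g_in w; rewrite inE => /orP[]->;
    rewrite ?orbT.
have [->|i_neq] := eqVneq i i1.
  move=> _; rewrite (_ : _ `&` _ = B)//; apply/seteqP; split=> w /=.
    case=> _; case: ifPn => [|_ gw]; first by rewrite inE.
    by have := g_in w; rewrite gw (negbTE i1_notin).
  by move=> Bw; split; [exact: BA|rewrite mem_set].
move=> i_in; have {}i_in : i \in i0 :: s.
  by move: i_in; rewrite !inE (negbTE i_neq).
rewrite (_ : _ `&` _ = (A `\` B) `&` g @^-1` [set i]); first exact: gP.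
apply/seteqP; split=> w /=.
  by case=> Aw; case: ifPn => [_ /esym/eqP|/negP]; [rewrite (negbTE i_neq)|rewrite inE].
by case=> [[Aw nBw] gw]; split=> //; rewrite memNset.
Qed.

Lemma splittable_partition (I : finType) (i0 : I) (A : set Om) (lam : I -> R) :
  measurable A -> (forall i, 0 <= lam i) -> Q A = (\sum_i lam i)%:E ->
  exists g : Om -> I, forall i, measurable (A `&` g @^-1` [set i]) /\
    Q (A `&` g @^-1` [set i]) = (lam i)%:E.
Proof.
move=> mA lam0; rewrite -big_enum/=.
have := mem_enum I; have := enum_uniq I; case: (enum I) => [_ /(_ i0)//|i1 s].
move=> uniq_s mem_s QA; have [g _ gP] := splittable_partition_seq uniq_s mA lam0 QA.
by exists g => i; apply: gP; rewrite mem_s.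
Qed.

Lemma splittable_refine (I J : finType) (j0 : J) (S : Om -> I) (lam : I -> J -> R) :
  (forall i, measurable (S @^-1` [set i])) -> (forall i j, 0 <= lam i j) ->
  (forall i, Q (S @^-1` [set i]) = (\sum_j lam i j)%:E) ->
  exists2 S' : Om -> J, (forall j, measurable (S' @^-1` [set j])) &
    forall i j, Q (S @^-1` [set i] `&` S' @^-1` [set j]) = (lam i j)%:E.
Proof.
move=> mS lam0 QS.
have /choice[g gP] : forall i, exists g : Om -> J, forall j,
    measurable (S @^-1` [set i] `&` g @^-1` [set j]) /\
    Q (S @^-1` [set i] `&` g @^-1` [set j]) = (lam i j)%:E.
  by move=> i; exact: splittable_partition.
pose S' w := g (S w) w.
have fiberE i j :
    S @^-1` [set i] `&` S' @^-1` [set j] = S @^-1` [set i] `&` g i @^-1` [set j].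
  by apply/seteqP; split=> w [/= Sw]; rewrite /S' Sw.
exists S' => [j|i j]; last by rewrite fiberE; exact: (gP i j).2.
have -> : S' @^-1` [set j] = \bigcup_i (S @^-1` [set i] `&` S' @^-1` [set j]).
  by apply/seteqP; split=> [w /= S'w|w [i _ []]]//; exists (S w).
apply: countable_bigcupT_measurable => [|i]; first exact: countableP.
by rewrite fiberE; exact: (gP i j).1.
Qed.

Lemma plan_chain_realization (I : nat -> finType) (p : forall n, I n -> R)
    (lam : forall n, I n -> I n.+1 -> R) :
  \sum_i p 0%N i = 1 -> (forall n i j, 0 <= lam n i j) ->
  (forall n i, \sum_j lam n i j = p n i) ->
  (forall n j, \sum_i lam n i j = p n.+1 j) ->
  exists S : forall n, Om -> I n, [/\ forall n i, measurable (S n @^-1` [set i]),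
    forall n i, Q (S n @^-1` [set i]) = (p n i)%:E &
    forall n i j, Q (S n @^-1` [set i] `&` S n.+1 @^-1` [set j]) = (lam n i j)%:E].
Proof.
move=> p0_sum lam0 lam_row lam_col.
have p_ge0 n i : 0 <= p n i by rewrite -lam_row sumr_ge0.
have p_sum n : \sum_i p n i = 1.
  elim: n => // n <-; rewrite -(eq_bigr _ (fun j _ => lam_col n j)) exchange_big.
  by apply: eq_bigr => i _; rewrite lam_row.
pose realizes n (S : Om -> I n) := (forall i, measurable (S @^-1` [set i])) /\
  forall i, Q (S @^-1` [set i]) = (p n i)%:E.
pose joint n (S : Om -> I n) (S' : Om -> I n.+1) :=
  forall i j, Q (S @^-1` [set i] `&` S' @^-1` [set j]) = (lam n i j)%:E.
have [|n S [mS QS]|S SP] := @dependent_choice_seq _ realizes joint.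
- have [i0 _] := sum1_inhabited p0_sum.
  have QT : Q setT = (\sum_i p 0%N i)%:E by rewrite p0_sum; exact: probability_setT.
  have [S SP] := splittable_partition i0 measurableT (p_ge0 0%N) QT.
  by exists S; split=> i; have := SP i; rewrite setTI => -[].
- have [j0 _] := sum1_inhabited (p_sum n.+1).
  have [|S' mS' QSS'] := splittable_refine j0 mS (lam0 n).
    by move=> i; rewrite QS lam_row.
  exists S'; split=> //; split=> // j.
  rewrite -(measure_finite_index Q mS (mS' j)) -lam_col -sumEFin.
  by apply: eq_bigr => i _; rewrite setIC.
by exists S; split=> n; have [[mS QS] QSS'] := SP n.
Qed.

End splittable.

Section uniform_splittable.
Variable R : realType.
Local Notation Om := (measurableTypeR R).
Local Notation U := (uniform_prob (@ltr01 R)).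

Let uniform_itv_le (A : set Om) (a b : R) : measurable A -> a <= b ->
  (U (A `&` `]a, b]%classic) <= (b - a)%:E)%E.
Proof.
move=> mA ab.
apply: (@le_trans _ _ (U `]a, b]%classic)).
  by apply: le_measure; rewrite ?inE//; exact: measurableI.
apply: (@le_trans _ _ (\int[lebesgue_measure]_(x in `]a, b]%classic) (cst 1%E x))%E).
  apply: ge0_le_integral => //.
  - by move=> x _; rewrite lee_fin uniform_pdf_ge0.
  - apply/measurable_EFinP; apply: measurable_funTS; exact: measurable_uniform_pdf.
  - by move=> x _; rewrite lee_fin /uniform_pdf; case: ifP; rewrite ?subr0 ?invr1.
rewrite integral_cst// mul1e.
have := @lebesgue_measure_itv R `]a, b]; rewrite /= lte_fin => ->.
by case: ltP => [_|ba]; rewrite -?EFinB// lee_fin subr_ge0.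
Qed.

Let eq_uniform (A B : set Om) : A `&` `[0, 1]%classic = B `&` `[0, 1]%classic ->
  U A = U B.
Proof.
move=> AB; rewrite /= /uniform_prob integral_uniform_pdf AB.
by rewrite -integral_uniform_pdf.
Qed.

Let mass_below (A : set Om) (a : R) : R := fine (U (A `&` `]-oo, a]%classic)).

Let measurable_below (A : set Om) a : measurable A ->
  measurable (A `&` (`]-oo, a]%classic : set Om)).
Proof. by move=> mA; apply: measurableI => //; exact: measurable_itv. Qed.

Let mass_belowE (A : set Om) a : measurable A ->
  U (A `&` `]-oo, a]%classic) = (mass_below A a)%:E.
Proof. by move=> mA; rewrite fineK// fin_num_measure//; exact: measurable_below. Qed.

Let mass_below_increment (A : set Om) (a b : R) : measurable A -> a <= b ->
  0 <= mass_below A b - mass_below A a <= b - a.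
Proof.
move=> mA ab.
have UE : U (A `&` `]-oo, b]%classic) =
    (U (A `&` `]-oo, a]%classic) + U (A `&` `]a, b]%classic))%E.
  rewrite -measureU//; last 3 first.
  - exact: measurable_below.
  - exact: measurableI.
  - rewrite -subset0 => x [[_ /=]]; rewrite !in_itv/= => xa [_ /andP[ax _]].
    by move: ax; rewrite ltNge xa.
  congr (U _); rewrite -setIUr; congr (_ `&` _).
  apply/seteqP; split=> x /=; rewrite !in_itv/=.
    by case: (leP x a) => xa xb; [left|right].
  by case=> [xa|/andP[]//]; exact: le_trans ab.
have U_ge0 : (0 <= U (A `&` `]a, b]%classic))%E by exact: measure_ge0.
have := uniform_itv_le mA ab; move: UE U_ge0; rewrite !mass_belowE//.
case: (U (A `&` `]a, b]%classic)) => // x; rewrite -EFinD => -[->].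
by rewrite !lee_fin addrAC subrr add0r => -> ->.
Qed.

Let continuous_mass_below (A : set Om) : measurable A -> continuous (mass_below A).
Proof.
move=> mA a; apply/cvgrPdist_le => e e0; near=> b.
have ab : `|a - b| <= e.
  by near: b; apply/nbhs_ballP; exists e => //= b; rewrite /ball/= => /ltW.
apply: le_trans ab; have [ab|/ltW ba] := leP a b.
  have /andP[? ?] := mass_below_increment mA ab.
  by rewrite distrC [`|a - b|]distrC !ger0_norm// subr_ge0.
by have /andP[? ?] := mass_below_increment mA ba; rewrite !ger0_norm// subr_ge0.
Unshelve. all: by end_near. Qed.

Lemma uniform_splittable : splittable U.
Proof.
move=> A s mA s0 sA.
have mass_belowN1 : mass_below A (-1) = 0.
  rewrite /mass_below (@eq_uniform _ set0) ?measure0//.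
  rewrite set0I -subset0 => x [[_ /=]].
  by rewrite !in_itv/= => x1 /andP[x0 _]; lra.
have mass_below2 : (mass_below A 2)%:E = U A.
  rewrite -mass_belowE//; apply: eq_uniform; apply/seteqP; split=> x /=.
    by case=> -[].
  rewrite !in_itv/= => -[Ax x01]; split=> //; split=> //.
  by case/andP: x01 => _ x1; lra.
have s_le : s <= mass_below A 2 by rewrite -lee_fin mass_below2.
have [||a _ a_s] := @IVT _ (mass_below A) (-1) 2 s ltac:(lra).
- by apply: continuous_subspaceT => a; exact: continuous_mass_below.
- by rewrite mass_belowN1 min_l ?max_r ?s0 ?s_le//; exact: le_trans s_le.
exists (A `&` `]-oo, a]%classic); split=> //; first exact: measurable_below.
by transitivity (mass_below A a)%:E; [exact: mass_belowE|rewrite a_s].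
Qed.

End uniform_splittable.

Section random_limit.
Context {R : realType} {d : measure_display} {E : measurableType d}.
Variable rho : E -> E -> R.
Hypothesis polish_rho : polish rho.
Local Notation c := (tdist rho).

Lemma Lip1_rho_cvg f (u : nat -> E) x : Lip1 rho f -> rho_converges rho u x ->
  f (u n) @[n --> \oo] --> f x.
Proof.
move=> [_ f_lip] ux; apply/cvgrPdist_le => e e0; have [N near_x] := ux e e0.
near=> n; apply: (@le_trans _ _ (rho (u n) x)).
  by rewrite distrC.
by apply/ltW/near_x; near: n; exact: nbhs_infty_ge.
Unshelve. all: by end_near. Qed.

Lemma measurable_rho_lim d' (O : measurableType d') (u : nat -> O -> E) (v : O -> E) :
  (forall n, measurable_fun setT (u n)) ->
  (forall w, rho_converges rho (u ^~ w) (v w)) -> measurable_fun setT v.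
Proof.
move=> mu uv; apply: (measurable_fun_Lip1 polish_rho) => f f_lip.
apply: (@measurable_fun_cvg _ _ _ _ (fun n => f \o u n)) => [n|w _].
  exact: measurableT_comp (Lip1_unit_mfun polish_rho f_lip).1 (mu n).
exact: Lip1_rho_cvg f_lip (uv w).
Qed.

Lemma tdist_path (u : nat -> E) m n : (m <= n)%N ->
  c (u m) (u n) <= \sum_(m <= i < n) c (u i) (u i.+1).
Proof.
move=> /subnK <-; elim: (n - m)%N => [|k IH].
  by rewrite add0n big_geq// tdistxx.
rewrite addSn big_nat_recr ?leq_addl//=.
by apply: le_trans (tdist_triangle polish_rho (u (k + m)%N) _ _) _; rewrite lerD2r.
Qed.

Lemma tdist_lt (e : R) x y : c x y < Num.min e 1 -> rho x y < e.
Proof.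
by rewrite /tdist !lt_min !gt_min ltxx orbF => /andP[/orP[//|e1] xy1]; lra.
Qed.

Lemma summable_rho_cauchy (u : nat -> E) (M : R) :
  (forall n, \sum_(0 <= i < n) c (u i) (u i.+1) <= M) -> rho_cauchy rho u.
Proof.
move=> sum_le_M e e0; pose S n := \sum_(0 <= i < n) c (u i) (u i.+1).
have SD m n : (m <= n)%N -> S n = S m + \sum_(m <= i < n) c (u i) (u i.+1).
  by move=> mn; rewrite /S (big_cat_nat _ mn).
pose e1 := Num.min e 1; have e1_gt0 : 0 < e1 by rewrite lt_min e0 ltr01.
have supS : has_sup (range S).
  by split; [exists (S 0%N), 0%N|exists M => _ [n _ <-]; exact: sum_le_M].
have [_ [N _ <-] supS_lt] := sup_adherent e1_gt0 supS.
have near_sup m n : (N <= m)%N -> (m <= n)%N -> c (u m) (u n) < e1.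
  move=> Nm mn; apply: le_lt_trans (tdist_path u mn) _.
  have : S n <= sup (range S) by apply: (ub_le_sup supS.2); exists n.
  have : 0 <= \sum_(N <= i < m) c (u i) (u i.+1).
    by apply: sumr_ge0 => i _; exact: tdist_ge0.
  by have := SD _ _ Nm; have := SD _ _ mn; move: supS_lt; move: (sup _) => s; lra.
exists N => m n Nm Nn; apply: tdist_lt.
have [mn|/ltnW nm] := leqP m n; first exact: near_sup.
by rewrite tdistC//; exact: near_sup.
Qed.

Section random_sequence.
Context {d' : measure_display} {O : measurableType d'}.
Variables (Q : probability O R) (u : nat -> O -> E).
Hypothesis measurable_u : forall n, measurable_fun setT (u n).

Lemma summable_ae_cauchy (eta : nat -> R) (M : R) :
  (forall n, (\int[Q]_w (c (u n w) (u n.+1 w))%:E <= (eta n)%:E)%E) ->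
  (forall n, \sum_(0 <= i < n) eta i <= M) ->
  {ae Q, forall w, rho_cauchy rho (u ^~ w)}.
Proof.
move=> u_eta eta_le_M; pose step n w := (c (u n w) (u n.+1 w))%:E.
have m_step n : measurable_fun setT (step n).
  by apply/measurable_EFinP; exact: measurable_fun_tdist.
have step_ge0 n w : (0 <= step n w)%E by rewrite lee_fin tdist_ge0.
pose g w := (\sum_(n <oo) step n w)%E.
have g_ge0 w : (0 <= g w)%E by apply: nneseries_ge0 => n _ _; exact: step_ge0.
have mg : measurable_fun setT g.
  apply: (emeasurable_fun_cvg (fun n w => \sum_(0 <= i < n) step i w)%E).
    by move=> n; apply: emeasurable_sum.
  by move=> w _; apply: is_cvg_nneseries => n _ _; exact: step_ge0.
have g_int : Q.-integrable setT g.
  apply/integrableP; split=> //; under eq_integral do rewrite gee0_abs//.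
  apply: (@le_lt_trans _ _ M%:E); last exact: ltry.
  rewrite integral_nneseries//; apply: lime_le.
    by apply: is_cvg_nneseries => n _ _; apply: integral_ge0 => w _; exact: step_ge0.
  apply: nearW => n; apply: (@le_trans _ _ (\sum_(0 <= i < n) (eta i)%:E)%E).
    by apply: lee_sum => i _; exact: u_eta.
  by rewrite sumEFin lee_fin.
apply: filterS (integrable_ae measurableT g_int) => w /(_ I) gw_fin.
apply: (@summable_rho_cauchy _ (fine (g w))) => n.
rewrite -lee_fin fineK// -sumEFin.
by apply: (@nneseries_lim_ge _ (fun i => step i w) xpredT 0 n) => i *; exact: step_ge0.
Qed.

Lemma ae_cauchy_limit : {ae Q, forall w, rho_cauchy rho (u ^~ w)} ->
  exists2 v : O -> E, measurable_fun setT v &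
    {ae Q, forall w, rho_converges rho (u ^~ w) (v w)}.
Proof.
move=> [N [mN QN cauchy_notN]]; have [_ complete _ _] := polish_rho.
have /choice[v0 v0_lim] : forall w, exists x, ~ N w -> rho_converges rho (u ^~ w) x.
  move=> w; have [Nw|nNw] := pselect (N w); first by exists point.
  have [|x ux] := complete (u ^~ w); last by exists x.
  by apply: contrapT => not_cauchy; apply: nNw; exact: cauchy_notN.
pose v w := if w \in N then point else v0 w.
pose u' n w := if w \in N then point else u n w.
have m_inN : measurable_fun setT (fun w => w \in N).
  apply: (measurable_fun_bool true); rewrite setTI.
  rewrite (_ : _ @^-1` _ = N)//; apply/seteqP; split=> w /=.
    exact: set_mem.
  exact: mem_set.
have m_u' n : measurable_fun setT (u' n) by exact: measurable_fun_ifT.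
exists v.
  apply: measurable_rho_lim m_u' _ => w; rewrite /u' /v; case: ifPn => [_|].
    by move=> e e0; exists 0%N => n _; rewrite (rhoxx polish_rho).
  by rewrite notin_setE; exact: v0_lim.
exists N; split=> // w /= not_lim; apply: contrapT => nNw; apply: not_lim.
by rewrite /v memNset//; exact: v0_lim.
Qed.

Lemma summable_law_limit (eta : nat -> R) (M : R) :
  (forall n, (\int[Q]_w (c (u n w) (u n.+1 w))%:E <= (eta n)%:E)%E) ->
  (forall n, \sum_(0 <= i < n) eta i <= M) ->
  exists pi : probability E R, forall f, Lip1 rho f ->
    \int[Q]_w f (u n w) @[n --> \oo] --> \int[pi]_x f x.
Proof.
move=> u_eta eta_le_M.
have [v mv u_v] := ae_cauchy_limit (summable_ae_cauchy u_eta eta_le_M).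
have [pi [_ pi_int]] := exists_law Q mv.
exists pi => f f_lip; have uf := Lip1_unit_mfun polish_rho f_lip.
have [mfE f0] := unit_mfun_EFin uf.
have -> : \int[pi]_x f x = \int[Q]_w f (v w) by rewrite /Rintegral (pi_int _ mfE f0).
apply: unit_Rintegral_cvg => [n||]; [exact: unit_mfun_comp|exact: unit_mfun_comp|].
by apply: filterS u_v => w; exact: Lip1_rho_cvg.
Qed.

End random_sequence.

End random_limit.

Section weak_completeness.
Context {R : realType} {d : measure_display} {E : measurableType d}.
Variable rho : E -> E -> R.
Hypothesis polish_rho : polish rho.
Implicit Types (mu : nat -> probability E R) (pi : probability E R).
Local Notation c := (tdist rho).
Local Notation mass mu q := (index_mass mu (cell q)).

Lemma quantized_weakly_cvg mu pi (q : nat -> quantizer E) (e : nat -> R) :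
  (forall n, (\int[mu n]_x (c x (quantize (q n) x))%:E <= (e n)%:E)%E) ->
  e n @[n --> \oo] --> 0 ->
  (forall f, Lip1 rho f ->
    \sum_i f (center i) * mass (mu n) (q n) i @[n --> \oo] --> \int[pi]_x f x) ->
  weakly_cvg rho mu pi.
Proof.
move=> q_e e_cvg sum_cvg f f_lip.
apply: (cvg_sub0 _ (sum_cvg f f_lip)).
apply/norm_cvg0P; apply: (squeeze_cvgr _ (cvg_cst 0) e_cvg).
by apply: nearW => n; rewrite normr_ge0/= (quantize_Rintegral_dist polish_rho).
Qed.

(* A Skorokhod-type construction: step functions on [0, 1], each refining the
   previous one along a finite optimal transport plan. *)
Lemma exists_quantized_sequence mu (q : nat -> quantizer E) (a e : nat -> R) :
  (forall n, (\int[mu n]_x (c x (quantize (q n) x))%:E <= (e n)%:E)%E) ->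
  (forall n f, Lip1 rho f -> `|\int[mu n]_x f x - \int[mu n.+1]_x f x| <= a n) ->
  exists (U : probability (measurableTypeR R) R) (u : nat -> measurableTypeR R -> E),
    [/\ forall n, measurable_fun setT (u n),
        forall n, (\int[U]_w (c (u n w) (u n.+1 w))%:E <= (a n + e n + e n.+1)%:E)%E &
        forall n f, Lip1 rho f ->
          \int[U]_w f (u n w) = \sum_i f (center i) * mass (mu n) (q n) i].
Proof.
move=> q_e mu_a; pose U : probability (measurableTypeR R) R := uniform_prob (@ltr01 R).
pose plan n := cid (exists_quantized_plan polish_rho (q_e n) (q_e n.+1) (mu_a n)).
pose lam n := sval (plan n).
have lam_ge0 n i j : 0 <= lam n i j.
  by have [+ _ _ _] := svalP (plan n); exact.
have lam_row n i : \sum_j lam n i j = mass (mu n) (q n) i.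
  by have [_ + _ _] := svalP (plan n); exact.
have lam_col n j : \sum_i lam n i j = mass (mu n.+1) (q n.+1) j.
  by have [_ _ + _] := svalP (plan n); exact.
have [S [mS massS jointS]] := plan_chain_realization (@uniform_splittable R)
  (sum_index_mass (mu 0%N) (@measurable_cell _ _ (q 0%N))) lam_ge0 lam_row lam_col.
exists U, (fun n w => center (S n w)); split=> [n|n|n f f_lip].
- exact: measurable_fun_finite_index (mS n) _ _ _.
- rewrite (integral_joint_index (mS n) (mS n.+1)
    (h := fun i j => c (center i) (center j)) _ (jointS n)).
    by rewrite lee_fin; have [] := svalP (plan n).
  by move=> i j; exact: tdist_ge0.
- rewrite (Rintegral_finite_index U (mS n) (h := f \o @center _ _ (q n))).
    by apply: eq_bigr => i _; rewrite [in LHS]/index_mass massS.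
  by move=> i; case/andP: (f_lip.1 (center i)).
Qed.

Lemma weakly_complete mu (a : nat -> R) (M : R) :
  (forall n f, Lip1 rho f -> `|\int[mu n]_x f x - \int[mu n.+1]_x f x| <= a n) ->
  (forall n, \sum_(0 <= i < n) a i <= M) ->
  exists pi, weakly_cvg rho mu pi.
Proof.
move=> mu_a a_le_M; pose e n : R := (1 / 2) ^+ n.
have e_gt0 n : 0 < e n by rewrite exprn_gt0.
have /choice[q q_e] n := exists_quantizer polish_rho (mu n) (e_gt0 n).
have [U [u [m_u u_step u_law]]] := exists_quantized_sequence q_e mu_a.
have step_sum n : \sum_(0 <= i < n) (a i + e i + e i.+1) <= M + 4.
  have e_sum : \sum_(0 <= i < n) e i <= 2.
    have -> : 2 = 1 * (1 - 1 / 2)^-1 :> R by field.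
    apply: le_trans (geometric_le_lim n ler01 _ _); [|lra|rewrite ger0_norm; lra].
    by rewrite le_eqVlt; apply: predU1l; apply: eq_bigr => i _; rewrite [RHS]mul1r.
  apply: (@le_trans _ _ (\sum_(0 <= i < n) (a i + 2 * e i))).
    apply: ler_sum => i _; rewrite -addrA lerD2l.
    by have := e_gt0 i; rewrite /e exprS; lra.
  by rewrite big_split/= -mulr_sumr; have := a_le_M n; lra.
have [pi u_pi] := summable_law_limit polish_rho m_u u_step step_sum.
exists pi; apply: (quantized_weakly_cvg q_e).
  by apply: cvg_expr; rewrite ger0_norm; lra.
by move=> f f_lip; under eq_fun do rewrite -u_law//; exact: u_pi.
Qed.

End weak_completeness.

(** * Ergodicity *)

Definition exponentially_ergodic (R : realType) (d : measure_display)
    (E : measurableType d) (rho : E -> E -> R) (P : R -> E -> probability E R)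
    (pi : probability E R) (w : E -> R) :=
  exists A kappa : R, [/\ 0 < A, 0 < kappa &
    forall f t x, Lip1 rho f -> 0 <= t ->
      `|Psg P t f x - \int[pi]_y f y| <= A * w x * expR (- (kappa * t))].

Section ergodicity.
Context {R : realType} {d : measure_display} {E : measurableType d}.
Variables (rho : E -> E -> R) (P : R -> E -> probability E R).
Variables (V : E -> R) (gamma K : R) (theta : E -> E -> R) (r L Rf : R -> R).
Variable eps : R.
Hypotheses (polish_rho : polish rho) (markov_P : markov_tf P).
Hypotheses (measurable_V : measurable_fun setT V) (V_ge0 : forall x, 0 <= V x).
Hypotheses (gamma_gt0 : 0 < gamma) (K_gt0 : 0 < K).
Hypothesis drift_V : lyapunov_drift P V gamma K.
Hypothesis premetric_theta : premetric rho theta.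
Hypothesis rho_theta : forall x y, Num.min (rho x y) 1 <= theta x y.
Hypothesis assumptionA_P : assumptionA P theta r L.
Hypothesis assumptionB2_P :
  assumptionB2 P theta [set x | V x <= 4 * K / gamma] Rf eps.
Implicit Types (f : E -> R) (x y : E) (s t u delta : R).

Local Notation C := (K / gamma).

Lemma Lip1_wlip (N b delta : R) f : 1 <= N -> 0 <= b -> 0 < delta < 1 ->
  Lip1 rho f -> wlip V (tcost theta N) b delta 1 f.
Proof.
move=> N1 b0 /andP[d0 d1] f_lip; have N0 : 0 <= N by exact: le_trans ler01 N1.
split=> [|x y]; first exact: Lip1_unit_mfun f_lip.
apply: (le_trans (Lip1_tdist x y f_lip)); rewrite mul1r /wcost.
set c := tcost theta N x y.
have /andP[c0 c1] : 0 <= c <= 1.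
  exact: (tcost_unit_mfun polish_rho premetric_theta N0).2 (x, y).
have theta0 : 0 <= theta x y by case: premetric_theta.
apply: (@le_trans _ _ c).
  rewrite /c /tcost le_min tdist_le1 andbT (le_trans (rho_theta x y))//.
  by rewrite ler_peMl.
apply: (@le_trans _ _ (c `^ (1 - delta))).
  move: c0; rewrite le_eqVlt => /predU1P[<-|c0]; first exact: powR_ge0.
  by apply: ger1_powR; rewrite ?c0//= gerBl ltW.
rewrite ler_peMr ?powR_ge0// powR_ge1// ?(ltW d0)// lerDl mulr_ge0//.
by rewrite addr_ge0.
Qed.

Lemma Psg_geometric_rate delta : 0 < delta < 1 ->
  exists T b al : R, [/\ 0 < T, 0 < b, 0 < al < 1 &
  forall f n s u x y, Lip1 rho f -> 0 <= s -> 0 <= u ->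
    `|Psg P (s + n%:R * T) f x - Psg P (u + n%:R * T) f y| <=
    al ^+ n * (1 + b * ((V x + C) + (V y + C))) `^ delta].
Proof.
move=> delta01; have [T [N [b [al [T0 N1 b0 al01 contr]]]]] :=
  Psg_contraction polish_rho markov_P measurable_V V_ge0 gamma_gt0 K_gt0 drift_V
    premetric_theta assumptionA_P assumptionB2_P delta01.
have N0 : 0 <= N by exact: le_trans ler01 N1.
have al0 : 0 <= al by case/andP: al01 => /ltW.
exists T, b, al; split=> // f n s u x y f_lip s0 u0.
have uf := Lip1_unit_mfun polish_rho f_lip.
have wlip_n : wlip V (tcost theta N) b delta (al ^+ n) (Psg P (n%:R * T) f).
  elim: n => [|n IH]; first by rewrite mul0r Psg0//; exact: Lip1_wlip N1 (ltW b0) _ _.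
  by rewrite Psg_natmulS ?(ltW T0)// exprS; apply: contr; rewrite // exprn_ge0.
have nT0 : 0 <= n%:R * T by rewrite mulr_ge0// ltW.
rewrite !(PsgD markov_P _ nT0 uf)//.
have PV_le := lyapunov_bound markov_P measurable_V V_ge0 gamma_gt0 K_gt0 drift_V.
exact: (wlip_product measurable_V V_ge0 (tcost_unit_mfun polish_rho premetric_theta N0)
  (ltW b0) delta01 (PV_le _ x s0) (PV_le _ y u0) (exprn_ge0 n al0) wlip_n).
Qed.

Lemma geometric_le_expR (al T t : R) : 0 < al < 1 -> 0 < T -> 0 <= t ->
  al ^+ Num.truncn (t / T) <= al^-1 * expR (- (- ln al / T * t)).
Proof.
move=> /andP[al0 al1] T0 t0; set n := Num.truncn _.
rewrite ler_pdivlMl// -exprS -[al in leLHS]lnK ?posrE//.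
rewrite -expRM_natl ler_expR (_ : - (_ * t) = t / T * ln al); last by ring.
by rewrite ler_wnM2r ?ltW// ?truncnS_gt// ln_lt0// al0.
Qed.

Lemma Psg_exponential_rate delta : 0 < delta < 1 ->
  exists A b kappa : R, [/\ 0 < A, 0 < b, 0 < kappa &
  forall f t u x y, Lip1 rho f -> 0 <= t -> t <= u ->
    `|Psg P t f x - Psg P u f y| <=
    A * expR (- (kappa * t)) * (1 + b * ((V x + C) + (V y + C))) `^ delta].
Proof.
move=> delta01; have [T [b [al [T0 b0 al01 rate]]]] := Psg_geometric_rate delta01.
have /andP[al0 al1] := al01.
exists al^-1, b, (- ln al / T); split=> //; first by rewrite invr_gt0.
  by rewrite divr_gt0// oppr_gt0 ln_lt0.
move=> f t u x y f_lip t0 tu; pose n := Num.truncn (t / T).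
have nT_le_t : n%:R * T <= t by rewrite -ler_pdivlMr// truncn_le// divr_ge0// ltW.
have := rate f n (t - n%:R * T) (u - n%:R * T) x y f_lip.
rewrite !subrK !subr_ge0 => /(_ nT_le_t (le_trans nT_le_t tu))/le_trans; apply.
by rewrite ler_wpM2r ?powR_ge0// geometric_le_expR.
Qed.

Lemma powR_affine_le (b D delta : R) : 0 < b -> 0 <= D -> 0 < delta ->
  exists2 A : R, 0 < A & forall v, 0 <= v ->
    (1 + b * (v + D)) `^ delta <= A * (1 + (gamma * v) `^ delta).
Proof.
move=> b0 D0 d0; set a := 1 + b * D.
have a0 : 0 < a by rewrite ltr_wpDr// mulr_ge0// ltW.
exists ((2 * a) `^ delta + (2 * b / gamma) `^ delta).
  by rewrite ltr_wpDr ?powR_ge0// powR_gt0// mulr_gt0.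
move=> v v0; have bv0 : 0 <= b * v by rewrite mulr_ge0// ltW.
rewrite (_ : 1 + b * (v + D) = a + b * v); last by rewrite /a; ring.
have av0 : 0 <= a + b * v by rewrite addr_ge0// ltW.
have := powR_ge0 (2 * a) delta; have := powR_ge0 (2 * b / gamma) delta.
have := powR_ge0 (gamma * v) delta => gv_ge0 b_ge0 a_ge0.
have := mulr_ge0 a_ge0 gv_ge0; have := mulr_ge0 b_ge0 gv_ge0.
have [bv_le_a|/ltW a_le_bv] := leP (b * v) a.
  have : (a + b * v) `^ delta <= (2 * a) `^ delta.
    by apply: ge0_le_powR => //; [exact: ltW|lra].
  lra.
have : (a + b * v) `^ delta <= (2 * b / gamma) `^ delta * (gamma * v) `^ delta.
  have gv0 : 0 <= gamma * v by rewrite mulr_ge0// ltW.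
  have bg0 : 0 <= 2 * b / gamma by rewrite divr_ge0 ?mulr_ge0// ltW.
  rewrite -powRM//; apply: ge0_le_powR => //; first exact: ltW.
  rewrite (_ : 2 * b / gamma * (gamma * v) = 2 * (b * v)); first lra.
  by field; rewrite gt_eqF.
lra.
Qed.

Lemma exists_weak_limit : exists pi : probability E R,
  weakly_cvg rho (fun n => P n%:R point) pi.
Proof.
have half01 : 0 < (1 / 2 : R) < 1 by lra.
have [A [b [kappa [A0 _ kappa0 rate]]]] := Psg_exponential_rate half01.
set B := (1 + b * ((V point + C) + (V point + C))) `^ (1 / 2).
have q1 : expR (- kappa) < 1 by rewrite expR_lt1 oppr_lt0.
apply: (weakly_complete polish_rho (a := fun n => A * B * expR (- kappa) ^+ n)
  (M := A * B * (1 - expR (- kappa))^-1)) => [n f f_lip|n].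
  have -> : A * B * expR (- kappa) ^+ n = A * expR (- (kappa * n%:R)) * B.
    by rewrite -expRM_natl mulrN (mulrC n%:R); ring.
  by apply: (rate f n%:R n.+1%:R point point); rewrite ?ler_nat.
apply: le_trans (geometric_le_lim n _ (expR_gt0 _) _).
- by rewrite le_eqVlt; apply: predU1l; apply: eq_bigr.
- by rewrite mulr_ge0 ?powR_ge0// ltW.
- by rewrite ger0_norm ?expR_ge0.
Qed.

Lemma exists_exponentially_ergodic : exists pi : probability E R,
  forall delta, 0 < delta < 1 ->
    exponentially_ergodic rho P pi (fun x => 1 + (gamma * V x) `^ delta).
Proof.
have [pi pi_lim] := exists_weak_limit; exists pi => delta delta01.
have [A [b [kappa [A0 b0 kappa0 rate]]]] := Psg_exponential_rate delta01.
have C0 : 0 < C by exact: divr_gt0.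
have D0 : 0 <= C + (V point + C) by rewrite !addr_ge0// ltW.
have [B B0 affine_le] := powR_affine_le b0 D0 (andP delta01).1.
exists (A * B), kappa; split=> //; first exact: mulr_gt0.
move=> f t x f_lip t0; apply/ler_addgt0Pr => e e0.
have /cvgrPdist_le/(_ e e0)[m0 _ near_pi] := pi_lim f f_lip.
pose m := maxn m0 (Num.truncn t).+1.
have m_near := near_pi m (leq_maxl _ _); rewrite distrC in m_near.
have t_le_m : t <= m%:R.
  by rewrite (le_trans (ltW (truncnS_gt t)))// ler_nat leq_maxr.
apply: le_trans (ler_distD (Psg P m%:R f point) _ _) _; apply: lerD m_near.
apply: le_trans (rate f t m%:R x point f_lip t0 t_le_m) _.
rewrite -[V x + C + _]addrA [leRHS](_ : _ = A * expR (- (kappa * t)) *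
  (B * (1 + (gamma * V x) `^ delta))); last by ring.
by rewrite ler_wpM2l ?mulr_ge0 ?expR_ge0 ?(ltW A0)// affine_le.
Qed.

End ergodicity.

Lemma exponential_rate_cvg (R : realType) (h : R -> R) (l A kappa s : R) :
  0 < kappa -> 0 <= s ->
  (forall t, 0 <= t -> `|h t - l| <= A * expR (- (kappa * t))) ->
  h (s + n%:R) @[n --> \oo] --> l.
Proof.
move=> kappa0 s0 h_rate.
have A0 : 0 <= A.
  by have := h_rate 0 (lexx _); rewrite mulr0 oppr0 expR0 mulr1; apply: le_trans.
have q1 : `|expR (- kappa)| < 1.
  by rewrite ger0_norm ?expR_ge0// expR_lt1 oppr_lt0.
have bound_cvg : A * expR (- kappa) ^+ n @[n --> \oo] --> 0.
  by rewrite -(mulr0 A); apply: cvgM; [exact: cvg_cst|exact: cvg_expr].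
apply/subr_cvg0/norm_cvg0P; apply: (squeeze_cvgr _ (cvg_cst 0) bound_cvg).
apply: nearW => n; rewrite normr_ge0/= (le_trans (h_rate _ _)) ?addr_ge0//.
by rewrite ler_wpM2l// -expRM_natl ler_expR mulrN lerN2 [leLHS]mulrC ler_pM2l// lerDr.
Qed.

Section invariance.
Context {R : realType} {d : measure_display} {E : measurableType d}.
Variables (rho : E -> E -> R) (P : R -> E -> probability E R).
Variables (pi : probability E R) (w : E -> R).
Hypotheses (polish_rho : polish rho) (markov_P : markov_tf P) (feller_P : feller rho P).
Hypothesis ergodic_pi : exponentially_ergodic rho P pi w.

Lemma exponentially_ergodic_cvg f s x : Lip1 rho f -> 0 <= s ->
  Psg P (s + n%:R) f x @[n --> \oo] --> \int[pi]_y f y.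
Proof.
move=> f_lip s_ge0; have [A [kappa [_ kappa_gt0 rate]]] := ergodic_pi.
exact: exponential_rate_cvg kappa_gt0 s_ge0 (fun t => rate f t x f_lip).
Qed.

Lemma exponentially_ergodic_invariant : is_invariant P pi.
Proof.
move=> t A t0 mA; have [nu nuE] := exists_markov_image markov_P pi t0.
rewrite nuE//; apply/esym; move: A mA; apply: (prob_eq_Lip1 polish_rho) => f f_lip.
have uf := Lip1_unit_mfun polish_rho f_lip.
rewrite -(Rintegral_Psg markov_P t0 uf nuE).
have Pf_continuous : rho_continuous rho (Psg P t f).
  suff f_bounded : Defs.bounded_fun f.
    by case: (feller_P t0 f_bounded (Lip1_continuous polish_rho f_lip)).
  by exists 1 => x; have /andP[f0 f1] := f_lip.1 x; rewrite ger0_norm.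
have pi_lim : weakly_cvg rho (fun n => P n%:R point) pi.
  move=> g g_lip; have := exponentially_ergodic_cvg point g_lip (lexx 0).
  by under eq_fun do rewrite add0r.
apply/esym/(weakly_cvg_continuous_eq polish_rho pi_lim) => //.
  exact: (Psg_unit_mfun markov_P t0 uf).2.
have := exponentially_ergodic_cvg point f_lip t0; under eq_fun do rewrite addrC PsgD//.
exact.
Qed.

Lemma exponentially_ergodic_unique (mu : probability E R) : is_invariant P mu ->
  forall A, measurable A -> mu A = pi A.
Proof.
move=> mu_inv; apply: (prob_eq_Lip1 polish_rho) => f f_lip.
have uf := Lip1_unit_mfun polish_rho f_lip.
have mu_Pf n : \int[mu]_x Psg P n%:R f x = \int[mu]_x f x.
  by apply: Rintegral_Psg => // A mA; exact: mu_inv.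
have pi_f01 := unit_Rintegral pi uf.
have : \int[mu]_x Psg P n%:R f x @[n --> \oo] --> \int[mu]_x (\int[pi]_y f y).
  apply: unit_Rintegral_cvg => [n||].
  - exact: Psg_unit_mfun.
  - by split.
  - apply: aeW => x; have := exponentially_ergodic_cvg x f_lip (lexx 0).
    by under eq_fun do rewrite add0r.
under eq_fun do rewrite mu_Pf; rewrite Rintegral_prob_cst => mu_f_cvg.
exact: cvg_unique (cvg_cst _) mu_f_cvg.
Qed.

End invariance.

Section linear_rate.
Context {R : realType}.
Implicit Types gamma z y : R.

Lemma H_phi_linear gamma z : 0 < gamma -> 1 <= z ->
  H_phi (fun u => gamma * u) z = ln z / gamma.
Proof.
move=> g0; rewrite le_eqVlt => /orP[/eqP <-|z1].
  by rewrite /H_phi set_itv1 integral_set1 ln1 mul0r.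
have derive_ln (x : R) : 0 < x ->
    is_derive x 1 (fun u : R => ln u / gamma) (1 / (gamma * x)).
  move=> x0; have ln_x := is_derive1_ln x0.
  apply: is_derive_eq; rewrite scaler0 add0r.
  by rewrite -[_ *: _]/(_ * _) div1r invfM.
have cont_ln (x : R) : 0 < x -> {for x, continuous (fun u : R => ln u / gamma)}.
  by move=> x0; apply: cvgM; [exact: continuous_ln|exact: cvg_cst].
rewrite /H_phi (@continuous_FTC2 _ _ (fun u => ln u / gamma))//.
- by rewrite ln1 mul0r -EFinB subr0.
- apply: continuous_in_subspaceT => x; rewrite inE/= in_itv/= => /andP[x1 _].
  have x0 : 0 < x by exact: lt_le_trans x1.
  under eq_fun do rewrite div1r.
  apply: cvgV; first by rewrite mulf_neq0// gt_eqF.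
  by apply: cvgM; [exact: cvg_cst|exact: cvg_id].
- split.
  + move=> x; rewrite in_itv/= => /andP[x1 _].
    by have [] := derive_ln x (lt_trans ltr01 x1).
  + by apply: cvg_at_right_filter; exact: cont_ln.
  + by apply: cvg_at_left_filter; apply: cont_ln; exact: lt_trans z1.
- move=> x; rewrite in_itv/= => /andP[x1 _].
  by rewrite derive1E; have [_ ->] := derive_ln x (lt_trans ltr01 x1).
Qed.

Lemma H_phi_inv_linear gamma y : 0 < gamma -> 0 <= y ->
  1 <= H_phi_inv (fun u => gamma * u) y <= expR (gamma * y).
Proof.
move=> g0 y0; rewrite /H_phi_inv; case: xgetP => [z _ [z1 <-]|_].
  have z0 : 0 < z by exact: lt_le_trans z1.
  by rewrite H_phi_linear// mulrC divfK ?gt_eqF// lnK ?posrE// z1 lexx.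
by rewrite lexx/= -expR0 ler_expR mulr_ge0// ltW.
Qed.

Lemma expR_le_H_phi_inv gamma delta kappa t : 0 < gamma -> 0 < delta -> 0 < kappa ->
  0 <= t -> expR (- (kappa * t)) <= gamma `^ delta /
    (gamma * H_phi_inv (fun u => gamma * u) (kappa / (gamma * delta) * t)) `^ delta.
Proof.
move=> g0 d0 kappa0 t0.
have y0 : 0 <= kappa / (gamma * delta) * t.
  by rewrite mulr_ge0// ltW// divr_gt0// mulr_gt0.
have /andP[] := H_phi_inv_linear g0 y0; set z := H_phi_inv _ _ => z1 z_le.
have z0 : 0 < z by exact: lt_le_trans z1.
rewrite powRM ?(ltW g0) ?(ltW z0)// invfM mulrA divff ?gt_eqF ?powR_gt0// mul1r expRN.
rewrite lef_pV2 ?posrE ?powR_gt0 ?expR_gt0//.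
apply: le_trans (ge0_le_powR (ltW d0) (ltW z0) z_le) _.
rewrite -expRM ler_expR le_eqVlt; apply: predU1l; field.
by rewrite !gt_eqF.
Qed.

End linear_rate.

Theorem theorem2p8 (R : realType) (d : measure_display) (E : measurableType d)
  (rho : E -> E -> R) (P : R -> E -> probability E R)
  (V : E -> R) (gamma K : R) (theta : E -> E -> R) (r L Rf : R -> R) (eps : R) :
  polish rho ->
  markov_tf P ->
  feller rho P ->
  (* (1) Lyapunov condition *)
  measurable_fun [set: E] V -> (forall x, 0 <= V x) -> 0 < gamma -> 0 < K ->
  (forall t x, 0 <= t ->
     (\int[P t x]_y (V y)%:E
      + gamma%:E * \int[lebesgue_measure]_(s in `[0%R, t]%classic) \int[P s x]_y (V y)%:E
      <= (V x + K * t)%:E)%E) ->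
  (* (2) *)
  premetric rho theta ->
  (forall x y, Num.min (rho x y) 1 <= theta x y) ->
  (* (3) *)
  assumptionA P theta r L ->
  (* (4* ) *)
  assumptionB2 P theta [set x | V x <= 4 * K / gamma] Rf eps ->
  exists pi : probability E R,
    [/\ is_invariant P pi,
        (forall pi' : probability E R, is_invariant P pi' ->
           forall A, measurable A -> pi' A = pi A) &
        forall delta : R, 0 < delta < 1 ->
          let phi := fun u : R => gamma * u in
          exists C1 C2 : R, [/\ 0 < C1, 0 < C2 &
            forall x t, 0 <= t ->
              (wasserstein (fun a b => Num.min (rho a b) 1%R) (P t x) pi
               <= (C1 * (1 + phi (V x) `^ delta)
                   / (phi (H_phi_inv phi (C2 * t))) `^ delta)%R%:E)%E]].
Proof.
move=> polish_rho markov_P feller_P measurable_V V_ge0 gamma_gt0 K_gt0 drift_V.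
move=> premetric_theta rho_theta assumptionA_P assumptionB2_P.
have [pi ergodic_pi] := exists_exponentially_ergodic polish_rho markov_P measurable_V
  V_ge0 gamma_gt0 K_gt0 drift_V premetric_theta rho_theta assumptionA_P assumptionB2_P.
have half01 : 0 < (1 / 2 : R) < 1 by lra.
exists pi; split=> [||delta delta01 phi].
- exact: exponentially_ergodic_invariant (ergodic_pi _ half01).
- exact: exponentially_ergodic_unique (ergodic_pi _ half01).
have [A [kappa [A_gt0 kappa_gt0 rate]]] := ergodic_pi _ delta01.
have /andP[delta_gt0 _] := delta01.
exists (A * gamma `^ delta), (kappa / (gamma * delta)); split.
- by rewrite mulr_gt0// powR_gt0.
- by rewrite divr_gt0// mulr_gt0.
move=> x t t_ge0; apply: (kantorovich_rubinstein polish_rho) => f f_lip.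
apply: le_trans (rate f t x f_lip t_ge0) _.
apply: le_trans (ler_wpM2l _ (expR_le_H_phi_inv gamma_gt0 delta_gt0 kappa_gt0 t_ge0)) _.
  by rewrite mulr_ge0 ?addr_ge0 ?powR_ge0// ltW.
by rewrite mulrA [A * _ * _]mulrAC.
Qed.
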